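(* Let $n\ge1$, $\alpha\in\mathbb{R}\setminus\pi\mathbb{Z}$, and let $\phi,\psi$ be two wavelets satisfying $$\int_{\mathbb{R}_{0}^n}\left|\left(\mathfrak{F}_\alpha\left\{e^{-\frac{i}{2}\|\cdot\|^2\cot\alpha}\phi(\cdot)\right\}\right)(u)\right|\left|\left(\mathfrak{F}_\alpha\left\{e^{-\frac{i}{2}\|\cdot\|^2\cot\alpha}\psi(\cdot)\right\}\right)(u)\right|\frac{1}{|u|_{p}}\,du<\infty .$$ Let $f,g\in L^2(\mathbb{R}^n)$ and let $W_{\phi,\alpha}f$ and $W_{\psi,\alpha}g$ be the continuous fractional wavelet transforms of $f$ and $g$ with respect to $\phi$ and $\psi$ respectively. Then $$\int_{\mathbb{R}_{0}^n}\int_{\mathbb{R}^n}(W_{\phi,\alpha}f)(b,a)\,\overline{(W_{\psi,\alpha}g)(b,a)}\,\frac{db\,da}{|a|_{p}^2}=\frac{C_{\phi,\psi,\alpha}}{|C_{\alpha}|^2}\langle f,g\rangle_{L^2(\mathbb{R}^n)},$$ where $$C_{\phi,\psi,\alpha}=\int_{\mathbb{R}_{0}^n}\overline{\left(\mathfrak{F}_\alpha\left\{e^{-\frac{i}{2}\|\cdot\|^2\cot\alpha}\phi(\cdot)\right\}\right)(u)}\left(\mathfrak{F}_\alpha\left\{e^{-\frac{i}{2}\|\cdot\|^2\cot\alpha}\psi(\cdot)\right\}\right)(u)\frac{1}{|u|_{p}}\,du.$$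
   Context: For $x,y\in\mathbb{R}^n$: $\|x\|$ is the Euclidean norm, $\langle x,y\rangle$ the Euclidean inner product, $|x|_p=|x_1x_2\cdots x_n|$, and $\mathbb{R}_0^n=\{x\in\mathbb{R}^n:|x|_p\ne 0\}$. For $y\in\mathbb{R}^n_0$, $\frac{x}{y}=(x_1/y_1,\dots,x_n/y_n)$. $\langle f,g\rangle_{L^2(\mathbb{R}^n)}=\int_{\mathbb{R}^n} f\overline{g}$. For $\alpha\in\mathbb{R}\setminus\pi\mathbb{Z}$ let $C_\alpha=\left(\frac{1-i\cot\alpha}{2\pi}\right)^{n/2}$ (principal branch) and $K_\alpha(t,\xi)=C_\alpha e^{\frac{i}{2}(\|t\|^2+\|\xi\|^2)\cot\alpha-i\langle t,\xi\rangle\csc\alpha}$. The fractional Fourier transform (FrFT) of $f\in L^1(\mathbb{R}^n)$ is $(\mathfrak{F}_\alpha f)(\xi)=\int_{\mathbb{R}^n}f(t)K_\alpha(t,\xi)\,dt$. For $f\in L^2(\mathbb{R}^n)$, $\mathfrak{F}_\alpha f\in L^2(\mathbb{R}^n)$ is the $L^2$-limit of $\mathfrak{F}_\alpha f_k$ for any sequence $f_k\in L^1\cap L^2$ converging to $f$ in $L^2(\mathbb{R}^n)$. For $\psi\in L^2(\mathbb{R}^n)$, $a\in\mathbb{R}^n_0$, $b\in\mathbb{R}^n$: $\psi_{a,b,\alpha}(t)=\frac{1}{\sqrt{|a|_p}}\psi\left(\frac{t-b}{a}\right)e^{-\frac{i}{2}(\|t\|^2-\|b\|^2)\cot\alpha}$.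 A non-zero $\psi\in L^2(\mathbb{R}^n)$ is a wavelet (wavelet admissible) if $\int_{\mathbb{R}_0^n}\int_{\mathbb{R}^n}|\langle\psi_{a,b,\alpha},\psi\rangle_{L^2(\mathbb{R}^n)}|^2\frac{db\,da}{|a|_p^2}<\infty$. The continuous fractional wavelet transform (CFrWT) of $f$ with respect to $\psi$ is $(W_{\psi,\alpha}f)(b,a)=\int_{\mathbb{R}^n}f(t)\overline{\psi_{a,b,\alpha}(t)}\,dt$, $(b,a)\in\mathbb{R}^n\times\mathbb{R}_0^n$. *)

(* Defs.v *)
From HB Require Import structures.
From mathcomp Require Import all_boot all_order all_algebra.
From mathcomp Require Import all_classical all_reals all_analysis.
From mathcomp Require Import complex.

Set Implicit Arguments.
Unset Strict Implicit.
Unset Printing Implicit Defensive.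
Import Order.TTheory GRing.Theory Num.Theory.
Import numFieldNormedType.Exports.

Local Open Scope classical_set_scope.
Local Open Scope ring_scope.
Local Open Scope complex_scope.

(* R^n is the type of n-tuples with the library's product sigma-algebra;
   measurableTypeR R is R equipped with its Borel sigma-algebra. *)
Notation Rn R n := (n.-tuple (measurableTypeR R)).
Notation normc := ComplexField.Normc.normc.

Section lebesgue_Rn.
Context (R : realType).

Definition tcons n (p : measurableTypeR R * Rn R n) : Rn R n.+1 :=
  [tuple of p.1 :: p.2].

Lemma measurable_tcons n : measurable_fun [set: _] (@tcons n).
Proof. exact: measurable_cons. Qed.

(* Lebesgue measure on R x R^n, transported along R x R^n ~ R^n.+1 *)
Definition lebesgue_tcons n
    (mu : {sigma_finite_measure set (Rn R n) -> \bar R}) :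
    set (Rn R n.+1) -> \bar R :=
  pushforward (lebesgue_measure \x mu)%E (@tcons n).

Section lebesgue_tcons_measure.
Context n (mu : {sigma_finite_measure set (Rn R n) -> \bar R}).
Let m : {measure set (Rn R n.+1) -> \bar R} :=
  measure_function_pushforward__canonical__measure_function_Measure
    (lebesgue_measure \x mu)%E (@measurable_tcons n).

HB.instance Definition _ := isMeasure.Build _ _ _ (lebesgue_tcons mu)
  (measure0 m) (measure_ge0 m) (@measure_semi_sigma_additive _ _ _ m).

Let sigma_finite_tcons : sigma_finite setT (lebesgue_tcons mu).
Proof.
have /sigma_finiteP[F [TF ndF Foo]] := sigma_finiteT (@lebesgue_measure R).
have /sigma_finiteP[G [TG ndG Goo]] := sigma_finiteT mu.
pose un (x : Rn R n.+1) : (measurableTypeR R * Rn R n)%type :=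
  (thead x, [tuple of behead x]).
have mun : measurable_fun setT un.
  apply/measurable_fun_pairP; split => /=; last exact: measurable_behead.
  exact: measurable_tnth.
exists (fun k => un @^-1` (F k `*` G k)).
  apply/seteqP; split => // x _.
  have [i _ Fi] : (\bigcup_i F i) (thead x) by rewrite -TF.
  have [j _ Gj] : (\bigcup_j G j) [tuple of behead x] by rewrite -TG.
  exists (maxn i j) => //; split => /=.
  - by move: Fi; exact/subsetPset/ndF/leq_maxl.
  - by move: Gj; exact/subsetPset/ndG/leq_maxr.
move=> k; have [mF Fk] := Foo k; have [mG Gk] := Goo k; split.
  by rewrite -[X in measurable X]setTI; apply: mun => //; exact: measurableX.
rewrite /lebesgue_tcons /pushforward (_ : _ @^-1` _ = F k `*` G k).
  by rewrite product_measure1E// lte_mul_pinfty// ge0_fin_numE.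
rewrite -comp_preimage (_ : un \o @tcons n = id) ?preimage_id//.
by apply/funext => -[x t]; congr pair; exact: val_inj.
Qed.

HB.instance Definition _ := Measure_isSigmaFinite.Build _ _ _
  (lebesgue_tcons mu) sigma_finite_tcons.

End lebesgue_tcons_measure.

Fixpoint lebesgue_Rn n : {sigma_finite_measure set (Rn R n) -> \bar R} :=
  match n with
  | 0 => \d_([tuple] : Rn R 0)
  | n'.+1 => lebesgue_tcons (lebesgue_Rn n')
  end.

Lemma lebesgue_Rn_box n (A : 'I_n -> set (measurableTypeR R)) :
  (forall i, measurable (A i)) ->
  lebesgue_Rn n [set x | forall i, A i (tnth x i)] =
  (\prod_(i < n) lebesgue_measure (A i))%E.
Proof.
elim: n A => [|n IH] A mA.
  by rewrite big_ord0 /= diracE mem_set// => -[].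
rewrite big_ord_recl -(IH (fun i => A (lift ord0 i)))// -product_measure1E//.
  congr product_measure1; apply/seteqP; split => -[x t] /=.
    by move=> At; split=> [|i]; [have := At ord0|have := At (lift ord0 i)];
      rewrite ?tnth0// tnthS.
  by move=> [Ax At] i; case: (unliftP ord0 i) => [j|] ->; rewrite ?tnth0// tnthS.
rewrite (_ : [set _ | _] =
    \bigcap_(i : 'I_n) ((@tnth n _)^~ i @^-1` A (lift ord0 i))); last first.
  by apply/seteqP; split=> x /= Ax i; [move=> _|]; exact: Ax.
apply: fin_bigcap_measurable => // i _.
by rewrite -[X in measurable X]setTI; exact: measurable_tnth.
Qed.

End lebesgue_Rn.

Section integral.
Context (R : realType) (n : nat).
Implicit Types (D : set (Rn R n)) (f g : Rn R n -> R[i]).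
Local Notation leb := (lebesgue_Rn R n).

Definition cintegrable D f :=
  leb.-integrable D (EFin \o (@complex.Re R \o f)) /\
  leb.-integrable D (EFin \o (@complex.Im R \o f)).

Definition cintegral D f : R[i] :=
  Rintegral leb D (@complex.Re R \o f) +i* Rintegral leb D (@complex.Im R \o f).

Definition cmeasurable f :=
  measurable_fun setT (@complex.Re R \o f) /\ measurable_fun setT (@complex.Im R \o f).

Definition cLnorm (p : \bar R) f : \bar R := 'N[leb]_p[EFin \o (@normc R \o f)]%E.

Definition inLp p f := cmeasurable f /\ (cLnorm p f < +oo)%E.

Definition cdotL2 f g : R[i] := cintegral setT (fun t => f t * (g t)^*%C).

End integral.

Section vectors.
Context (R : realType) (n : nat).
Implicit Types x y : Rn R n.

Definition coord x (i : 'I_n) : R := tnth x i.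

Definition dotRn x y : R := \sum_(i < n) coord x i * coord y i.

Definition normRn x : R := Num.sqrt (dotRn x x).

Definition absp x : R := `|\prod_(i < n) coord x i|.

Definition R0n : set (Rn R n) := [set x | absp x != 0].

Definition subRn x y : Rn R n := [tuple (coord x i - coord y i : R) | i < n].

Definition divRn x y : Rn R n := [tuple (coord x i / coord y i : R) | i < n].

End vectors.

Arguments R0n {R n}.

Section complex_functions.
Context (R : realType).
Implicit Types (z : R[i]) (x : R).

Definition cot x : R := cos x / sin x.

Definition csc x : R := (sin x)^-1.

Definition expi x : R[i] := cos x +i* sin x.

(* principal argument, in ]-pi, pi] *)
Definition carg z : R :=
  if 0 <= complex.Im z then acos (complex.Re z / normc z) else - acos (complex.Re z / normc z).

(* principal branch of the power with real exponent *)
Definition cpowR z x : R[i] := (normc z `^ x)%:C * expi (x * carg z).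

End complex_functions.

Section FrFT.
Context (R : realType) (n : nat) (alpha : R).
Implicit Types (f F psi : Rn R n -> R[i]) (a b t xi : Rn R n).

Definition Calpha : R[i] :=
  cpowR ((1 -i* cot alpha) / (2 * pi)%:C) (n%:R / 2).

Definition Kalpha t xi : R[i] :=
  Calpha * expi ((normRn t ^+ 2 + normRn xi ^+ 2) * cot alpha / 2
                 - dotRn t xi * csc alpha).

Definition FrFT_L1 f xi : R[i] := cintegral setT (fun t => f t * Kalpha t xi).

Definition is_FrFT_L2 f F :=
  inLp 2%:E F /\
  forall f_ : nat -> (Rn R n -> R[i]),
    (forall k, inLp 1%:E (f_ k) /\ inLp 2%:E (f_ k)) ->
    cLnorm 2%:E (f_ k \- f) @[k --> \oo] --> 0%E ->
    cLnorm 2%:E (FrFT_L1 (f_ k) \- F) @[k --> \oo] --> 0%E.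

(* A chosen representative of the L^2 transform, which is determined up to
   almost-everywhere equality; 0 is a junk value for f outside L^2. *)
Definition FrFT f : Rn R n -> R[i] := xget (fun=> 0) (is_FrFT_L2 f).

Definition chirp f t : R[i] := expi (- (normRn t ^+ 2 * cot alpha / 2)) * f t.

Definition wavelet_atom psi a b t : R[i] :=
  ((Num.sqrt (absp a))^-1)%:C * psi (divRn (subRn t b) a)
  * expi (- ((normRn t ^+ 2 - normRn b ^+ 2) * cot alpha / 2)).

Definition wavelet psi :=
  [/\ inLp 2%:E psi,
      ~ {ae lebesgue_Rn R n, forall t, psi t = 0} &
      (\int[lebesgue_Rn R n]_(a in R0n) \int[lebesgue_Rn R n]_b
         (normc (cdotL2 (wavelet_atom psi a b) psi) ^+ 2
          / absp a ^+ 2)%:E < +oo)%E].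

Definition CFrWT psi f b a : R[i] :=
  cintegral setT (fun t => f t * (wavelet_atom psi a b t)^*%C).

Definition Cphipsi (phi psi : Rn R n -> R[i]) : R[i] :=
  cintegral R0n (fun u => (FrFT (chirp phi) u)^*%C * FrFT (chirp psi) u
                          * ((absp u)^-1)%:C).

End FrFT.

Arguments Calpha {R} n alpha.

(* Main.v *)
Require Import Defs.
From HB Require Import structures.
From mathcomp Require Import all_boot all_order all_algebra.
From mathcomp Require Import all_classical all_reals all_analysis.
From mathcomp Require Import complex.
From mathcomp Require Import measurable_realfun ring lra.

Set Implicit Arguments.
Unset Strict Implicit.
Unset Printing Implicit Defensive.
Import Order.TTheory GRing.Theory Num.Theory.
Import numFieldNormedType.Exports.

Local Open Scope classical_set_scope.
Local Open Scope ring_scope.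
Local Open Scope complex_scope.

(** The wavelet transform at dilation a, as a function of the translation b, is a
    phase times |a|^(-1/2) times the correlation of F with the dilate of phi, where
    F is f multiplied by exp(i |t|^2 cot alpha / 2) (CFrWTE). Let P and Q be the
    Fourier transforms, at scale s = csc alpha, of F and phi. By Parseval's
    identity the correlation is a multiple of the inverse Fourier transform of
    the function P(xi) conj(Q(a xi)) of xi (corr_FT). Plancherel's identity
    in b therefore turns the left-hand side of the orthogonality relation into
    the integral over (xi, a) of

      P(xi) conj(P'(xi)) conj(Q(a xi)) Q'(a xi) / |a|,

    where P' and Q' belong to g and psi. As da / |a| is invariant under the
    dilation a |-> a xi, the integral over a does not depend on xi and equals the
    integral of conj(Q(u)) Q'(u) / |u|. This is the constant of the theorem divided
    by |C_alpha|^2, because the fractional transform of the chirped phi is C_alpha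
    times a phase times Q (FrFT_chirp). What remains is the inner product of P
    and P', hence that of f and g by Parseval's identity again. The powers of
    2 pi / |s| of the two identities cancel (cint_corr2).

    The exchange of integrals rests on the case of equal factors, in which all
    integrands are nonnegative and Tonelli's theorem gives the identity in
    [0, +oo] (energy_corr). Taking f = phi there shows that for a wavelet the
    integral of |Q(u)|^2 / |u| is finite (wavelet_admissibility). The kernel above
    is then a product of two square-integrable functions of (xi, a), hence
    integrable.

    Plancherel's identity is needed in a strong form: for every integrable function
    H on R^n, both sides being possibly infinite, since the function
    P(xi) conj(Q(a xi)) is only known to be integrable. On the line it is first
    proved for bounded continuous H by inserting the weights exp(-|b| / (k + 1)),
    whose transforms are Cauchy kernels (Plancherel_line_continuous). Means over
    short intervals reduce the general case to this one by Lebesgue's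
    differentiation theorem and Fatou's lemma (Plancherel_line). Dimension n
    follows by induction (Plancherel_Rn). Density of integrable functions and
    completeness then give the transform of square-integrable functions
    (L2FT_exists). *)

Notation Re := (@complex.Re _).
Notation Im := (@complex.Im _).

(** * Moduli and phases of complex numbers *)

Section complex_modulus.
Context {R : realType}.
Implicit Types (z w : R[i]) (x y : R).

Lemma ReD z w : Re (z + w) = Re z + Re w. Proof. by case: z w => [? ?] []. Qed.
Lemma ImD z w : Im (z + w) = Im z + Im w. Proof. by case: z w => [? ?] []. Qed.
Lemma ReN z : Re (- z) = - Re z. Proof. by case: z. Qed.
Lemma ImN z : Im (- z) = - Im z. Proof. by case: z. Qed.
Lemma ReM z w : Re (z * w) = Re z * Re w - Im z * Im w.
Proof. by case: z w => [? ?] []. Qed.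
Lemma ImM z w : Im (z * w) = Re z * Im w + Im z * Re w.
Proof. by case: z w => [? ?] []. Qed.
Lemma Reconj z : Re z^*%C = Re z. Proof. by case: z. Qed.
Lemma Imconj z : Im z^*%C = - Im z. Proof. by case: z. Qed.
Lemma Re_real x : Re x%:C = x. Proof. by []. Qed.
Lemma Im_real x : Im x%:C = 0. Proof. by []. Qed.

Definition ReImE := (ReD, ImD, ReN, ImN, ReM, ImM, Reconj, Imconj).

Lemma ReIm_inj z w : Re z = Re w -> Im z = Im w -> z = w.
Proof. by case: z w => [? ?] [? ?] /= -> ->. Qed.

Lemma sqr_normc z : normc z ^+ 2 = Re z ^+ 2 + Im z ^+ 2.
Proof. by case: z => a b /=; rewrite sqr_sqrtr// addr_ge0 ?sqr_ge0. Qed.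

Lemma normc_ge0 z : 0 <= normc z. Proof. by case: z => a b /=. Qed.

Lemma normc_le_sqr z x : 0 <= x -> Re z ^+ 2 + Im z ^+ 2 <= x ^+ 2 -> normc z <= x.
Proof. by move=> x0; rewrite -sqr_normc ler_pXn2r// nnegrE normc_ge0. Qed.

Lemma Re_le_normc z : `|Re z| <= normc z.
Proof.
rewrite -(@ler_pXn2r _ 2)// ?nnegrE ?normc_ge0// sqr_normc -normrX ger0_norm ?sqr_ge0//.
by rewrite lerDl sqr_ge0.
Qed.

Lemma Im_le_normc z : `|Im z| <= normc z.
Proof.
rewrite -(@ler_pXn2r _ 2)// ?nnegrE ?normc_ge0// sqr_normc -normrX ger0_norm ?sqr_ge0//.
by rewrite lerDr sqr_ge0.
Qed.

Lemma normc_le_ReIm z : normc z <= `|Re z| + `|Im z|.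
Proof.
apply: normc_le_sqr; first by rewrite addr_ge0.
by rewrite sqrrD !real_normK ?num_real// -addrA lerD2l lerDr mulrn_wge0// mulr_ge0.
Qed.

Lemma normc_conj z : normc z^*%C = normc z.
Proof. by case: z => a b /=; rewrite sqrrN. Qed.

Lemma normc_real x : normc x%:C = `|x|.
Proof. by rewrite /= expr0n /= addr0 sqrtr_sqr. Qed.

Lemma normc_expi x : normc (expi x) = 1.
Proof. by rewrite /= cos2Dsin2 sqrtr1. Qed.

Lemma mulc_conj z : z * z^*%C = (normc z ^+ 2)%:C.
Proof. by apply: ReIm_inj; rewrite !ReImE ?Re_real ?Im_real ?sqr_normc; ring. Qed.

Lemma realCM x y : (x * y)%:C = x%:C * y%:C.
Proof. by apply: ReIm_inj; rewrite ?ReImE /=; ring. Qed.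

Lemma realCB x y : (x - y)%:C = x%:C - y%:C.
Proof. by apply: ReIm_inj; rewrite ?ReImE /=; ring. Qed.

Lemma conjcM z w : (z * w)^*%C = z^*%C * w^*%C.
Proof. exact: rmorphM. Qed.

Lemma conjcB z w : (z - w)^*%C = z^*%C - w^*%C.
Proof. exact: rmorphB. Qed.

Lemma expiD x y : expi (x + y) = expi x * expi y.
Proof. by apply: ReIm_inj; rewrite !ReImE /= ?cosD ?sinD //; ring. Qed.

Lemma expi0 : expi 0 = 1 :> R[i].
Proof. by rewrite /expi cos0 sin0. Qed.

Lemma conj_expi x : (expi x)^*%C = expi (- x).
Proof. by rewrite /expi cosN sinN. Qed.

Lemma normcM z w : normc (z * w) = normc z * normc w.
Proof. exact: ComplexField.Normc.normcM. Qed.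

Lemma normcD z w : normc (z + w) <= normc z + normc w.
Proof. exact: le_normcD. Qed.

Lemma normcN z : normc (- z) = normc z.
Proof. exact: complex.normcN. Qed.

Lemma normc_eq0 z : normc z = 0 -> z = 0.
Proof. exact: ComplexField.Normc.eq0_normc. Qed.

Lemma normc0 : normc 0 = 0 :> R.
Proof. exact: ComplexField.Normc.normc0. Qed.

Lemma normcB z w : normc (z - w) = normc (w - z).
Proof. by rewrite -normcN opprB. Qed.

Lemma normc_sqrD z w : normc (z + w) ^+ 2 <= 2 * normc z ^+ 2 + 2 * normc w ^+ 2.
Proof.
rewrite !sqr_normc !ReImE -subr_ge0.
rewrite [leRHS](_ : _ = (Re z - Re w) ^+ 2 + (Im z - Im w) ^+ 2); last by ring.
by rewrite addr_ge0 ?sqr_ge0.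
Qed.

End complex_modulus.

(** * Measurable complex functions *)

Section measurable_complex.
Context {R : realType}.

Lemma measurable_inv : measurable_fun [set: R] (fun x : R => x^-1).
Proof.
(* This also holds at 0, where both sides are 0. *)
rewrite (_ : (fun x : R => x^-1) = (fun x => x * powR (x ^+ 2) (-1))); last first.
  apply/funext => x; have [->|x0] := eqVneq x 0; first by rewrite invr0 mul0r.
  by rewrite powR_inv1 ?sqr_ge0//; field.
apply: measurable_funM => //.
exact: (@measurableT_comp _ _ _ _ _ _ (@powR R ^~ (-1)) setT (fun x : R => x ^+ 2) (measurable_powR (-1)) (exprn_measurable 2)).
Qed.

Context d (T : measurableType d).
Implicit Types f g : T -> R[i].

(** The domain is arbitrary because the line, R^n and products of such spaces
    all occur. *)
Definition cmeas f :=
  measurable_fun [set: T] (Re \o f) /\ measurable_fun [set: T] (Im \o f).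

Lemma cmeas_cst c : cmeas (fun=> c).
Proof. by split; exact: measurable_cst. Qed.

Lemma cmeasD f g : cmeas f -> cmeas g -> cmeas (fun x => f x + g x).
Proof.
move=> [rf jf] [rg jg]; split.
- rewrite (_ : _ \o _ = (Re \o f) \+ (Re \o g)); first exact: measurable_funD.
  by apply/funext => x /=; rewrite ReD.
- rewrite (_ : _ \o _ = (Im \o f) \+ (Im \o g)); first exact: measurable_funD.
  by apply/funext => x /=; rewrite ImD.
Qed.

Lemma cmeasM f g : cmeas f -> cmeas g -> cmeas (fun x => f x * g x).
Proof.
move=> [rf jf] [rg jg]; split.
- rewrite (_ : _ \o _ = ((Re \o f) \* (Re \o g)) \- ((Im \o f) \* (Im \o g))).
    by apply: measurable_funB; exact: measurable_funM.
  by apply/funext => x /=; rewrite ReM.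
- rewrite (_ : _ \o _ = ((Re \o f) \* (Im \o g)) \+ ((Im \o f) \* (Re \o g))).
    by apply: measurable_funD; exact: measurable_funM.
  by apply/funext => x /=; rewrite ImM.
Qed.

Lemma cmeas_conj f : cmeas f -> cmeas (fun x => (f x)^*%C).
Proof.
move=> [rf jf]; split.
- by rewrite (_ : _ \o _ = (Re \o f))//; apply/funext => x /=; rewrite Reconj.
- rewrite (_ : _ \o _ = \- (Im \o f)); first exact: measurable_funN.
  by apply/funext => x /=; rewrite Imconj.
Qed.

Lemma cmeas_real (u : T -> R) : measurable_fun [set: T] u -> cmeas (fun x => (u x)%:C).
Proof. by move=> mu; split => //=; exact: measurable_cst. Qed.

Lemma cmeasB f g : cmeas f -> cmeas g -> cmeas (fun x => f x - g x).
Proof.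
move=> mf mg; rewrite (_ : (fun _ => _) = fun x => f x + (-1) * g x); last first.
  by apply/funext => x; rewrite mulN1r.
by apply: cmeasD => //; apply: cmeasM => //; exact: cmeas_cst.
Qed.

Lemma cmeas_expi (u : T -> R) : measurable_fun [set: T] u -> cmeas (fun x => expi (u x)).
Proof.
move=> mu; split.
- apply: (measurableT_comp _ mu); apply: continuous_measurable_fun.
  exact: continuous_cos.
- apply: (measurableT_comp _ mu); apply: continuous_measurable_fun.
  exact: continuous_sin.
Qed.

Lemma measurable_normc f : cmeas f -> measurable_fun [set: T] (fun x => normc (f x)).
Proof.
move=> [rf jf].
rewrite (_ : (fun _ => _) = (fun x => powR ((Re \o f) x ^+ 2 + (Im \o f) x ^+ 2) (2^-1))).
  apply: (measurableT_comp (measurable_powR (2^-1))).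
  by apply: measurable_funD; apply: measurable_funX.
apply/funext => x /=; rewrite powR12_sqrt; last by rewrite addr_ge0 ?sqr_ge0.
by case: (f x).
Qed.

Lemma measurable_normc2 f : cmeas f -> measurable_fun [set: T] (fun x => normc (f x) ^+ 2).
Proof. by move=> mf; apply: measurable_funX; exact: measurable_normc. Qed.

Lemma measurable_normc_EFin f : cmeas f -> measurable_fun [set: T] (fun x => (normc (f x))%:E).
Proof. by move=> mf; apply/measurable_EFinP; exact: measurable_normc. Qed.

Lemma measurable_normc2_EFin f : cmeas f ->
  measurable_fun [set: T] (fun x => (normc (f x) ^+ 2)%:E).
Proof. by move=> mf; apply/measurable_EFinP; exact: measurable_normc2. Qed.

End measurable_complex.

Lemma cmeas_comp {R : realType} d1 d2 (T1 : measurableType d1) (T2 : measurableType d2)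
    (f : T2 -> R[i]) (u : T1 -> T2) :
  cmeas f -> measurable_fun [set: T1] u -> cmeas (fun x => f (u x)).
Proof. by move=> [rf jf] mu; split; [exact: (measurableT_comp rf mu)|exact: (measurableT_comp jf mu)]. Qed.

(** * Integrals of complex functions *)

Section complex_integral.
Context {R : realType} d (T : measurableType d) (mu : {measure set T -> \bar R}).
Implicit Types f g : T -> R[i].

Definition cintg f :=
  mu.-integrable setT (EFin \o (Re \o f)) /\ mu.-integrable setT (EFin \o (Im \o f)).

Definition cint f : R[i] :=
  Rintegral mu setT (Re \o f) +i* Rintegral mu setT (Im \o f).

#[local] Arguments cint : simpl never.

Lemma Re_cint f : Re (cint f) = Rintegral mu setT (Re \o f). Proof. by []. Qed.
Lemma Im_cint f : Im (cint f) = Rintegral mu setT (Im \o f). Proof. by []. Qed.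

Lemma cintg_cmeas f : cintg f -> cmeas f.
Proof.
by move=> [/integrableP[/measurable_EFinP ? _] /integrableP[/measurable_EFinP ? _]].
Qed.

(** The modulus dominates each part and is dominated by their sum. *)
Lemma cintgP f :
  cintg f <-> cmeas f /\ (\int[mu]_x (normc (f x))%:E < +oo)%E.
Proof.
split=> [fi|[[rf jf] foo]].
  have [rf jf] := cintg_cmeas fi; split=> //.
  have [/integrableP[_ roo] /integrableP[_ joo]] := fi.
  apply: (@le_lt_trans _ _ (\int[mu]_x ((`|Re (f x)|)%:E + (`|Im (f x)|)%:E))%E).
    apply: ge0_le_integral => //=.
    - by move=> x _; rewrite lee_fin normc_ge0.
    - exact: measurable_normc_EFin.
    - by apply: emeasurable_funD; apply/measurable_EFinP; exact: measurableT_comp.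
    - by move=> x _; rewrite lee_fin normc_le_ReIm.
  rewrite ge0_integralD//=; [|by apply/measurable_EFinP; apply: measurableT_comp..].
  exact: lte_add_pinfty.
split; apply/integrableP; split; try exact/measurable_EFinP.
- apply: le_lt_trans foo; apply: ge0_le_integral => //=.
  + by apply/measurable_EFinP; apply: measurableT_comp.
  + exact: measurable_normc_EFin.
  + by move=> x _; rewrite lee_fin Re_le_normc.
- apply: le_lt_trans foo; apply: ge0_le_integral => //=.
  + by apply/measurable_EFinP; apply: measurableT_comp.
  + exact: measurable_normc_EFin.
  + by move=> x _; rewrite lee_fin Im_le_normc.
Qed.

Lemma cintg_le f (g : T -> R) : cmeas f -> measurable_fun [set: T] g ->
  (forall x, normc (f x) <= g x) -> (\int[mu]_x (g x)%:E < +oo)%E -> cintg f.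
Proof.
move=> mf mg fg goo; apply/cintgP; split=> //; apply: le_lt_trans goo.
apply: ge0_le_integral => //=.
- by move=> x _; rewrite lee_fin normc_ge0.
- exact: measurable_normc_EFin.
- exact/measurable_EFinP.
- by move=> x _; rewrite lee_fin.
Qed.

Lemma cintg_normc f : cintg f -> mu.-integrable setT (fun x => (normc (f x))%:E).
Proof.
move=> /cintgP[mf foo]; apply/integrableP; split.
  exact: measurable_normc_EFin.
by under eq_integral do rewrite /= ger0_norm ?normc_ge0//.
Qed.

Lemma cintgD f g : cintg f -> cintg g -> cintg (fun x => f x + g x).
Proof.
move=> [rf jf] [rg jg]; split.
- rewrite (_ : _ \o _ = ((EFin \o (Re \o f)) \+ (EFin \o (Re \o g)))%E).
    exact: integrableD.
  by apply/funext => x /=; rewrite ReD EFinD.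
- rewrite (_ : _ \o _ = ((EFin \o (Im \o f)) \+ (EFin \o (Im \o g)))%E).
    exact: integrableD.
  by apply/funext => x /=; rewrite ImD EFinD.
Qed.

Lemma cintgM_bounded f g (M : R) : cmeas f -> (forall x, normc (f x) <= M) ->
  cintg g -> cintg (fun x => f x * g x).
Proof.
move=> mf fM ig; have /cintgP[mg goo] := ig.
apply: (@cintg_le _ (fun x => `|M| * normc (g x))).
- exact: cmeasM.
- by apply: measurable_funM => //; exact: measurable_normc.
- move=> x; rewrite normcM ler_wpM2r ?normc_ge0//.
  by rewrite (le_trans (fM x))// ler_norm.
- under eq_integral do rewrite EFinM.
  rewrite ge0_integralZl_EFin//; [exact: lte_mul_pinfty| |].
  + by move=> x _; rewrite lee_fin normc_ge0.
  + exact: measurable_normc_EFin.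
Qed.

Lemma cintgZ c f : cintg f -> cintg (fun x => c * f x).
Proof. by apply: (@cintgM_bounded _ _ (normc c)) => //; exact: cmeas_cst. Qed.

Lemma cintg_conj f : cintg f -> cintg (fun x => (f x)^*%C).
Proof.
move=> /cintgP[mf foo]; apply/cintgP; split; first exact: cmeas_conj.
by under eq_integral do rewrite normc_conj.
Qed.

Lemma cint_ext f g : (forall x, f x = g x) -> cint f = cint g.
Proof. by move=> fg; congr cint; apply/funext. Qed.

Lemma cintD f g : cintg f -> cintg g ->
  cint (fun x => f x + g x) = cint f + cint g.
Proof.
move=> [rf jf] [rg jg]; apply: ReIm_inj; rewrite !ReImE !(Re_cint, Im_cint).
- by rewrite -RintegralD//; congr Rintegral; apply/funext => x /=; rewrite ReD.
- by rewrite -RintegralD//; congr Rintegral; apply/funext => x /=; rewrite ImD.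
Qed.

Lemma cintZ c f : cintg f -> cint (fun x => c * f x) = c * cint f.
Proof.
move=> [rf jf]; apply: ReIm_inj; rewrite !ReImE !(Re_cint, Im_cint).
- rewrite -!RintegralZl// -RintegralB//.
  + by congr Rintegral; apply/funext => x /=; rewrite ReM.
  + rewrite (_ : _ \o _ = (fun x => (Re c)%:E * (EFin \o (Re \o f)) x)%E).
      exact: integrableZl.
    by apply/funext => x /=; rewrite EFinM.
  + rewrite (_ : _ \o _ = (fun x => (Im c)%:E * (EFin \o (Im \o f)) x)%E).
      exact: integrableZl.
    by apply/funext => x /=; rewrite EFinM.
- rewrite -!RintegralZl// -RintegralD//.
  + by congr Rintegral; apply/funext => x /=; rewrite ImM.
  + rewrite (_ : _ \o _ = (fun x => (Re c)%:E * (EFin \o (Im \o f)) x)%E).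
      exact: integrableZl.
    by apply/funext => x /=; rewrite EFinM.
  + rewrite (_ : _ \o _ = (fun x => (Im c)%:E * (EFin \o (Re \o f)) x)%E).
      exact: integrableZl.
    by apply/funext => x /=; rewrite EFinM.
Qed.

Lemma cintgB f g : cintg f -> cintg g -> cintg (fun x => f x - g x).
Proof.
move=> fi gi; rewrite (_ : (fun _ => _) = fun x => f x + (-1) * g x).
  by apply: cintgD => //; exact: cintgZ.
by apply/funext => x; rewrite mulN1r.
Qed.

Lemma cintB f g : cintg f -> cintg g ->
  cint (fun x => f x - g x) = cint f - cint g.
Proof.
move=> fi gi; rewrite (_ : (fun _ => _) = fun x => f x + (-1) * g x).
  by rewrite cintD ?cintZ ?mulN1r//; exact: cintgZ.
by apply/funext => x; rewrite mulN1r.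
Qed.

Lemma cint_conj f : cintg f -> cint (fun x => (f x)^*%C) = (cint f)^*%C.
Proof.
move=> [rf jf]; apply: ReIm_inj; rewrite !ReImE !(Re_cint, Im_cint).
- by congr Rintegral; apply/funext => x /=; rewrite Reconj.
- rewrite -mulN1r -RintegralZl//; congr Rintegral.
  by apply/funext => x /=; rewrite Imconj mulN1r.
Qed.

Lemma cint0 : cint (fun=> 0) = 0.
Proof.
by apply: ReIm_inj; rewrite !(Re_cint, Im_cint) /Rintegral /= integral0.
Qed.

Lemma cint_real (u : T -> R) : cint (fun x => (u x)%:C) = (Rintegral mu setT u)%:C.
Proof.
apply: ReIm_inj => //; rewrite Im_cint /Rintegral (_ : (fun _ => _) = cst 0%E) ?integral0//.
Qed.

Lemma cintg_real (u : T -> R) : mu.-integrable setT (EFin \o u) ->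
  cintg (fun x => (u x)%:C).
Proof.
move=> iu; split=> //; rewrite (_ : _ \o _ = cst 0%E)//.
exact: integrable0.
Qed.

(** Rotating by the phase of the integral reduces the bound to real parts. *)
Lemma normc_cint_le f : cintg f ->
  ((normc (cint f))%:E <= \int[mu]_x (normc (f x))%:E)%E.
Proof.
move=> fi; have [z ez] : {z | z = cint f} by exists (cint f).
rewrite -ez.
have [z0|z0] := eqVneq (normc z) 0.
  by rewrite z0; apply: integral_ge0 => x _; rewrite lee_fin normc_ge0.
have zgt0 : 0 < normc z by rewrite lt_def z0 normc_ge0.
have inf := cintg_normc fi.
have fin : (\int[mu]_x (normc (f x))%:E)%E \is a fin_num by exact: integrable_fin_num.
rewrite -(fineK fin) lee_fin -(ler_pM2l zgt0) -expr2.
have -> : normc z ^+ 2 = Re (cint (fun x => z^*%C * f x)).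
  by rewrite cintZ// -ez mulrC mulc_conj.
have [rz _] := cintgZ z^*%C fi.
rewrite -[X in _ <= _ * X]/(Rintegral mu setT (fun x => normc (f x))) -RintegralZl//=.
apply: le_Rintegral => //.
  rewrite (_ : _ \o _ = (fun x => (normc z)%:E * (normc (f x))%:E)%E).
    exact: integrableZl.
  by apply/funext => x /=; rewrite EFinM.
move=> x _ /=; rewrite (le_trans (ler_norm _))// (le_trans (Re_le_normc _))//.
by rewrite normcM normc_conj.
Qed.

Lemma cint_dominated (f_ : nat -> T -> R[i]) f (g : T -> R) :
  (forall k, cmeas (f_ k)) -> cmeas f -> measurable_fun [set: T] g ->
  {ae mu, forall x, normc (f_ k x - f x) @[k --> \oo] --> (0 : R)} ->
  (forall k x, normc (f_ k x) <= g x) -> (forall x, normc (f x) <= g x) ->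
  (\int[mu]_x (g x)%:E < +oo)%E ->
  normc (cint (f_ k) - cint f) @[k --> \oo] --> (0 : R).
Proof.
move=> mf_ mf mg f_f f_g fg goo.
have if_ k : cintg (f_ k) by apply: (@cintg_le _ g).
have if' : cintg f by apply: (@cintg_le _ g).
have g0 x : 0 <= g x by rewrite (le_trans (normc_ge0 _) (fg x)).
have := @dominated_convergence _ _ _ mu setT measurableT
  (fun k x => (normc (f_ k x - f x))%:E) (cst 0%E) (fun x => (2 * g x)%:E).
have mfB k : cmeas (fun x => f_ k x - f x) by exact: cmeasB.
have h1 k : measurable_fun [set: T] (fun x => (normc (f_ k x - f x))%:E).
  by apply/measurable_EFinP; exact: (measurable_normc (mfB k)).
have h2 : {ae mu, forall x, [set: T] x ->
    (normc (f_ k x - f x))%:E @[k --> \oo] --> (cst 0%E : T -> \bar R) x}.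
  by apply: filterS f_f => x fx _; apply: cvg_EFin => //; exact: nearW.
have h3 : mu.-integrable setT (fun x => (2 * g x)%:E).
  apply/integrableP; split; first by apply/measurable_EFinP; exact: measurable_funM.
  under eq_integral do rewrite /= ger0_norm ?mulr_ge0// EFinM.
  rewrite ge0_integralZl_EFin//; [exact: lte_mul_pinfty| | exact/measurable_EFinP].
  by move=> x _; rewrite lee_fin.
have h4 : {ae mu, forall x k, [set: T] x ->
    (`|(normc (f_ k x - f x))%:E| <= (2 * g x)%:E)%E}.
  apply: nearW => x k _; rewrite /= lee_fin ger0_norm ?normc_ge0//.
  by rewrite (le_trans (normcD _ _))// normcN mulr_natl mulr2n lerD.
move=> /(_ h1 (measurable_cst _) h2 h3 h4) [_ _].
rewrite integral0 => cv.
apply: (@squeeze_cvgr _ _ _ _ (fun=> 0) (fun k => fine (\int[mu]_x (normc (f_ k x - f x))%:E)%E)).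
- apply: nearW => k; rewrite normc_ge0 andTb.
  rewrite -lee_fin fineK; last first.
    by apply: integrable_fin_num => //; apply: cintg_normc; exact: cintgB.
  by rewrite -cintB//; apply: normc_cint_le; exact: cintgB.
- exact: cvg_cst.
- exact: (fine_cvg cv).
Qed.

Lemma cint_ae f g : cmeas f -> cmeas g -> {ae mu, forall x, f x = g x} -> cint f = cint g.
Proof.
move=> [rf jf] [rg jg] fg; rewrite /cint /Rintegral; congr (fine _ +i* fine _).
- apply: ae_eq_integral => //; try exact/measurable_EFinP.
  by apply: filterS fg => x /= fgx _; rewrite fgx.
- apply: ae_eq_integral => //; try exact/measurable_EFinP.
  by apply: filterS fg => x /= fgx _; rewrite fgx.
Qed.

End complex_integral.
Arguments cint : simpl never.

(** * Fubini's theorem for complex functions *)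

Section complex_fubini.
Context {R : realType} d1 d2 (T1 : measurableType d1) (T2 : measurableType d2).
Variables (m1 : {sigma_finite_measure set T1 -> \bar R})
          (m2 : {sigma_finite_measure set T2 -> \bar R}).

(** Integrals of the positive and negative parts depend measurably on the
    parameter by Tonelli's theorem. *)
Lemma measurable_Rintegral (u : T1 * T2 -> R) : measurable_fun setT u ->
  measurable_fun [set: T1] (fun x => Rintegral m2 setT (fun y => u (x, y))).
Proof.
move=> mu; apply: (measurableT_comp (fine_measurable _)) => //.
under eq_fun do rewrite integralE.
apply: emeasurable_funB.
- rewrite (_ : (fun _ => _) = fubini_F m2 (EFin \o u)^\+%E); last first.
    by apply/funext => x; apply: eq_integral => y _; rewrite !funeposE.
  apply: measurable_fun_fubini_tonelli_F => //.
  by apply: measurable_funepos; exact/measurable_EFinP.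
- rewrite (_ : (fun _ => _) = fubini_F m2 (EFin \o u)^\-%E); last first.
    by apply/funext => x; apply: eq_integral => y _; rewrite !funenegE.
  apply: measurable_fun_fubini_tonelli_F => //.
  by apply: measurable_funeneg; exact/measurable_EFinP.
Qed.

Lemma cmeas_cint (f : T1 * T2 -> R[i]) : cmeas f ->
  cmeas (fun x => cint m2 (fun y => f (x, y))).
Proof.
move=> [rf jf]; split.
- exact: (measurable_Rintegral rf).
- exact: (measurable_Rintegral jf).
Qed.

Lemma Rintegral12_prod (u : T1 * T2 -> R) :
  (m1 \x m2)%E.-integrable setT (EFin \o u) ->
  Rintegral m1 setT (fun x => Rintegral m2 setT (fun y => u (x, y))) =
  Rintegral (m1 \x m2)%E setT u.
Proof.
move=> iu; rewrite /Rintegral -(integral12_prod_meas1 iu); congr fine.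
have iF := integrable_fubini_F iu.
have mu : measurable_fun setT u by move/integrableP : iu => [/measurable_EFinP].
apply: ae_eq_integral => //.
- exact/measurable_EFinP/measurable_Rintegral.
- exact: measurable_int iF.
(* Almost every section is integrable, and fine loses nothing there. *)
- apply: filterS (integrable_ae measurableT iF) => x /= Fx _.
  by rewrite fineK//; exact: Fx.
Qed.

Lemma Rintegral21_prod (u : T1 * T2 -> R) :
  (m1 \x m2)%E.-integrable setT (EFin \o u) ->
  Rintegral m2 setT (fun y => Rintegral m1 setT (fun x => u (x, y))) =
  Rintegral (m1 \x m2)%E setT u.
Proof.
move=> iu; rewrite /Rintegral -(integral21_prod_meas1 iu); congr fine.
have mG := measurable_fubini_G iu.
have mu : measurable_fun setT u by move/integrableP : iu => [/measurable_EFinP].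
apply: ae_eq_integral => //.
- apply/measurable_EFinP.
  exact: (measurableT_comp (fine_measurable measurableT) mG).
- apply: filterS (ae_integrable2 iu) => y iy _ /=.
  by rewrite fineK//; exact: (integrable_fin_num measurableT iy).
Qed.

Lemma cintg_prod (f : T1 * T2 -> R[i]) : cmeas f ->
  (\int[m1]_x \int[m2]_y (normc (f (x, y)))%:E < +oo)%E ->
  cintg (m1 \x m2)%E f.
Proof.
move=> mf foo; apply/cintgP; split => //; rewrite fubini_tonelli1//.
- exact: measurable_normc_EFin.
- by move=> x; rewrite lee_fin normc_ge0.
Qed.

Lemma cint_prod12 (f : T1 * T2 -> R[i]) : cintg (m1 \x m2)%E f ->
  cint (m1 \x m2)%E f = cint m1 (fun x => cint m2 (fun y => f (x, y))).
Proof.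
by move=> [rf jf]; apply: ReIm_inj; rewrite !(Re_cint, Im_cint);
  [rewrite -(Rintegral12_prod rf)|rewrite -(Rintegral12_prod jf)].
Qed.

Lemma cint_prod21 (f : T1 * T2 -> R[i]) : cintg (m1 \x m2)%E f ->
  cint (m1 \x m2)%E f = cint m2 (fun y => cint m1 (fun x => f (x, y))).
Proof.
by move=> [rf jf]; apply: ReIm_inj; rewrite !(Re_cint, Im_cint);
  [rewrite -(Rintegral21_prod rf)|rewrite -(Rintegral21_prod jf)].
Qed.

Lemma cint_fubini (f : T1 * T2 -> R[i]) : cmeas f ->
  (\int[m1]_x \int[m2]_y (normc (f (x, y)))%:E < +oo)%E ->
  cint m1 (fun x => cint m2 (fun y => f (x, y))) =
  cint m2 (fun y => cint m1 (fun x => f (x, y))).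
Proof.
by move=> mf foo; have fi := cintg_prod mf foo; rewrite -cint_prod12// cint_prod21.
Qed.

End complex_fubini.

(** * Square-integrable functions *)

Section square_integrable.
Context {R : realType} d (T : measurableType d) (mu : {measure set T -> \bar R}).
Implicit Types f g : T -> R[i].

(** The square of the L^2 norm with values in [0, +oo]. Tonelli's theorem and
    Fatou's lemma apply to it directly, which they do not to the norm. *)
Definition N2 f : \bar R := (\int[mu]_x (normc (f x) ^+ 2)%:E)%E.

Lemma N2_ge0 f : (0 <= N2 f)%E.
Proof. by apply: integral_ge0 => x _; rewrite lee_fin sqr_ge0. Qed.

Lemma N2_fin f : (N2 f < +oo)%E -> N2 f \is a fin_num.
Proof. by move=> foo; rewrite ge0_fin_numE ?N2_ge0. Qed.

Lemma N2_ext f g : (forall x, f x = g x) -> N2 f = N2 g.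
Proof. by move=> fg; apply: eq_integral => x _; rewrite fg. Qed.

Lemma le_N2 f g : cmeas f -> cmeas g ->
  {ae mu, forall x, normc (f x) <= normc (g x)} -> (N2 f <= N2 g)%E.
Proof.
move=> mf mg fg; apply: ae_ge0_le_integral => //; try exact: measurable_normc2_EFin.
- by move=> x _; rewrite lee_fin sqr_ge0.
- by move=> x _; rewrite lee_fin sqr_ge0.
- apply: filterS fg => x fgx _.
  by rewrite lee_fin ler_pXn2r// ?nnegrE ?normc_ge0.
Qed.

(** For the quadratic N2 this stands in for the triangle inequality. *)
Lemma N2D f g : cmeas f -> cmeas g ->
  (N2 (fun x => f x + g x)%R <= 2%:E * N2 f + 2%:E * N2 g)%E.
Proof.
move=> mf mg; rewrite /N2.
rewrite -ge0_integralZl_EFin//; [|by move=> x _; rewrite lee_fin sqr_ge0|exact: measurable_normc2_EFin].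
rewrite -ge0_integralZl_EFin//; [|by move=> x _; rewrite lee_fin sqr_ge0|exact: measurable_normc2_EFin].
rewrite -ge0_integralD//; first apply: ge0_le_integral => //.
- by move=> x _; rewrite lee_fin sqr_ge0.
- by apply: measurable_normc2_EFin; exact: cmeasD.
- by apply: emeasurable_funD; apply: measurable_funeM; exact: measurable_normc2_EFin.
- by move=> x _; rewrite -!EFinM -EFinD lee_fin normc_sqrD.
- by move=> x _; rewrite -EFinM lee_fin mulr_ge0 ?sqr_ge0.
- by apply: measurable_funeM; exact: measurable_normc2_EFin.
- by move=> x _; rewrite -EFinM lee_fin mulr_ge0 ?sqr_ge0.
- by apply: measurable_funeM; exact: measurable_normc2_EFin.
Qed.

Lemma N2Z c f : cmeas f -> N2 (fun x => c * f x) = ((normc c ^+ 2)%:E * N2 f)%E.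
Proof.
move=> mf; rewrite /N2 -ge0_integralZl_EFin ?sqr_ge0//.
- by apply: eq_integral => x _; rewrite -EFinM normcM exprMn.
- by move=> x _; rewrite lee_fin sqr_ge0.
- exact: measurable_normc2_EFin.
Qed.

Lemma N2D_lty f g : cmeas f -> cmeas g -> (N2 f < +oo)%E -> (N2 g < +oo)%E ->
  (N2 (fun x => f x + g x)%R < +oo)%E.
Proof.
move=> mf mg foo goo; apply: le_lt_trans (N2D mf mg) _.
by apply: lte_add_pinfty; apply: lte_mul_pinfty.
Qed.

Lemma N2Z_lty c f : cmeas f -> (N2 f < +oo)%E -> (N2 (fun x => c * f x)%R < +oo)%E.
Proof. by move=> mf foo; rewrite N2Z//; apply: lte_mul_pinfty; rewrite // lee_fin sqr_ge0. Qed.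

Lemma N2B f g : cmeas f -> cmeas g ->
  (N2 (fun x => f x - g x)%R <= 2%:E * N2 f + 2%:E * N2 g)%E.
Proof.
move=> mf mg; have := N2D mf (cmeasM (cmeas_cst _ (-1)) mg).
rewrite N2Z// normcN (_ : normc 1 = 1) ?expr1n ?mul1e; last exact: ComplexField.Normc.normc1.
by under N2_ext do rewrite mulN1r.
Qed.

Lemma N2B_lty f g : cmeas f -> cmeas g -> (N2 f < +oo)%E -> (N2 g < +oo)%E ->
  (N2 (fun x => f x - g x)%R < +oo)%E.
Proof.
move=> mf mg foo goo; apply: le_lt_trans (N2B mf mg) _.
by apply: lte_add_pinfty; apply: lte_mul_pinfty.
Qed.

Lemma N2_conj f : N2 (fun x => (f x)^*%C) = N2 f.
Proof. by apply: eq_integral => x _; rewrite normc_conj. Qed.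

Lemma cintg_mul f g : cmeas f -> cmeas g -> (N2 f < +oo)%E -> (N2 g < +oo)%E ->
  cintg mu (fun x => f x * g x).
Proof.
move=> mf mg foo goo.
apply: (@cintg_le _ _ _ _ _ (fun x => normc (f x) ^+ 2 + normc (g x) ^+ 2)).
- exact: cmeasM.
- by apply: measurable_funD; exact: measurable_normc2.
- move=> x; rewrite normcM -subr_ge0.
  have := sqr_ge0 (normc (f x) - normc (g x)).
  have := mulr_ge0 (normc_ge0 (f x)) (normc_ge0 (g x)).
  nra.
- under eq_integral do rewrite EFinD.
  rewrite ge0_integralD//; first exact: lte_add_pinfty.
  + by move=> x _; rewrite lee_fin sqr_ge0.
  + exact: measurable_normc2_EFin.
  + by move=> x _; rewrite lee_fin sqr_ge0.
  + exact: measurable_normc2_EFin.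
Qed.

Lemma N2_Lnorm f : N2 f =
  ('N[mu]_2%:E[EFin \o (fun x => normc (f x))] * 'N[mu]_2%:E[EFin \o (fun x => normc (f x))])%E.
Proof.
transitivity ('N[mu]_2%:E[EFin \o (fun x => normc (f x))] `^ 2)%E.
  rewrite poweR_Lnorm//; apply: eq_integral => t _ /=.
  by rewrite ger0_norm ?normc_ge0// powR_mulrn ?normc_ge0.
have := Lnorm_ge0 mu 2%:E (EFin \o (fun x => normc (f x))); case: ('N[mu]_2%:E[_])%E => [x|_|//] /=.
  by rewrite lee_fin => x0; rewrite powR_mulrn// expr2.
by rewrite mulyy pnatr_eq0.
Qed.

Lemma Cauchy_Schwarz f g : cmeas f -> cmeas g -> (N2 f < +oo)%E -> (N2 g < +oo)%E ->
  fine (\int[mu]_x (normc (f x * g x))%:E)%E ^+ 2 <= fine (N2 f) * fine (N2 g).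
Proof.
move=> mf mg; have := @hoelder _ _ _ mu (fun x => normc (f x)) (fun x => normc (g x)) 2 2
  (measurable_normc mf) (measurable_normc mg).
rewrite Lnorm1 !N2_Lnorm => /(_ (ltr0n R 2) (ltr0n R 2)) hoe.
have {hoe} := hoe _; rewrite (_ : 2^-1 + 2^-1 = 1); last by field.
move=> /(_ erefl).
under eq_integral do rewrite /= ger0_norm ?mulr_ge0 ?normc_ge0// -normcM.
have := Lnorm_ge0 mu 2%:E (EFin \o (fun x => normc (f x))).
have := Lnorm_ge0 mu 2%:E (EFin \o (fun x => normc (g x))).
case: ('N[mu]_2%:E[EFin \o (fun x => normc (f x))])%E => [x|_ _ _|//]; last by rewrite mulyy.
case: ('N[mu]_2%:E[EFin \o (fun x => normc (g x))])%E => [y|_ _ _ _|//]; last by rewrite mulyy.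
rewrite !lee_fin => y0 x0 + _ _; have : (0 <= \int[mu]_t (normc (f t * g t))%:E)%E.
  by apply: integral_ge0 => t _; rewrite lee_fin normc_ge0.
case: (\int[mu]_t _)%E => [z|//|//] /=; rewrite -EFinM !lee_fin => z0 zxy.
by rewrite mulrACA -!expr2 ler_pXn2r ?nnegrE ?mulr_ge0.
Qed.

End square_integrable.

(** * Completeness of the space of square-integrable functions *)

Section complex_limits.
Context {R : realType}.
Implicit Types (z : nat -> R[i]).

(** Convergence of complex sequences is expressed by moduli of differences
    throughout. *)
Lemma cvg_normc_unique z a b :
  normc (z k - a) @[k --> \oo] --> (0 : R) ->
  normc (z k - b) @[k --> \oo] --> (0 : R) -> a = b.
Proof.
move=> za zb; apply/eqP; rewrite -subr_eq0; apply/eqP/normc_eq0.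
apply/eqP; rewrite eq_le normc_ge0 andbT.
have h : (normc (z k - a) + normc (z k - b)) @[k --> \oo] --> (0 + 0 : R).
  exact: (cvgD za zb).
rewrite addr0 in h; rewrite -(cvg_lim _ h)//.
apply: limr_ge; first by apply/cvg_ex; exists 0.
apply: nearW => k; rewrite (_ : a - b = (a - z k) + (z k - b)); last by ring.
by apply: (le_trans (normcD _ _)); rewrite (normcB a).
Qed.

End complex_limits.

Section L2_limits.
Context {R : realType} d (T : measurableType d) (mu : {measure set T -> \bar R}).
Implicit Types f g : T -> R[i].

Lemma normc_cint_mul f g : cmeas f -> cmeas g ->
  (N2 mu f < +oo)%E -> (N2 mu g < +oo)%E ->
  normc (cint mu (fun x => f x * g x)) <=
  Num.sqrt (fine (N2 mu f)) * Num.sqrt (fine (N2 mu g)).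
Proof.
move=> mf mg foo goo.
have ifg := cintg_mul mf mg foo goo.
have fin := integrable_fin_num measurableT (cintg_normc ifg).
have h := normc_cint_le ifg.
rewrite -(fineK fin) lee_fin in h; apply: le_trans h _.
rewrite -(@ler_pXn2r _ 2)// ?nnegrE ?mulr_ge0 ?sqrtr_ge0//; last first.
  by apply: fine_ge0; apply: integral_ge0 => x _; rewrite lee_fin normc_ge0.
rewrite exprMn !sqr_sqrtr ?fine_ge0 ?N2_ge0//.
exact: Cauchy_Schwarz.
Qed.

Lemma cint_sqr f : cmeas f -> (N2 mu f < +oo)%E ->
  cint mu (fun x => f x * (f x)^*%C) = (fine (N2 mu f))%:C.
Proof. by move=> mf foo; rewrite -cint_real; apply: cint_ext => x; rewrite mulc_conj. Qed.

Lemma cvg_sqrt_fine (e : nat -> \bar R) : (e k @[k --> \oo] --> 0%E) ->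
  Num.sqrt (fine (e k)) @[k --> \oo] --> (0 : R).
Proof.
move=> e0; rewrite -[X in _ --> X]sqrtr0.
exact: (@continuous_cvg _ _ _ _ _ _ (@Num.sqrt R) 0 (@sqrt_continuous R 0) (fine_cvg e0)).
Qed.

(** Cauchy-Schwarz bounds each term of
    u v - f g = (u - f) (v - g) + (u - f) g + f (v - g). *)
Lemma cint_mul_cvg (u v : nat -> T -> R[i]) f g :
  (forall k, cmeas (u k)) -> (forall k, cmeas (v k)) -> cmeas f -> cmeas g ->
  (forall k, N2 mu (u k) < +oo)%E -> (forall k, N2 mu (v k) < +oo)%E ->
  (N2 mu f < +oo)%E -> (N2 mu g < +oo)%E ->
  N2 mu (fun x => u k x - f x) @[k --> \oo] --> 0%E ->
  N2 mu (fun x => v k x - g x) @[k --> \oo] --> 0%E ->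
  normc (cint mu (fun x => u k x * v k x) - cint mu (fun x => f x * g x))
    @[k --> \oo] --> (0 : R).
Proof.
move=> mu_ mv mf mg uoo voo foo goo uf vg.
pose e k := Num.sqrt (fine (N2 mu (fun x => u k x - f x))).
pose e' k := Num.sqrt (fine (N2 mu (fun x => v k x - g x))).
pose F := Num.sqrt (fine (N2 mu f)).
pose G := Num.sqrt (fine (N2 mu g)).
have muf k : cmeas (fun x => u k x - f x) by exact: cmeasB.
have mvg k : cmeas (fun x => v k x - g x) by exact: cmeasB.
have ufoo k : (N2 mu (fun x => u k x - f x)%R < +oo)%E by exact: N2B_lty.
have vgoo k : (N2 mu (fun x => v k x - g x)%R < +oo)%E by exact: N2B_lty.
apply: (@squeeze_cvgr _ _ _ _ (fun=> 0) (fun k => e k * e' k + e k * G + F * e' k)).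
- apply: nearW => k; rewrite normc_ge0 andTb.
  have i1 := cintg_mul (muf k) (mvg k) (ufoo k) (vgoo k).
  have i2 := cintg_mul (muf k) mg (ufoo k) goo.
  have i3 := cintg_mul mf (mvg k) foo (vgoo k).
  rewrite -cintB; last 2 first.
    exact: cintg_mul. exact: cintg_mul.
  rewrite (@cint_ext _ _ _ _ _ (fun x => ((u k x - f x) * (v k x - g x)
    + (u k x - f x) * g x) + f x * (v k x - g x))); last by move=> x; ring.
  rewrite cintD//; last exact: cintgD.
  rewrite cintD//.
  apply: (le_trans (normcD _ _)); apply: lerD; last exact: normc_cint_mul.
  by apply: (le_trans (normcD _ _)); apply: lerD; exact: normc_cint_mul.
- exact: cvg_cst.
- have e0 : e k @[k --> \oo] --> (0 : R) by exact: cvg_sqrt_fine uf.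
  have e'0 : e' k @[k --> \oo] --> (0 : R) by exact: cvg_sqrt_fine vg.
  rewrite (_ : 0 = 0 * 0 + 0 * G + F * 0); last by rewrite !mul0r mulr0 !addr0.
  apply: cvgD; [apply: cvgD|]; apply: cvgM => //; exact: cvg_cst.
Qed.

Lemma N2_conj_cvg (u : nat -> T -> R[i]) f :
  N2 mu (fun x => u k x - f x) @[k --> \oo] --> 0%E ->
  N2 mu (fun x => (u k x)^*%C - (f x)^*%C) @[k --> \oo] --> 0%E.
Proof.
suff -> : (fun k => N2 mu (fun x => (u k x)^*%C - (f x)^*%C)) =
          (fun k => N2 mu (fun x => u k x - f x)) by [].
apply/funext => k; rewrite -[RHS]N2_conj; apply: N2_ext => x.
by rewrite rmorphB.
Qed.

End L2_limits.

Section Riesz_Fischer.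
Context {R : realType}.

Lemma geometric_cvg (a : nat -> R) (r : R) :
  (forall k j, `|a (k + j)%N - a k| <= r * 2^-1 ^+ k) -> cvgn a.
Proof.
move=> ha; apply/cauchy_cvgP/cauchy_exP => e e0.
have r0 : 0 <= r by have := ha 0%N 0%N; rewrite expr0 mulr1; apply: le_trans.
have : (r * 2^-1 ^+ k) @[k --> \oo] --> (0 : R).
  rewrite -[X in _ --> X](mulr0 r); apply: cvgMr.
  by apply: cvg_expr; rewrite ger0_norm ?invr_ge0// invf_lt1// ltr1n.
move=> /cvgrPdist_lt/(_ _ e0)[N _ hN].
exists (a N), N => // n /= Nn; rewrite /ball /= distrC.
rewrite -(subnKC Nn); apply: (le_lt_trans (ha _ _)).
have := hN N (leqnn N); rewrite /= sub0r normrN ger0_norm//.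
by rewrite mulr_ge0// exprn_ge0// invr_ge0.
Qed.

Lemma geometric_cvg_dist (a : nat -> R) (r : R) k :
  (forall k j, `|a (k + j)%N - a k| <= r * 2^-1 ^+ k) ->
  `|a k - limn a| <= r * 2^-1 ^+ k.
Proof.
move=> ha; have cva := geometric_cvg ha.
have h : `|a k - a j| @[j --> \oo] --> `|a k - limn a|.
  by apply: cvg_norm; apply: cvgB => //; exact: cvg_cst.
rewrite -(cvg_lim _ h)//; apply: limr_le; first by apply/cvg_ex; eexists; exact: h.
exists k => // j /= kj; rewrite distrC -(subnKC kj); exact: ha.
Qed.

Context d (T : measurableType d) (mu : {measure set T -> \bar R}).

(** If the consecutive distances decay geometrically, the weighted sum S of
   their squares is integrable; wherever S is finite the sequence is Cauchy,
   with a tail bounded by S itself, which controls the distance to the limit. *)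
Lemma L2_complete (u : nat -> T -> R[i]) (C : R) :
  (forall k, cmeas (u k)) ->
  (forall k, N2 mu (fun x => u k.+1 x - u k x)%R <= (C * 8^-1 ^+ k)%:E)%E ->
  exists U, cmeas U /\ N2 mu (fun x => u k x - U x) @[k --> \oo] --> 0%E.
Proof.
move=> mu_ hu.
pose del k x := u k.+1 x - u k x.
have mdel k : cmeas (del k) by exact: cmeasB.
pose s k x : \bar R := (4 ^+ k * normc (del k x) ^+ 2)%:E.
have s0 k x : (0 <= s k x)%E by rewrite lee_fin mulr_ge0 ?sqr_ge0 ?exprn_ge0.
have ms k : measurable_fun setT (s k).
  apply/measurable_EFinP; apply: measurable_funM; first exact: measurable_cst.
  exact: measurable_normc2.
pose S x : \bar R := (\sum_(0 <= k <oo) s k x)%E.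
have S0 x : (0 <= S x)%E by apply: nneseries_ge0.
have mS : measurable_fun setT S by apply: ge0_emeasurable_sum.
have C0 : 0 <= C.
  by have := le_trans (N2_ge0 _ _) (hu 0%N); rewrite expr0 mulr1 lee_fin.
have intS : (\int[mu]_x S x <= (2 * C)%:E)%E.
  rewrite integral_nneseries//; apply: lime_le.
    by apply: is_cvg_nneseries => k _ _; exact: integral_ge0.
  apply: nearW => n.
  apply: (@le_trans _ _ (\sum_(0 <= k < n) (C * 2^-1 ^+ k)%:E)%E).
    apply: lee_sum => k _; rewrite /s.
    under eq_integral do rewrite EFinM.
    rewrite ge0_integralZl_EFin ?exprn_ge0//; last 2 first.
      by move=> x _; rewrite lee_fin sqr_ge0.
      exact: measurable_normc2_EFin.
    rewrite (_ : C * 2^-1 ^+ k = 4 ^+ k * (C * 8^-1 ^+ k)); last first.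
      by rewrite mulrCA -exprMn; congr (_ * _ ^+ _); field.
    by rewrite EFinM lee_wpmul2l ?lee_fin ?exprn_ge0//; exact: hu.
  rewrite sumEFin lee_fin -mulr_sumr mulrC ler_wpM2r//.
  have -> : \sum_(0 <= i < n) (2^-1 : R) ^+ i = 2 - 2 * 2^-1 ^+ n.
    elim: n => [|n IH]; first by rewrite big_nil expr0 mulr1 subrr.
    by rewrite big_nat_recr//= IH exprS; field.
  by rewrite lerBlDr lerDl mulr_ge0// exprn_ge0// invr_ge0.
have iS : mu.-integrable setT S.
  apply/integrableP; split=> //; under eq_integral do rewrite gee0_abs//.
  by rewrite (le_lt_trans intS)// ltry.
pose A := [set x | S x \is a fin_num].
have mA : measurable A.
  by rewrite -[A]setTI; exact: emeasurable_fin_num.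
have aeA : {ae mu, forall x, A x}.
  by apply: filterS (integrable_ae measurableT iS) => x /(_ I).
pose r x := Num.sqrt (fine (S x)).
have r0 x : 0 <= r x by exact: sqrtr_ge0.
have step x k : A x -> normc (del k x) <= r x * 2^-1 ^+ k.
  move=> Ax; rewrite -(@ler_pXn2r _ 2)// ?nnegrE ?normc_ge0//; last first.
    by rewrite mulr_ge0// exprn_ge0// invr_ge0.
  rewrite exprMn sqr_sqrtr ?fine_ge0// -exprM mulnC exprM.
  rewrite -(@ler_pM2l _ (4 ^+ k)) ?exprn_gt0//.
  rewrite [leRHS](_ : _ = fine (S x)); last first.
    by rewrite mulrCA -exprMn (_ : 4 * 2^-1 ^+ 2 = 1 :> R) ?expr1n ?mulr1//; field.
  rewrite -lee_fin fineK//.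
  have := @nneseries_lim_ge _ (s ^~ x) xpredT 0 k.+1 (fun n _ _ => s0 n x).
  apply: le_trans; rewrite big_nat_recr//= leeDr//.
  by apply: sume_ge0.
have tail x k j : A x -> normc (u (k + j)%N x - u k x) <= 2 * r x * 2^-1 ^+ k.
  move=> Ax; apply: (@le_trans _ _ (2 * r x * (2^-1 ^+ k - 2^-1 ^+ (k + j)))).
    elim: j => [|j IH]; first by rewrite addn0 !subrr mulr0 normc0.
    rewrite addnS.
    rewrite (_ : u _ x - u k x = del (k + j)%N x + (u (k + j)%N x - u k x)); last first.
      by rewrite /del; ring.
    apply: (le_trans (normcD _ _)); apply: (le_trans (lerD (step x (k + j)%N Ax) IH)).
    by rewrite exprS -subr_ge0 [leRHS](_ : _ = 0)//; field.
  rewrite ler_wpM2l ?mulr_ge0// lerBlDr lerDl exprn_ge0// invr_ge0//.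
pose v k x : R[i] := u k x * (\1_A x)%:C.
have mv k : cmeas (v k).
  by apply: cmeasM => //; apply: cmeas_real; exact: measurable_indic.
have tailv x k j : normc (v (k + j)%N x - v k x) <= 2 * r x * 2^-1 ^+ k.
  rewrite /v indicE; have [/set_mem Ax|_] := boolP (x \in A).
    by rewrite !mulr1; exact: tail.
  by rewrite !mulr0 subrr normc0 mulr_ge0 ?mulr_ge0// exprn_ge0// invr_ge0.
have tailRe x k j : `|Re (v (k + j)%N x) - Re (v k x)| <= 2 * r x * 2^-1 ^+ k.
  by apply: le_trans (tailv x k j); rewrite -ReN -ReD; exact: Re_le_normc.
have tailIm x k j : `|Im (v (k + j)%N x) - Im (v k x)| <= 2 * r x * 2^-1 ^+ k.
  by apply: le_trans (tailv x k j); rewrite -ImN -ImD; exact: Im_le_normc.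
pose U x : R[i] := limn (fun k => Re (v k x)) +i* limn (fun k => Im (v k x)).
have mU : cmeas U.
  split.
  - apply: (@measurable_fun_cvg _ _ _ _ (fun k x => Re (v k x))).
      by move=> k; exact: (mv k).1.
    by move=> x _; exact: (geometric_cvg (tailRe x)).
  - apply: (@measurable_fun_cvg _ _ _ _ (fun k x => Im (v k x))).
      by move=> k; exact: (mv k).2.
    by move=> x _; exact: (geometric_cvg (tailIm x)).
exists U; split=> //.
have distU x k : A x -> normc (u k x - U x) ^+ 2 <= 16 * fine (S x) * 4^-1 ^+ k.
  move=> Ax; have -> : u k x = v k x by rewrite /v indicE mem_set// mulr1.
  have hr := geometric_cvg_dist k (tailRe x).
  have hi := geometric_cvg_dist k (tailIm x).
  rewrite sqr_normc ReD ImD ReN ImN.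
  set q := 2 * r x * 2^-1 ^+ k in hr hi.
  have q0 : 0 <= q by rewrite !mulr_ge0// exprn_ge0// invr_ge0.
  have sq (y : R) : `|y| <= q -> y ^+ 2 <= q ^+ 2.
    by move=> yq; rewrite -real_normK ?num_real// ler_pXn2r// nnegrE.
  apply: (le_trans (lerD (sq _ hr) (sq _ hi))).
  have -> : q ^+ 2 = 4 * fine (S x) * 4^-1 ^+ k.
    rewrite /q !exprMn sqr_sqrtr ?fine_ge0// -exprM mulnC exprM.
    by congr (_ * _ * _ ^+ _); field.
  have : 0 <= fine (S x) * 4^-1 ^+ k by rewrite mulr_ge0 ?fine_ge0 ?exprn_ge0 ?invr_ge0.
  lra.
have bound k : (N2 mu (fun x => u k x - U x)%R <= (32 * C * 4^-1 ^+ k)%:E)%E.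
  have -> : (32 * C * 4^-1 ^+ k)%:E = ((16 * 4^-1 ^+ k)%:E * (2 * C)%:E)%E.
    by rewrite -EFinM; congr EFin; ring.
  have c0 : 0 <= 16 * 4^-1 ^+ k :> R by rewrite mulr_ge0// exprn_ge0// invr_ge0.
  apply: le_trans (lee_wpmul2l _ intS); last by rewrite lee_fin.
  rewrite -ge0_integralZl_EFin//.
  apply: ae_ge0_le_integral => //.
  - by move=> x _; rewrite lee_fin sqr_ge0.
  - by apply: measurable_normc2_EFin; exact: cmeasB.
  - by move=> x _; rewrite mule_ge0 ?lee_fin.
  - exact: measurable_funeM.
  - apply: filterS aeA => x Ax _; rewrite -(fineK Ax) -EFinM lee_fin.
    by apply: (le_trans (distU x k Ax)); rewrite mulrAC.
apply: (@squeeze_cvge _ _ _ _ (fun=> 0%E) _ (fun k => (32 * C * 4^-1 ^+ k)%:E)).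
- by apply: nearW => k; rewrite N2_ge0 bound.
- exact: cvg_cst.
- apply: cvg_EFin; first exact: nearW.
  rewrite -[X in _ --> X](mulr0 (32 * C)); apply: cvgMr.
  by apply: cvg_expr; rewrite ger0_norm ?invr_ge0// invf_lt1// ltr1n.
Qed.

End Riesz_Fischer.

(** * Affine changes of variables on the line *)

Section affine_line.
Context {R : realType}.
Local Notation R1 := (measurableTypeR R).
Local Notation leb1 := (@lebesgue_measure R).
Implicit Types (c e : R).

Lemma measurable_affine c e : measurable_fun [set: R1] (fun x : R1 => (c * x + e : R1)).
Proof. by apply: measurable_funD => //; exact: measurable_cst. Qed.

(** Both sides are measures in A that agree on half-open intervals. *)
Lemma lebesgue_measure_affine c e (A : set R1) : c != 0 -> measurable A ->
  (`|c|%:E * leb1 ((fun x : R1 => c * x + e : R1)%R @^-1` A) = leb1 A)%E.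
Proof.
move=> c0 mA.
have cgt0 : 0 < `|c| by rewrite normr_gt0.
pose phi : R1 -> R1 := fun x => c * x + e.
have mphi : measurable_fun [set: R1] phi by exact: measurable_affine.
pose P : {measure set (measurableTypeR R) -> \bar R} :=
  measure_function_pushforward__canonical__measure_function_Measure leb1 mphi.
pose k : {nonneg R} := NngNum (normr_ge0 c).
pose M : {measure set (measurableTypeR R) -> \bar R} := mscale k P.
suff -> : leb1 A = M A by [].
apply: lebesgue_measure_unique => // _ [[a b] _ <-] /=.
rewrite /M /mscale/= /P /pushforward /phi.
have [ab|ba] := ltP a b; last first.
  rewrite !set_itv_ge ?preimage_set0 ?measure0 ?mule0// ?bnd_simp -?leNgt//.
have [cneg|cpos|ceq] := ltrgtP c 0; last by rewrite ceq eqxx in c0.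
(* A negative slope exchanges the closed and the open end. *)
- rewrite (_ : _ @^-1` _ = `[(b - e) / c, (a - e) / c[%classic); last first.
    apply/seteqP; split => x /=; rewrite !in_itv/= => /andP[h1 h2]; apply/andP; split.
    + by rewrite ler_ndivrMr// mulrC lerBrDr.
    + by rewrite ltr_ndivlMr// mulrC ltrBlDr.
    + by move: h2; rewrite ltr_ndivlMr// mulrC ltrBlDr.
    + by move: h1; rewrite ler_ndivrMr// mulrC lerBrDr.
  rewrite !lebesgue_measure_itv/= !lte_fin ab ltr_ndivrMr// divfK//.
  rewrite ltrD2r ab -!EFinB -EFinM; congr EFin.
  by rewrite ltr0_norm//; field.
- rewrite (_ : _ @^-1` _ = `](a - e) / c, (b - e) / c]%classic); last first.
    apply/seteqP; split => x /=; rewrite !in_itv/= => /andP[h1 h2]; apply/andP; split.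
    + by rewrite ltr_pdivrMr// mulrC ltrBlDr.
    + by rewrite ler_pdivlMr// mulrC lerBrDr.
    + by move: h1; rewrite ltr_pdivrMr// mulrC ltrBlDr.
    + by move: h2; rewrite ler_pdivlMr// mulrC lerBrDr.
  rewrite !lebesgue_measure_itv/= !lte_fin ab ltr_pdivrMr// divfK//.
  rewrite ltrD2r ab -!EFinB -EFinM; congr EFin.
  by rewrite gtr0_norm//; field.
Qed.

Lemma ge0_integral_affine c e (f : R1 -> \bar R) : c != 0 ->
  measurable_fun [set: R1] f -> (forall x, 0 <= f x)%E ->
  (`|c|%:E * \int[leb1]_x f (c * x + e)%R = \int[leb1]_x f x)%E.
Proof.
move=> c0 mf f0.
pose phi : R1 -> R1 := fun x => c * x + e.
have mphi : measurable_fun [set: R1] phi by exact: measurable_affine.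
pose P : {measure set (measurableTypeR R) -> \bar R} :=
  measure_function_pushforward__canonical__measure_function_Measure leb1 mphi.
pose k : {nonneg R} := NngNum (normr_ge0 c).
pose M : {measure set (measurableTypeR R) -> \bar R} := mscale k P.
rewrite -(_ : \int[M]_x f x = \int[leb1]_x f x)%E; last first.
  apply: eq_measure_integral => A mA _; exact: lebesgue_measure_affine.
rewrite (ge0_integral_mscale _ _ k)//; congr (_ * _)%E.
rewrite -[RHS]/(\int[pushforward leb1 phi]_(x in setT) f x)%E.
by rewrite (@ge0_integral_pushforward _ _ _ _ _ _ mphi)// => y _; exact: f0.
Qed.

End affine_line.

Section affine_signed.
Context {R : realType} d (T : measurableType d) (mu : {measure set T -> \bar R}).

(** A change of variables known for nonnegative functions extends to signed
    ones through their positive and negative parts. *)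
Lemma Rintegral_change (phi : T -> T) (J : R) : 0 <= J -> measurable_fun [set: T] phi ->
  (forall f : T -> \bar R, measurable_fun [set: T] f -> (forall x, 0 <= f x)%E ->
    (J%:E * \int[mu]_x f (phi x) = \int[mu]_x f x)%E) ->
  forall f : T -> R, measurable_fun [set: T] f ->
  Rintegral mu setT (fun x => J * f (phi x)) = Rintegral mu setT f.
Proof.
move=> J0 mphi H f mf; rewrite /Rintegral; congr fine.
have mEf : measurable_fun [set: T] (EFin \o f) by exact/measurable_EFinP.
rewrite [RHS]integralE -(H (EFin \o f)^\+%E)//; last exact: measurable_funepos.
rewrite -(H (EFin \o f)^\-%E)//; last exact: measurable_funeneg.
rewrite integralE; congr (_ - _)%E.
- rewrite -ge0_integralZl_EFin//; last first.
    apply: (@measurableT_comp _ _ _ _ _ _ (EFin \o f)^\+%E _ phi) => //.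
    exact: measurable_funepos.
  apply: eq_integral => x _; rewrite !funeposE /= EFinM.
  by rewrite maxe_pMr// mule0.
- rewrite -ge0_integralZl_EFin//; last first.
    apply: (@measurableT_comp _ _ _ _ _ _ (EFin \o f)^\-%E _ phi) => //.
    exact: measurable_funeneg.
  apply: eq_integral => x _; rewrite !funenegE maxe_pMr// mule0.
  by congr (Order.max _ _); rewrite /= -EFinM mulrN.
Qed.

Lemma cint_change (phi : T -> T) (J : R) : 0 <= J -> measurable_fun [set: T] phi ->
  (forall f : T -> \bar R, measurable_fun [set: T] f -> (forall x, 0 <= f x)%E ->
    (J%:E * \int[mu]_x f (phi x) = \int[mu]_x f x)%E) ->
  forall f : T -> R[i], cmeas f ->
  cint mu (fun x => J%:C * f (phi x)) = cint mu f.
Proof.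
move=> J0 mphi H f [rf jf]; apply: ReIm_inj; rewrite !(Re_cint, Im_cint).
- rewrite -(Rintegral_change J0 mphi H rf); congr Rintegral; apply/funext => x /=.
  by case: (f (phi x)) => a b /=; rewrite mul0r subr0.
- rewrite -(Rintegral_change J0 mphi H jf); congr Rintegral; apply/funext => x /=.
  by case: (f (phi x)) => a b /=; rewrite mul0r addr0.
Qed.

End affine_signed.

(** * The Cauchy kernel *)

Section Cauchy_kernel.
Context {R : realType}.
Local Notation R1 := (measurableTypeR R).
Local Notation leb1 := (@lebesgue_measure R).
Implicit Types z : R.

(** Normalized so as to be the Fourier transform of exp(-|b|). *)
Definition Cauchy z : R := 2 / (1 + z ^+ 2).

Lemma Cauchy_ge0 z : 0 <= Cauchy z.
Proof. by rewrite divr_ge0// addr_ge0// sqr_ge0. Qed.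

Let Cauchy_den z : 1 + z ^+ 2 != 0.
Proof. by rewrite gt_eqF// ltr_pwDl// sqr_ge0. Qed.

Lemma measurable_Cauchy : measurable_fun [set: R] Cauchy.
Proof.
apply: measurable_funM => //.
apply: (measurableT_comp measurable_inv).
by apply: measurable_funD => //; exact: measurable_cst.
Qed.

Lemma integral_Cauchy : (\int[leb1]_z (Cauchy z)%:E = (2 * pi)%:E)%E.
Proof.
rewrite (ge0_symfun_integralT Cauchy_ge0); last 2 first.
- move=> z; apply: cvgM; first exact: cvg_cst.
  exact: (@continuous_oneDsqrV R z).
- by move=> z /=; rewrite /Cauchy sqrrN.
rewrite (_ : [set x | 0 <= x] = `[0, +oo[%classic); last first.
  by apply/seteqP; split => x /=; rewrite in_itv/= andbT.
rewrite (_ : (2 * pi)%:E = 2%:E * (2%:E * (pi / 2)%:E))%E; last first.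
  by rewrite -!EFinM; congr EFin; field.
congr (_ * _)%E; rewrite -integral0y_oneDsqr -ge0_integralZl_EFin//.
- apply/measurable_EFinP; apply: measurable_funTS.
  by apply: continuous_measurable_fun; exact: continuous_oneDsqrV.
Qed.

(** A primitive of exp(-b) (1 + cos(z b)). Adding 1 to the cosine keeps the
    integrand nonnegative, so that its integral over [0, +oo[ is the variation
    of the primitive. *)
Let Gd z (b : R) : R := - expR (- b) + expR (- b) * (z * sin (z * b) - cos (z * b)) / (1 + z ^+ 2).
Let gd z (b : R) : R := expR (- b) * (1 + cos (z * b)).

Let gd_ge0 z b : 0 <= gd z b.
Proof. by rewrite mulr_ge0 ?expR_ge0// -lerBlDl sub0r cos_geN1. Qed.

Let continuous_scale z : continuous (fun b : R => z * b).
Proof. by move=> b; apply: cvgM; [exact: cvg_cst|exact: cvg_id]. Qed.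

Let is_derive_Gd z (b : R) : is_derive b 1 (Gd z) (gd z b).
Proof.
have dE : is_derive b 1 (fun b => expR (- b)) (- expR (- b)).
  have := @is_derive1_comp R expR -%R b (expR (- b)) (-1) _ _.
  by rewrite mulrN1 => h; apply: h.
have dL : is_derive b 1 (fun b => z * b) z.
  by apply: is_derive_eq; rewrite [RHS](_ : _ = z *: 1 + b *: 0)// scaler0 addr0 /GRing.scale /= mulr1.
have dS : is_derive b 1 (fun b => sin (z * b)) (cos (z * b) * z).
  by apply: (@is_derive1_comp R sin (fun b => z * b)).
have dC : is_derive b 1 (fun b => cos (z * b)) (- sin (z * b) * z).
  by apply: (@is_derive1_comp R cos (fun b => z * b)).
apply: is_derive_eq; rewrite /GRing.scale /= /gd.
by field.
Qed.

Let integral_gd z : (\int[leb1]_(b in `[0%R, +oo[) (gd z b)%:E = (1 + (1 + z ^+ 2)^-1)%:E)%E.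
Proof.
have cgd : continuous (gd z).
  move=> b; apply: cvgM.
    apply: (@continuous_comp _ _ _ -%R expR); first exact: opp_continuous.
    exact: continuous_expR.
  apply: cvgD; first exact: cvg_cst.
  by apply: (@continuous_comp _ _ _ (fun b => z * b) cos);
    [exact: continuous_scale|exact: continuous_cos].
rewrite (@ge0_continuous_FTC2y R (gd z) (Gd z) 0 0).
- by rewrite /Gd mulr0 sin0 cos0 oppr0 expR0 mulr0 mul1r; congr EFin; field.
- by move=> b _; exact: gd_ge0.
- exact: continuous_subspaceT.
- apply/norm_cvg0P.
  apply: (@squeeze_cvgr _ _ _ _ (fun=> 0) (fun b => expR (- b) * (1 + (`|z| + 1) / (1 + z ^+ 2)))).
  + apply: nearW => b; rewrite normr_ge0 andTb /Gd.
    apply: (le_trans (ler_normD _ _)).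
    rewrite normrN [leRHS]mulrDr mulr1 ger0_norm ?expR_ge0// lerD2l -mulrA.
    rewrite normrM ger0_norm ?expR_ge0// ler_wpM2l ?expR_ge0//.
    rewrite normrM [X in _ * X]ger0_norm ?invr_ge0 ?addr_ge0 ?sqr_ge0//.
    rewrite ler_wpM2r ?invr_ge0 ?addr_ge0 ?sqr_ge0//.
    rewrite (le_trans (ler_normD _ _))// normrN lerD ?cos_max// normrM.
    by rewrite ler_piMr ?sin_max.
  + exact: cvg_cst.
  + rewrite -[X in _ --> X](mul0r (1 + (`|z| + 1) / (1 + z ^+ 2))).
    by apply: cvgMl; exact: cvgr_expR.
- by move=> b _; have [] := is_derive_Gd z b.
- apply: cvg_at_right_filter.
  apply: differentiable_continuous; apply/derivable1_diffP.
  by have [] := is_derive_Gd z 0.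
- by move=> b _; rewrite derive1E; exact: (@derive_val _ _ _ _ _ _ _ (is_derive_Gd z b)).
Qed.

Let integral_gd_sym z :
  (\int[leb1]_b (expR (- `|b|) * (1 + cos (z * b)))%:E = (2 + Cauchy z)%:E)%E.
Proof.
rewrite ge0_symfun_integralT; last 3 first.
- by move=> b; rewrite mulr_ge0 ?expR_ge0// -lerBlDl sub0r cos_geN1.
- move=> b; apply: cvgM.
    apply: (@continuous_comp _ _ _ (fun b : R => - `|b|) expR); last exact: continuous_expR.
    by apply: cvgN; exact: norm_continuous.
  apply: cvgD; first exact: cvg_cst.
  by apply: (@continuous_comp _ _ _ (fun b => z * b) cos);
    [exact: continuous_scale|exact: continuous_cos].
- by move=> b /=; rewrite normrN mulrN cosN.
rewrite (_ : [set x | 0 <= x] = `[0, +oo[%classic); last first.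
  by apply/seteqP; split => x /=; rewrite in_itv/= andbT.
rewrite (eq_integral (fun b : R1 => (gd z b)%:E)); last first.
  by move=> b; rewrite inE/= in_itv/= andbT => b0; rewrite ger0_norm.
by rewrite integral_gd -EFinM; congr EFin; rewrite /Cauchy; field.
Qed.

Lemma measurable_expRabs : measurable_fun [set: R1] (fun b : R1 => expR (- `|b|)).
Proof. by apply: measurableT_comp => //; apply: measurableT_comp => //; exact: measurableT_comp. Qed.

Lemma integral_expRabs : (\int[leb1]_b (expR (- `|b|))%:E = 2%:E)%E.
Proof.
have h := integral_gd_sym 0.
have -> : (2%:E = 2^-1%:E * (2 + Cauchy 0)%:E :> \bar R)%E.
  by rewrite -EFinM; congr EFin; rewrite /Cauchy expr0n /=; field.
rewrite -h -ge0_integralZl_EFin//.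
- by apply: eq_integral => b _; rewrite mul0r cos0 -EFinM; congr EFin; field.
- apply/measurable_EFinP; apply: measurable_funM; first exact: measurable_expRabs.
  by under eq_fun do rewrite mul0r; exact: measurable_cst.
Qed.

Lemma cintg_expRabs z : cintg leb1 (fun b : R1 => (expR (- `|b|))%:C * expi (z * b)).
Proof.
apply: (@cintg_le _ _ _ leb1 _ (fun b : R1 => expR (- `|b|))).
- apply: cmeasM; first by apply: cmeas_real; exact: measurable_expRabs.
  by apply: cmeas_expi.
- exact: measurable_expRabs.
- by move=> b; rewrite normcM normc_expi normc_real mulr1 ger0_norm ?expR_ge0.
- by rewrite integral_expRabs ltry.
Qed.

(** The cosine part comes from integral_gd_sym by subtracting the integral of
    exp(-|b|); the sine part is odd. *)
Lemma cint_expRabs z :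
  cint leb1 (fun b : R1 => (expR (- `|b|))%:C * expi (z * b)) = (Cauchy z)%:C.
Proof.
have [ri ji] := cintg_expRabs z.
have ie : leb1.-integrable setT (fun b : R1 => (expR (- `|b|))%:E).
  apply/integrableP; split; first by apply/measurable_EFinP; exact: measurable_expRabs.
  under eq_integral do rewrite /= ger0_norm ?expR_ge0//.
  by rewrite integral_expRabs ltry.
apply: ReIm_inj; rewrite !(Re_cint, Im_cint) /=.
- have h : Rintegral leb1 setT (fun b : R1 => expR (- `|b|) + expR (- `|b|) * cos (z * b)) =
           2 + Cauchy z.
    rewrite /Rintegral -[RHS]/(fine (2 + Cauchy z)%:E) -integral_gd_sym; congr fine.
    by apply: eq_integral => b _; rewrite mulrDr mulr1.
  rewrite (@RintegralD _ _ _ leb1 setT (fun b : R1 => expR (- `|b|))) in h => //; last first.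
    apply: eq_integrable ri => // b _ /=.
    by rewrite mul0r subr0.
  rewrite {1}/Rintegral integral_expRabs /= in h.
  move/addrI : h => <-; congr Rintegral; apply/funext => b /=.
  by rewrite mul0r subr0.
- set I := Rintegral _ _ _.
  suff : I = - I by move=> /eqP; rewrite -subr_eq0 opprK -mulr2n mulrn_eq0/= => /eqP.
  rewrite {2}/I -mulN1r -RintegralZl//.
  have c0 : (-1 : R) != 0 by rewrite oppr_eq0 oner_eq0.
  rewrite /I -(@Rintegral_change R _ _ leb1 (fun x : R1 => (-1 * x + 0 : R1)) `|-1|)//; last 3 first.
  + exact: measurable_affine.
  + by move=> f mf f0; exact: ge0_integral_affine.
  + by move/integrableP : ji => [/measurable_EFinP].
  congr Rintegral; apply/funext => b /=.
  rewrite normrN normr1 mul1r addr0 mulN1r normrN mulrN sinN cosN.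
  by rewrite mul0r addr0; ring.
Qed.

End Cauchy_kernel.

(** * Plancherel's identity on the line *)

Section multiplication_formula.
Context {R : realType} d1 d2 (T1 : measurableType d1) (T2 : measurableType d2).
Variables (m1 : {sigma_finite_measure set T1 -> \bar R})
          (m2 : {sigma_finite_measure set T2 -> \bar R}).

(** Fubini's theorem for f(x) g(y) k(x, y), integrable because k is bounded.
    For k a phase this is the multiplication formula of Fourier analysis. *)
Lemma cint_exchange (f : T1 -> R[i]) (g : T2 -> R[i]) (k : T1 * T2 -> R[i]) (M : R) :
  cintg m1 f -> cintg m2 g -> cmeas k -> (forall p, normc (k p) <= M) ->
  cint m1 (fun x => f x * cint m2 (fun y => g y * k (x, y))) =
  cint m2 (fun y => g y * cint m1 (fun x => f x * k (x, y))).
Proof.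
move=> fi gi mk kM.
have mf := cintg_cmeas fi; have mg := cintg_cmeas gi.
have M0 : 0 <= M by apply: le_trans (kM point); exact: normc_ge0.
have gk x : cintg m2 (fun y => g y * k (x, y)).
  rewrite (_ : (fun _ => _) = (fun y => k (x, y) * g y)); last first.
    by apply/funext => y; rewrite mulrC.
  apply: (@cintgM_bounded _ _ _ _ _ _ M) => //.
  exact: (cmeas_comp mk (pair1_measurable x)).
have fk y : cintg m1 (fun x => f x * k (x, y)).
  rewrite (_ : (fun _ => _) = (fun x => k (x, y) * f x)); last first.
    by apply/funext => x; rewrite mulrC.
  apply: (@cintgM_bounded _ _ _ _ _ _ M) => //.
  exact: (cmeas_comp mk (pair2_measurable y)).
pose F (p : T1 * T2) := f p.1 * (g p.2 * k p).
have mF : cmeas F.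
  apply: cmeasM; first exact: (cmeas_comp mf measurable_fst).
  by apply: cmeasM => //; exact: (cmeas_comp mg measurable_snd).
have foo : (\int[m1]_x \int[m2]_y (normc (F (x, y)))%:E < +oo)%E.
  apply: (@le_lt_trans _ _ (\int[m1]_x ((normc (f x))%:E * (M%:E * \int[m2]_y (normc (g y))%:E)))%E).
    apply: ge0_le_integral => //.
    - by move=> x _; apply: integral_ge0 => y _; rewrite lee_fin normc_ge0.
    - apply: (measurable_fun_fubini_tonelli_F (fun p => (normc (F p))%:E)).
        exact: measurable_normc_EFin.
      by move=> p; rewrite lee_fin normc_ge0.
    - under eq_fun do rewrite muleC.
      by apply: measurable_funeM; apply/measurable_EFinP; exact: measurable_normc.
    - move=> x _; rewrite -ge0_integralZl_EFin//; last 2 first.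
        by move=> y _; rewrite lee_fin normc_ge0.
        exact: measurable_normc_EFin.
      rewrite -ge0_integralZl_EFin ?normc_ge0//; last 2 first.
        by move=> y _; rewrite -EFinM lee_fin mulr_ge0 ?normc_ge0.
        by apply: measurable_funeM; apply/measurable_EFinP; exact: measurable_normc.
      apply: ge0_le_integral => //.
      + by move=> y _; rewrite lee_fin normc_ge0.
      + apply/measurable_EFinP; apply: measurable_normc.
        exact: (cmeas_comp mF (pair1_measurable x)).
      + do 2 apply: measurable_funeM; apply/measurable_EFinP; exact: measurable_normc.
      + move=> y _; rewrite -!EFinM lee_fin /F !normcM ler_wpM2l ?normc_ge0//.
        by rewrite mulrC ler_wpM2r ?normc_ge0.
  have [_ goo] := (cintgP m2 g).1 gi.
  have [_ f_oo] := (cintgP m1 f).1 fi.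
  have gfin : (\int[m2]_y (normc (g y))%:E)%E \is a fin_num.
    by rewrite ge0_fin_numE//; apply: integral_ge0 => y _; rewrite lee_fin normc_ge0.
  rewrite -(fineK gfin) -EFinM.
  rewrite ge0_integralZr//; last 3 first.
    exact: measurable_normc_EFin.
    by move=> x _; rewrite lee_fin normc_ge0.
    by rewrite lee_fin mulr_ge0// fine_ge0//; apply: integral_ge0 => y _; rewrite lee_fin normc_ge0.
  rewrite muleC; apply: lte_mul_pinfty => //.
  by rewrite lee_fin mulr_ge0// fine_ge0//; apply: integral_ge0 => y _; rewrite lee_fin normc_ge0.
transitivity (cint m1 (fun x => cint m2 (fun y => F (x, y)))).
  by apply: cint_ext => x; rewrite /F /= cintZ.
rewrite cint_fubini//; apply: cint_ext => y; rewrite -cintZ//.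
by apply: cint_ext => x; rewrite /F /= mulrCA.
Qed.

End multiplication_formula.

Section N2_fatou.
Context {R : realType} d (T : measurableType d) (mu : {measure set T -> \bar R}).

Lemma cintgMr_bounded (f g : T -> R[i]) (M : R) : cmeas g -> (forall x, normc (g x) <= M) ->
  cintg mu f -> cintg mu (fun x => f x * g x).
Proof.
move=> mg gM fi; rewrite (_ : (fun _ => _) = fun x => g x * f x).
  exact: (cintgM_bounded mg gM).
by apply/funext => x; rewrite mulrC.
Qed.

Lemma N2_fatou (u : nat -> T -> R[i]) (f : T -> R[i]) (L : \bar R) :
  (forall k, cmeas (u k)) -> cmeas f ->
  {ae mu, forall x, normc (u k x - f x) @[k --> \oo] --> (0 : R)} ->
  (forall k, N2 mu (u k) <= L)%E -> (N2 mu f <= L)%E.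
Proof.
move=> mu_ mf uf uL.
have ms (g : T -> R[i]) : cmeas g -> measurable_fun [set: T] (fun x => (normc (g x) ^+ 2)%:E).
  by move=> mg; apply/measurable_EFinP; exact: measurable_normc2.
have h0 k (x : T) : [set: T] x -> (0 <= (normc (u k x) ^+ 2)%:E)%E by move=> _; rewrite lee_fin sqr_ge0.
have h := @fatou _ _ _ mu setT measurableT (fun k x => (normc (u k x) ^+ 2)%:E)
  (fun k => ms _ (mu_ k)) h0.
have -> : N2 mu f = (\int[mu]_x limn_einf (fun k => (normc (u k x) ^+ 2)%:E))%E.
  apply: ae_eq_integral => //; first exact: ms.
  - rewrite (_ : (fun _ => _) = (fun x => - limn_esup (fun k => - (normc (u k x) ^+ 2)%:E))%E).
      apply: measurableT_comp => //; apply: measurable_fun_limn_esup => k.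
      by apply: measurableT_comp => //; exact: ms.
    apply/funext => x; rewrite -limn_einfN; congr limn_einf.
    by apply/funext => k; rewrite /= opprK.
  - apply: filterS uf => x ufx _.
    have cv : normc (u k x) @[k --> \oo] --> normc (f x).
      apply/subr_cvg0; apply/norm_cvg0P.
      apply: (@squeeze_cvgr _ _ _ _ (fun=> 0) (fun k => normc (u k x - f x))) => //.
        apply: nearW => k; rewrite normr_ge0 andTb ler_norml; apply/andP; split.
          rewrite lerNl opprB lerBlDr normcB -{1}(subrK (u k x) (f x)); exact: normcD.
        by rewrite lerBlDr -{1}(subrK (f x) (u k x)); exact: normcD.
      exact: cvg_cst.
    have cv2 : (normc (u k x) ^+ 2)%:E @[k --> \oo] --> (normc (f x) ^+ 2)%:E.
      by apply: cvg_EFin; [exact: nearW|apply: cvgM].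
    by rewrite (cvg_limn_einf_sup cv2).1.
apply: (le_trans h); rewrite limn_einf_lim; apply: lime_le; first exact: is_cvg_einfs.
apply: nearW => k; apply: le_trans (uL k); apply: ereal_inf_lbound.
by exists k => /=.
Qed.

End N2_fatou.

Section Fourier_line.
Context {R : realType}.
Local Notation R1 := (measurableTypeR R).
Local Notation leb1 := (@lebesgue_measure R).
Implicit Types (H : R1 -> R[i]) (b x : R1).

Definition FT1 H b : R[i] := cint leb1 (fun x : R1 => H x * expi (- (b * x))).

Lemma measurable_mulR1 : measurable_fun [set: R1 * R1] (fun p : R1 * R1 => (p.1 * p.2 : R)).
Proof. by apply: measurable_funM; [exact: measurable_fst|exact: measurable_snd]. Qed.

Lemma cmeas_phase1 : cmeas (fun p : R1 * R1 => expi (- (p.1 * p.2))).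
Proof. by apply: cmeas_expi; apply: measurableT_comp => //; exact: measurable_mulR1. Qed.

Lemma cmeas_FT1 H : cmeas H -> cmeas (FT1 H).
Proof.
move=> mH; apply: (@cmeas_cint _ _ _ R1 R1 leb1 (fun p : R1 * R1 => H p.2 * expi (- (p.1 * p.2)))).
by apply: cmeasM; [exact: (cmeas_comp mH measurable_snd)|exact: cmeas_phase1].
Qed.

Lemma cintg_phase1 H b : cintg leb1 H -> cintg leb1 (fun x : R1 => H x * expi (- (b * x))).
Proof.
move=> Hi; rewrite (_ : (fun _ => _) = fun x : R1 => expi (- (b * x)) * H x); last first.
  by apply/funext => x; rewrite mulrC.
apply: (@cintgM_bounded _ _ _ _ _ _ 1) => //; last by move=> x; rewrite normc_expi.
by apply: cmeas_expi; apply: measurableT_comp => //; exact: (mulrl_measurable b).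
Qed.

Lemma FT1_bound H b : cintg leb1 H ->
  normc (FT1 H b) <= fine (\int[leb1]_x (normc (H x))%:E)%E.
Proof.
move=> Hi; have fin := integrable_fin_num measurableT (cintg_normc Hi).
rewrite -lee_fin fineK//; apply: le_trans (normc_cint_le (cintg_phase1 b Hi)) _.
by under eq_integral do rewrite normcM normc_expi mulr1.
Qed.

(** Convergence factors: E k increases to 1 with k, and the transform of E k is
    an explicit approximate identity. *)
Let E k (b : R1) : R := expR (- `|(k.+1%:R)^-1 * b|).

Let E_ge0 k b : 0 <= E k b. Proof. exact: expR_ge0. Qed.

Let E_le1 k b : E k b <= 1.
Proof. by rewrite -expR0 ler_expR oppr_le0. Qed.

Let mE k : measurable_fun [set: R1] (E k).
Proof.
apply: (measurableT_comp measurable_expRabs).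
exact: (mulrl_measurable (k.+1%:R)^-1).
Qed.

Let cvg_step : ((k.+1%:R)^-1 : R) @[k --> \oo] --> (0 : R).
Proof. exact: cvg_harmonic. Qed.

Let integral_E k : (\int[leb1]_b (E k b)%:E = (k.+1%:R * 2)%:E)%E.
Proof.
have c0 : (k.+1%:R)^-1 != 0 :> R by rewrite invr_neq0.
have h := @ge0_integral_affine R _ 0 (fun b : R1 => (expR (- `|b|))%:E) c0.
rewrite integral_expRabs in h.
rewrite EFinM -h; last 2 first.
  by apply/measurable_EFinP; exact: measurable_expRabs.
  by move=> x; rewrite lee_fin expR_ge0.
rewrite muleA -EFinM ger0_norm// divff// mul1e.
by apply: eq_integral => b _; rewrite addr0.
Qed.

Let cintg_E k : cintg leb1 (fun b : R1 => (E k b)%:C).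
Proof.
apply: cintg_real; apply/integrableP; split; first exact/measurable_EFinP.
under eq_integral do rewrite /= ger0_norm//.
by rewrite integral_E ltry.
Qed.

Let cmeas_lin (w : R) : cmeas (fun b : R1 => expi (w * b)).
Proof. by apply: cmeas_expi; exact: (mulrl_measurable w). Qed.

Let cint_E k (w : R) : cint leb1 (fun b : R1 => (E k b)%:C * expi (w * b)) =
  (k.+1%:R * Cauchy (w * k.+1%:R))%:C.
Proof.
have c0 : (k.+1%:R)^-1 != 0 :> R by rewrite invr_neq0.
have h := @cint_change R _ _ leb1 (fun x : R1 => (k.+1%:R^-1 * x + 0 : R1)) `|k.+1%:R^-1|
  (normr_ge0 _) (measurable_affine _ _) (fun f mf f0 => ge0_integral_affine 0 c0 mf f0)
  (fun b : R1 => (expR (- `|b|))%:C * expi ((w * k.+1%:R) * b))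
  (cintg_cmeas (cintg_expRabs _)).
rewrite cint_expRabs in h.
have key : (Cauchy (w * k.+1%:R))%:C =
    (k.+1%:R^-1)%:C * cint leb1 (fun b : R1 => (E k b)%:C * expi (w * b)) :> R[i].
  rewrite -h -cintZ; last by apply: (@cintgMr_bounded _ _ _ _ _ _ 1) => // x; rewrite normc_expi.
  apply: cint_ext => x; rewrite ger0_norm// addr0 -(mulrA w) mulVKf//.
by rewrite realCM key mulrA -realCM divff// mul1r.
Qed.

Let average k H (x : R1) : R[i] :=
  cint leb1 (fun z : R1 => H (k.+1%:R^-1 * z + x)%R * (Cauchy z)%:C).

Let cmeas_Cauchy : cmeas (fun z : R1 => (Cauchy z)%:C).
Proof. by apply: cmeas_real; exact: measurable_Cauchy. Qed.

Let cintg_Cauchy : cintg leb1 (fun z : R1 => (Cauchy z)%:C).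
Proof.
apply: cintg_real; apply/integrableP; split; first by apply/measurable_EFinP; exact: measurable_Cauchy.
under eq_integral do rewrite /= ger0_norm ?Cauchy_ge0//.
by rewrite integral_Cauchy ltry.
Qed.

Let averageE k H x : cmeas H ->
  average k H x = cint leb1 (fun y : R1 => H y * (k.+1%:R * Cauchy ((x - y) * k.+1%:R))%:C).
Proof.
move=> mH; have c0 : (k.+1%:R)^-1 != 0 :> R by rewrite invr_neq0.
have mF : cmeas (fun y : R1 => H y * (k.+1%:R * Cauchy ((x - y) * k.+1%:R))%:C).
  apply: cmeasM => //; apply: cmeas_real; apply: measurable_funM => //.
  apply: (measurableT_comp measurable_Cauchy); apply: measurable_funM => //.
  by apply: measurable_funB => //; exact: measurable_cst.
rewrite -(@cint_change R _ _ leb1 (fun z : R1 => (k.+1%:R^-1 * z + x : R1)) `|k.+1%:R^-1|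
  (normr_ge0 _) (measurable_affine _ _) (fun f mf f0 => ge0_integral_affine x c0 mf f0) _ mF).
apply: cint_ext => z; rewrite ger0_norm// mulrCA -realCM; congr (_ * _%:C).
rewrite mulrA mulVf// mul1r (_ : (x - _) * _ = - z); last by field.
by rewrite /Cauchy sqrrN.
Qed.

(** Unfolding both factors of |FT1 H|^2 and integrating the phases first against
    the weight E k leaves H times its average against a Cauchy kernel of width
    1/(k+1). *)
Let weighted_identity k H : cintg leb1 H ->
  cint leb1 (fun b : R1 => (normc (FT1 H b) ^+ 2 * E k b)%:C) =
  cint leb1 (fun x : R1 => H x * (average k H x)^*%C).
Proof.
move=> Hi; have mH := cintg_cmeas Hi; have mh := cmeas_FT1 mH.
have bE : cintg leb1 (fun b : R1 => (FT1 H b)^*%C * (E k b)%:C).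
  apply: (cintgM_bounded (cmeas_conj mh) _ (cintg_E k)) => b.
  by rewrite normc_conj; exact: FT1_bound.
have unit1 (p : R1 * R1) : normc (expi (- (p.1 * p.2))) <= 1 by rewrite normc_expi.
transitivity (cint leb1 (fun b : R1 => ((FT1 H b)^*%C * (E k b)%:C) *
    cint leb1 (fun x : R1 => H x * expi (- (b * x))))).
  apply: cint_ext => b; rewrite realCM -mulc_conj -/(FT1 H b).
  by rewrite -mulrA mulrC.
rewrite (cint_exchange bE Hi cmeas_phase1 unit1).
apply: cint_ext => x; congr (_ * _).
rewrite averageE// -[LHS]conjcK; congr (_^*%C).
have i1 : cintg leb1 (fun b : R1 => (FT1 H b)^*%C * (E k b)%:C * expi (- (b * x))).
  apply: (@cintgMr_bounded _ _ _ _ _ _ 1) => //; last by move=> b; rewrite normc_expi.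
  by apply: cmeas_expi; apply: measurableT_comp => //; exact: (mulrr_measurable x).
rewrite -(cint_conj i1).
have Ex : cintg leb1 (fun b : R1 => (E k b)%:C * expi (x * b)).
  by apply: (@cintgMr_bounded _ _ _ _ _ _ 1) => // b; rewrite normc_expi.
transitivity (cint leb1 (fun b : R1 => ((E k b)%:C * expi (x * b)) *
    cint leb1 (fun y : R1 => H y * expi (- (b * y))))).
  apply: cint_ext => b; rewrite !conjcM conjcK conjc_real conj_expi opprK.
  by rewrite -/(FT1 H b) (mulrC b x); ring.
rewrite (cint_exchange Ex Hi cmeas_phase1 unit1).
apply: cint_ext => y; congr (_ * _).
rewrite -cint_E; apply: cint_ext => b; rewrite /= -mulrA -expiD; congr (_ * expi _); ring.
Qed.

Let average_bound k H (B : R) x : (forall y, normc (H y) <= B) -> cmeas H ->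
  normc (average k H x) <= B * (2 * pi).
Proof.
move=> HB mH; have B0 : 0 <= B by apply: le_trans (HB 0); exact: normc_ge0.
have mHx : cmeas (fun z : R1 => H (k.+1%:R^-1 * z + x)%R).
  exact: (cmeas_comp mH (measurable_affine _ _)).
have i := cintgM_bounded mHx (fun z => HB _) cintg_Cauchy.
rewrite -lee_fin; apply: le_trans (normc_cint_le i) _.
rewrite EFinM -integral_Cauchy -ge0_integralZl_EFin//; last 2 first.
  by move=> z _; rewrite lee_fin Cauchy_ge0.
  by apply/measurable_EFinP; exact: measurable_Cauchy.
apply: ge0_le_integral => //.
- by move=> z _; rewrite lee_fin normc_ge0.
- by apply: measurable_normc_EFin; exact: cintg_cmeas i.
- by apply: measurable_funeM; apply/measurable_EFinP; exact: measurable_Cauchy.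
- move=> z _; rewrite -EFinM lee_fin normcM normc_real ger0_norm ?Cauchy_ge0//.
  by rewrite ler_wpM2r ?Cauchy_ge0.
Qed.

Let average_cvg H (B : R) x : (forall y, normc (H y) <= B) -> cmeas H ->
  (forall u : nat -> R, u k @[k --> \oo] --> (0 : R) ->
    normc (H (u k + x)%R - H x) @[k --> \oo] --> (0 : R)) ->
  normc (average k H x - H x * (2 * pi)%:C) @[k --> \oo] --> (0 : R).
Proof.
move=> HB mH cH; have B0 : 0 <= B by apply: le_trans (HB 0); exact: normc_ge0.
have -> : H x * (2 * pi)%:C = cint leb1 (fun z : R1 => H x * (Cauchy z)%:C).
  rewrite cintZ; last exact: cintg_Cauchy.
  by rewrite cint_real /Rintegral integral_Cauchy.
apply: (@cint_dominated _ _ _ _ _ _ (fun z : R1 => B * Cauchy z)).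
- move=> k; apply: cmeasM => //; exact: (cmeas_comp mH (measurable_affine _ _)).
- by apply: cmeasM => //; exact: cmeas_cst.
- by apply: measurable_funM; [exact: measurable_cst|exact: measurable_Cauchy].
- apply: nearW => z.
  have u0 : k.+1%:R^-1 * z @[k --> \oo] --> (0 : R).
    by rewrite -[X in _ --> X](mul0r z); apply: cvgMl; exact: cvg_step.
  have h := cH _ u0.
  have -> : (fun k => normc (H (k.+1%:R^-1 * z + x)%R * (Cauchy z)%:C - H x * (Cauchy z)%:C)) =
            (fun k => normc (H (k.+1%:R^-1 * z + x)%R - H x) * Cauchy z).
    by apply/funext => k; rewrite -mulrBl normcM normc_real ger0_norm ?Cauchy_ge0.
  by rewrite -[X in _ --> X](mul0r (Cauchy z)); apply: cvgMl.
- by move=> k z; rewrite normcM normc_real ger0_norm ?Cauchy_ge0// ler_wpM2r ?Cauchy_ge0.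
- by move=> z; rewrite normcM normc_real ger0_norm ?Cauchy_ge0// ler_wpM2r ?Cauchy_ge0.
- under eq_integral do rewrite EFinM.
  rewrite ge0_integralZl_EFin//.
  + by rewrite integral_Cauchy -EFinM ltry.
  + by move=> z _; rewrite lee_fin Cauchy_ge0.
  + by apply/measurable_EFinP; exact: measurable_Cauchy.
Qed.

Lemma N2_bounded_lty H (B : R) : (forall y, normc (H y) <= B) -> cintg leb1 H ->
  (N2 leb1 H < +oo)%E.
Proof.
move=> HB /cintgP[mH Hoo]; have B0 : 0 <= B by apply: le_trans (HB 0); exact: normc_ge0.
apply: (@le_lt_trans _ _ (B%:E * \int[leb1]_x (normc (H x))%:E)%E).
  rewrite -ge0_integralZl_EFin//; last 2 first.
    by move=> z _; rewrite lee_fin normc_ge0.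
    exact: measurable_normc_EFin.
  apply: ge0_le_integral => //.
  - by move=> z _; rewrite lee_fin sqr_ge0.
  - exact: measurable_normc2_EFin.
  - by apply: measurable_funeM; apply/measurable_EFinP; exact: measurable_normc.
  - by move=> z _; rewrite -EFinM lee_fin expr2 ler_wpM2r ?normc_ge0.
exact: lte_mul_pinfty.
Qed.

(** In weighted_identity the left-hand sides increase to the integral of
    |FT1 H|^2 by monotone convergence, while the averages on the right-hand side
    stay bounded and converge to 2 pi H by continuity. *)
Lemma Plancherel_line_continuous H (B : R) : cintg leb1 H ->
  (forall y, normc (H y) <= B) ->
  (forall x (u : nat -> R), u k @[k --> \oo] --> (0 : R) ->
    normc (H (u k + x)%R - H x) @[k --> \oo] --> (0 : R)) ->
  N2 leb1 (FT1 H) = ((2 * pi)%:E * N2 leb1 H)%E.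
Proof.
move=> Hi HB cH; have mH := cintg_cmeas Hi; have mh := cmeas_FT1 mH.
have B0 : 0 <= B by apply: le_trans (HB 0); exact: normc_ge0.
have Hoo := N2_bounded_lty HB Hi.
have pi2 : 0 <= 2 * pi :> R by rewrite mulr_ge0// pi_ge0.
have Bpi : 0 <= B * (2 * pi) by rewrite mulr_ge0.
pose w k : R1 -> R := fun b => normc (FT1 H b) ^+ 2 * E k b.
have mw k : measurable_fun [set: R1] (w k).
  by apply: measurable_funM => //; exact: measurable_normc2.
have w0 k b : 0 <= w k b by rewrite mulr_ge0 ?sqr_ge0.
have maverage k : cmeas (average k H).
  apply: (@cmeas_cint _ _ _ R1 R1 leb1
    (fun p : R1 * R1 => H (k.+1%:R^-1 * p.2 + p.1)%R * (Cauchy p.2)%:C)).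
  apply: cmeasM; last exact: (cmeas_comp cmeas_Cauchy measurable_snd).
  apply: (cmeas_comp mH); apply: measurable_funD; last exact: measurable_fst.
  by apply: measurable_funM; [exact: measurable_cst|exact: measurable_snd].
have lim1 : normc (cint leb1 (fun x : R1 => H x * (average k H x)^*%C) -
    cint leb1 (fun x : R1 => H x * (H x * (2 * pi)%:C)^*%C)) @[k --> \oo] --> (0 : R).
  apply: (@cint_dominated _ _ _ _ _ _ (fun x : R1 => normc (H x) * (B * (2 * pi)))).
  - by move=> k; apply: cmeasM => //; exact: cmeas_conj.
  - by apply: cmeasM => //; apply: cmeas_conj; apply: cmeasM => //; exact: cmeas_cst.
  - by apply: measurable_funM; [exact: measurable_normc|exact: measurable_cst].
  - apply: nearW => x; have h := average_cvg HB mH (cH x).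
    have -> : (fun k => normc (H x * (average k H x)^*%C - H x * (H x * (2 * pi)%:C)^*%C)) =
              (fun k => normc (H x) * normc (average k H x - H x * (2 * pi)%:C)).
      by apply/funext => k; rewrite -mulrBr -conjcB normcM normc_conj.
    by rewrite -[X in _ --> X](mulr0 (normc (H x))); apply: cvgMr.
  - by move=> k x; rewrite normcM normc_conj ler_wpM2l ?normc_ge0//; exact: average_bound.
  - move=> x; rewrite normcM normc_conj ler_wpM2l ?normc_ge0// normcM normc_real.
    by rewrite ger0_norm// ler_wpM2r.
  - under eq_integral do rewrite mulrC EFinM.
    have [_ noo] := (cintgP _ _).1 Hi.
    rewrite ge0_integralZl_EFin//.
    + by apply: lte_mul_pinfty => //; rewrite lee_fin.
    + by move=> x _; rewrite lee_fin normc_ge0.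
    + exact: measurable_normc_EFin.
have Hsq : cint leb1 (fun x : R1 => H x * (H x * (2 * pi)%:C)^*%C) =
    (2 * pi * fine (N2 leb1 H))%:C.
  rewrite [RHS]realCM -(cint_sqr mH Hoo) -cintZ; last first.
    by apply: cintg_mul => //; [exact: cmeas_conj|rewrite N2_conj].
  by apply: cint_ext => x; rewrite conjcM conjc_real; ring.
have wfin k : (\int[leb1]_b (w k b)%:E)%E \is a fin_num.
  have i : cintg leb1 (fun b : R1 => (normc (FT1 H b) ^+ 2)%:C * (E k b)%:C).
    pose A := fine (\int[leb1]_x (normc (H x))%:E)%E.
    apply: (@cintgM_bounded _ _ _ _ _ _ (A ^+ 2)) => //.
      by apply: cmeas_real; exact: measurable_normc2.
    move=> b; rewrite normc_real ger0_norm ?sqr_ge0//.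
    rewrite ler_pXn2r ?nnegrE ?normc_ge0//; first exact: FT1_bound.
    by apply: le_trans (FT1_bound 0 Hi); exact: normc_ge0.
  apply: (integrable_fin_num measurableT); have [ri _] := i.
  apply: eq_integrable ri => // b _ /=.
  by rewrite /w mulr0 subr0.
have lim2 : (\int[leb1]_b (w k b)%:E)%E @[k --> \oo] --> ((2 * pi * fine (N2 leb1 H))%:E : \bar R).
  under eq_cvg do rewrite -(fineK (wfin _)).
  apply: cvg_EFin; first exact: nearW.
  apply/subr_cvg0; apply/norm_cvg0P.
  have -> : (fun k => `|fine (\int[leb1]_b (w k b)%:E)%E - 2 * pi * fine (N2 leb1 H)|) =
     (fun k => normc (cint leb1 (fun x : R1 => H x * (average k H x)^*%C) -
    cint leb1 (fun x : R1 => H x * (H x * (2 * pi)%:C)^*%C))).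
    by apply/funext => k; rewrite Hsq -weighted_identity// cint_real -realCB normc_real.
  exact: lim1.
have lim3 : (\int[leb1]_b (w k b)%:E)%E @[k --> \oo] --> N2 leb1 (FT1 H).
  rewrite (_ : N2 leb1 (FT1 H) = \int[leb1]_b limn (fun k => (w k b)%:E))%E; last first.
    apply: eq_integral => b _; apply/esym/cvg_lim => //.
    apply: cvg_EFin; first exact: nearW.
    rewrite -[X in _ --> X]mulr1; apply: cvgMr.
    rewrite -expR0 -oppr0 -[in X in _ --> X](@normr0 _ R) -[in X in _ --> X](mul0r b).
    apply: (@continuous_cvg _ _ _ _ _ _ (@expR R)); first exact: continuous_expR.
    by apply: cvgN; apply: cvg_norm; apply: cvgMl; exact: cvg_step.
  apply: cvg_monotone_convergence => //.
  - by move=> k; exact/measurable_EFinP.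
  - by move=> k b _; rewrite lee_fin.
  - move=> b _ m k mk; rewrite lee_fin ler_wpM2l ?sqr_ge0// ler_expR lerN2 !normrM.
    by rewrite ler_wpM2r// !ger0_norm// lef_pV2 ?posrE// ler_nat.
have -> : N2 leb1 (FT1 H) = (2 * pi * fine (N2 leb1 H))%:E.
  exact: cvg_unique lim3 lim2.
by rewrite EFinM fineK// N2_fin.
Qed.

End Fourier_line.

Section box_average.
Context {R : realType}.
Local Notation R1 := (measurableTypeR R).
Local Notation leb1 := (@lebesgue_measure R).
Implicit Types (H : R1 -> R[i]) (b x : R1).

Lemma ae_neq (a : R1) : {ae leb1, forall y : R1, y != a}.
Proof.
exists [set a]; split; [exact: measurable_set1|exact: lebesgue_measure_set1|].
by move=> y /=; apply: contra_notP => ya; apply/eqP.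
Qed.

Lemma cvg_expi (t : nat -> R) : t k @[k --> \oo] --> (0 : R) ->
  normc (expi (t k) - 1) @[k --> \oo] --> (0 : R).
Proof.
move=> t0.
have c0 : cos (t k) @[k --> \oo] --> (1 : R).
  rewrite -(@cos0 R).
  exact: (@continuous_cvg _ _ _ _ _ _ (@cos R) 0 (@continuous_cos R 0) t0).
have s0 : sin (t k) @[k --> \oo] --> (0 : R).
  rewrite -[X in _ --> X](@sin0 R).
  exact: (@continuous_cvg _ _ _ _ _ _ (@sin R) 0 (@continuous_sin R 0) t0).
apply: (@squeeze_cvgr _ _ _ _ (fun=> 0) (fun k => `|cos (t k) - 1| + `|sin (t k)|)).
- apply: nearW => k; rewrite normc_ge0 andTb.
  by apply: le_trans (normc_le_ReIm _) _; rewrite ReD ImD ReN ImN /= subr0.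
- exact: cvg_cst.
- rewrite -[X in _ --> X]addr0; apply: cvgD.
  + rewrite -[X in _ --> X](@normr0 _ R); apply: cvg_norm.
    by rewrite -[X in _ --> X](subrr 1); apply: cvgB => //; exact: cvg_cst.
  + by rewrite -[X in _ --> X](@normr0 _ R); apply: cvg_norm.
Qed.

Let I (z : R1) : R := \1_(`[0, 1]%classic : set R1) z.

Let mI01 : measurable (`[0, 1]%classic : set R1). Proof. exact: measurable_itv. Qed.

Let mI : measurable_fun [set: R1] I. Proof. exact: measurable_indic. Qed.

Let I_ge0 z : 0 <= I z. Proof. by rewrite /I indicE. Qed.

Let I_le1 z : I z <= 1. Proof. by rewrite /I indicE; case: (_ \in _). Qed.

Let I_sqr z : I z ^+ 2 = I z.
Proof. by rewrite /I indicE; case: (_ \in _); rewrite ?expr1n ?expr0n. Qed.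

Let intI : (\int[leb1]_z (I z)%:E = 1)%E.
Proof.
have h := @lebesgue_measure_itv R `[0%R, 1%R].
rewrite /= lte_fin ltr01 -EFinB subr0 in h.
by rewrite integral_indic// setIT -h.
Qed.

Let cmI : cmeas (fun z => (I z)%:C). Proof. exact: cmeas_real. Qed.

Let normcI z : normc (I z)%:C = I z.
Proof. by rewrite normc_real ger0_norm. Qed.

(** The mean of H over [x, x + e]. Writing it as an integral over [0, 1] of
    translates of H makes its Fourier transform a multiple of that of H. *)
Definition box (e : R) H x : R[i] :=
  cint leb1 (fun z : R1 => H (e * z + x)%R * (I z)%:C).

Variables (e : R) (H : R1 -> R[i]).
Hypotheses (e0 : 0 < e) (Hi : cintg leb1 H).
Let mH : cmeas H. Proof. exact: cintg_cmeas Hi. Qed.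
Let en0 : e != 0. Proof. by rewrite gt_eqF. Qed.
Let A := fine (\int[leb1]_x (normc (H x))%:E)%E.

Let AE : (\int[leb1]_x (normc (H x))%:E = A%:E)%E.
Proof. by rewrite fineK//; exact: integrable_fin_num (cintg_normc Hi). Qed.

Let A_ge0 : 0 <= A.
Proof. by apply: fine_ge0; apply: integral_ge0 => x _; rewrite lee_fin normc_ge0. Qed.

Let m_shift : measurable_fun [set: R1 * R1] (fun p : R1 * R1 => (e * p.2 + p.1 : R1)).
Proof.
apply: measurable_funD; last exact: measurable_fst.
by apply: measurable_funM; [exact: measurable_cst|exact: measurable_snd].
Qed.

Let tonelli_box (g : R1 -> R) : measurable_fun [set: R1] g -> (forall x, 0 <= g x) ->
  (\int[leb1]_x \int[leb1]_z (g (e * z + x)%R * I z)%:E = \int[leb1]_x (g x)%:E)%E.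
Proof.
move=> mg g0.
have := @fubini_tonelli _ _ R1 R1 R leb1 leb1 (fun p : R1 * R1 => (g (e * p.2 + p.1)%R * I p.2)%:E).
have h1 : measurable_fun [set: R1 * R1] (fun p : R1 * R1 => (g (e * p.2 + p.1)%R * I p.2)%:E).
  apply/measurable_EFinP; apply: measurable_funM.
    exact: (measurableT_comp mg m_shift).
  exact: (measurableT_comp mI measurable_snd).
have h2 (p : R1 * R1) : (0 <= (g (e * p.2 + p.1)%R * I p.2)%:E)%E.
  by rewrite lee_fin mulr_ge0.
move=> /(_ h1 h2) ->.
transitivity (\int[leb1]_z ((I z)%:E * \int[leb1]_x (g x)%:E))%E.
  apply: eq_integral => z _ /=.
  have c1 : (1 : R) != 0 by [].
  rewrite -(ge0_integral_affine (e * z) c1 (f := fun x : R1 => (g x)%:E)); last 2 first.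
    exact/measurable_EFinP.
    by move=> x; rewrite lee_fin.
  rewrite normr1 mul1e -ge0_integralZl_EFin//; last 2 first.
    by move=> x _; rewrite lee_fin.
    apply/measurable_EFinP; exact: (measurableT_comp mg (measurable_affine 1 (e * z))).
  by apply: eq_integral => x _; rewrite -EFinM mul1r addrC mulrC.
rewrite ge0_integralZr//.
- by rewrite intI mul1e.
- exact/measurable_EFinP.
- by move=> z _; rewrite lee_fin.
- by apply: integral_ge0 => x _; rewrite lee_fin.
Qed.

Let change (F : R1 -> R[i]) x : cmeas F ->
  cint leb1 (fun z : R1 => e%:C * F (e * z + x)%R) = cint leb1 F.
Proof.
move=> mF.
rewrite -(@cint_change R _ _ leb1 (fun z : R1 => (e * z + x : R1)) `|e|
  (normr_ge0 _) (measurable_affine _ _) (fun f mf f0 => ge0_integral_affine x en0 mf f0) _ mF).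
by rewrite gtr0_norm.
Qed.

Lemma boxE x : box e H x = cint leb1 (fun y : R1 => H y * (e^-1 * I ((y - x) / e)%R)%:C).
Proof.
rewrite -(change x).
  apply: cint_ext => z; rewrite mulrCA -realCM; congr (_ * _%:C).
  by rewrite mulrA divff// mul1r addrK mulrC mulKf.
apply: cmeasM => //; apply: cmeas_real; apply: measurable_funM => //.
apply: (measurableT_comp mI); apply: measurable_funM => //.
by apply: measurable_funB => //; exact: measurable_cst.
Qed.

Lemma cintg_boxE x : cintg leb1 (fun y : R1 => H y * (e^-1 * I ((y - x) / e)%R)%:C).
Proof.
apply: (@cintgMr_bounded _ _ _ _ _ _ e^-1) => //.
- apply: cmeas_real; apply: measurable_funM => //.
  apply: (measurableT_comp mI); apply: measurable_funM => //.
  by apply: measurable_funB => //; exact: measurable_cst.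
- move=> y; rewrite normc_real ger0_norm ?mulr_ge0 ?invr_ge0 ?(ltW e0)//.
  by rewrite ler_piMr// invr_ge0 ltW.
Qed.

Lemma cmeas_box : cmeas (box e H).
Proof.
apply: (@cmeas_cint _ _ _ R1 R1 leb1 (fun p : R1 * R1 => H (e * p.2 + p.1)%R * (I p.2)%:C)).
apply: cmeasM; first exact: (cmeas_comp mH m_shift).
exact: (cmeas_comp cmI measurable_snd).
Qed.

Let cintg_shift x : cintg leb1 (fun z : R1 => H (e * z + x)%R * (I z)%:C).
Proof.
apply: (@cintgMr_bounded _ _ _ _ _ _ 1); [exact: cmI|by move=> z; rewrite normcI|].
apply/cintgP; split; first exact: (cmeas_comp mH (measurable_affine _ _)).
have h := ge0_integral_affine x en0 (f := fun y : R1 => (normc (H y))%:E).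
have := h _ _; rewrite AE => {}h.
have : (`|e|%:E * \int[leb1]_z (normc (H (e * z + x)%R))%:E < +oo)%E.
  rewrite h ?ltry//; first exact: measurable_normc_EFin.
  by move=> y; rewrite lee_fin normc_ge0.
have [->|/eqP] := eqVneq (\int[leb1]_z (normc (H (e * z + x)%R))%:E)%E +oo%E.
  by rewrite gt0_muley ?ltxx// lte_fin normr_gt0.
by move=> ne _; rewrite ltey; apply/eqP.
Qed.

Lemma box_le x : ((normc (box e H x))%:E <= \int[leb1]_z (normc (H (e * z + x)%R) * I z)%:E)%E.
Proof.
apply: le_trans (normc_cint_le (cintg_shift x)) _.
by under eq_integral do rewrite normcM normcI.
Qed.

Lemma cintg_box : cintg leb1 (box e H).
Proof.
apply/cintgP; split; first exact: cmeas_box.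
apply: (@le_lt_trans _ _ A%:E); last exact: ltry.
rewrite -AE -(tonelli_box (g := fun x => normc (H x))); last 2 first.
- exact: measurable_normc.
- by move=> x; exact: normc_ge0.
apply: ge0_le_integral => //.
- by move=> x _; rewrite lee_fin normc_ge0.
- by apply: measurable_normc_EFin; exact: cmeas_box.
- apply: (@measurable_fun_fubini_tonelli_F _ _ R1 R1 R leb1
    (fun p : R1 * R1 => (normc (H (e * p.2 + p.1)%R) * I p.2)%:E)).
    apply/measurable_EFinP; apply: measurable_funM.
      exact: (measurableT_comp (measurable_normc mH) m_shift).
    exact: (measurableT_comp mI measurable_snd).
  by move=> p; rewrite lee_fin mulr_ge0 ?normc_ge0.
- by move=> x _; exact: box_le.
Qed.

Lemma box_bounded x : normc (box e H x) <= e^-1 * A.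
Proof.
rewrite boxE -lee_fin; apply: le_trans (normc_cint_le (cintg_boxE x)) _.
rewrite EFinM -AE -ge0_integralZl_EFin ?invr_ge0 ?(ltW e0)//; last 2 first.
- by move=> y _; rewrite lee_fin normc_ge0.
- exact: measurable_normc_EFin.
apply: ge0_le_integral => //.
- by move=> y _; rewrite lee_fin normc_ge0.
- by apply: measurable_normc_EFin; exact: cintg_cmeas (cintg_boxE x).
- by apply: measurable_funeM; apply/measurable_EFinP; exact: measurable_normc.
- move=> y _; rewrite -EFinM lee_fin normcM normc_real mulrC ler_wpM2r ?normc_ge0//.
  rewrite ger0_norm ?mulr_ge0 ?invr_ge0 ?(ltW e0)//.
  by rewrite ler_piMr// invr_ge0 ltW.
Qed.

Let cvg_I (t : R) (u : nat -> R) : t != 0 -> t != 1 -> u k @[k --> \oo] --> t ->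
  I (u k) @[k --> \oo] --> I t.
Proof.
move=> t0 t1 ut; apply: cvg_near_cst.
have [tlt0|tgt0|teq] := ltgtP t 0; last by rewrite teq eqxx in t0.
- have h : \forall k \near \oo, u k < 0 by have := cvgr_lt _ ut _ tlt0; apply.
  apply: filterS h => k uk.
  rewrite /I !indicE !memNset//= in_itv/=; apply/negP; rewrite negb_and -!ltNge.
    by rewrite tlt0.
  by rewrite uk.
have [tlt1|tgt1|teq] := ltgtP t 1; last by rewrite teq eqxx in t1.
- have h1 : \forall k \near \oo, u k < 1 by have := cvgr_lt _ ut _ tlt1; apply.
  have h2 : \forall k \near \oo, 0 < u k by have := cvgr_gt _ ut _ tgt0; apply.
  apply: filterS2 h1 h2 => k uk1 uk0; rewrite /I !indicE !mem_set//= in_itv/=.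
    by rewrite !ltW.
  by rewrite !ltW.
- have h : \forall k \near \oo, 1 < u k by have := cvgr_gt _ ut _ tgt1; apply.
  apply: filterS h => k uk.
  rewrite /I !indicE !memNset//= in_itv/=; apply/negP; rewrite negb_and -!ltNge.
    by rewrite tgt1 orbT.
  by rewrite uk orbT.
Qed.

(** Moving the window changes the integrand only at its two end points in the
    limit, hence almost nowhere. *)
Lemma box_continuous x (u : nat -> R) : u k @[k --> \oo] --> (0 : R) ->
  normc (box e H (u k + x)%R - box e H x) @[k --> \oo] --> (0 : R).
Proof.
move=> u0; rewrite boxE; under eq_cvg do rewrite boxE.
apply: (@cint_dominated _ _ _ _ _ _ (fun y : R1 => normc (H y) * e^-1)).
- by move=> k; exact: cintg_cmeas (cintg_boxE _).
- exact: cintg_cmeas (cintg_boxE _).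
- by apply: measurable_funM; [exact: measurable_normc|exact: measurable_cst].
- have := ae_neq x; apply: filterS2 (ae_neq (x + e)%R) => y y1 y2.
  have ut : (y - (u k + x)) / e @[k --> \oo] --> (y - x) / e.
    apply: cvgMl; rewrite -[X in _ --> X]/(y - x) -{2}(add0r x).
    by apply: cvgB; [exact: cvg_cst|apply: cvgD => //; exact: cvg_cst].
  have tn0 : (y - x) / e != 0 by rewrite mulf_neq0 ?invr_neq0// subr_eq0.
  have tn1 : (y - x) / e != 1.
    by rewrite -(divff en0) (inj_eq (mulIf (invr_neq0 en0))) subr_eq addrC.
  have h := cvg_I tn0 tn1 ut.
  have -> : (fun k => normc (H y * (e^-1 * I ((y - (u k + x)) / e))%:C -
      H y * (e^-1 * I ((y - x) / e))%:C)) =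
      (fun k => normc (H y) * e^-1 * `|I ((y - (u k + x)) / e) - I ((y - x) / e)|).
    apply/funext => k; rewrite -mulrBr -realCB -mulrBr normcM normc_real normrM.
    by rewrite mulrA (@ger0_norm _ e^-1)// invr_ge0 ltW.
  rewrite -[X in _ --> X](mulr0 (normc (H y) * e^-1)); apply: cvgMr.
  apply/norm_cvg0P; apply/subr_cvg0; exact: h.
- move=> k y; rewrite normcM ler_wpM2l ?normc_ge0// normc_real.
  rewrite ger0_norm ?mulr_ge0 ?invr_ge0 ?(ltW e0)//.
  by rewrite ler_piMr// invr_ge0 ltW.
- move=> y; rewrite normcM ler_wpM2l ?normc_ge0// normc_real.
  rewrite ger0_norm ?mulr_ge0 ?invr_ge0 ?(ltW e0)//.
  by rewrite ler_piMr// invr_ge0 ltW.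
- under eq_integral do rewrite mulrC EFinM.
  rewrite ge0_integralZl_EFin ?invr_ge0 ?(ltW e0)//.
  + by rewrite AE -EFinM ltry.
  + by move=> y _; rewrite lee_fin normc_ge0.
  + exact: measurable_normc_EFin.
Qed.

Definition box_symbol b : R[i] := cint leb1 (fun z : R1 => (I z)%:C * expi (b * e * z)).

Let cintg_symbol b : cintg leb1 (fun z : R1 => (I z)%:C * expi (b * e * z)).
Proof.
apply: (@cintgMr_bounded _ _ _ _ _ _ 1).
- by apply: cmeas_expi; exact: (mulrl_measurable (b * e)).
- by move=> z; rewrite normc_expi.
- apply: cintg_real; apply/integrableP; split; first exact/measurable_EFinP.
  by under eq_integral do rewrite /= ger0_norm//; rewrite intI ltry.
Qed.

Lemma FT1_box b : FT1 (box e H) b = box_symbol b * FT1 H b.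
Proof.
pose F (p : R1 * R1) : R[i] := (H (e * p.2 + p.1)%R * (I p.2)%:C) * expi (- (b * p.1)).
have mF : cmeas F.
  apply: cmeasM.
    apply: cmeasM; first exact: (cmeas_comp mH m_shift).
    exact: (cmeas_comp cmI measurable_snd).
  apply: cmeas_expi; apply: measurableT_comp => //.
  by apply: measurable_funM; [exact: measurable_cst|exact: measurable_fst].
have foo : (\int[leb1]_x \int[leb1]_z (normc (F (x, z)))%:E < +oo)%E.
  under eq_integral do under eq_integral do rewrite /F /= !normcM normc_expi mulr1 normcI.
  rewrite (tonelli_box (g := fun x => normc (H x))); last 2 first.
  - exact: measurable_normc.
  - by move=> x; exact: normc_ge0.
  by rewrite AE ltry.
transitivity (cint leb1 (fun x : R1 => cint leb1 (fun z : R1 => F (x, z)))).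
  apply: cint_ext => x; rewrite mulrC /box -cintZ; last exact: cintg_shift.
  by apply: cint_ext => z; rewrite /F mulrC.
rewrite cint_fubini// mulrC /box_symbol -cintZ; last exact: cintg_symbol.
apply: cint_ext => z; rewrite /FT1 mulrC -cintZ; last exact: cintg_phase1.
have c1 : (1 : R) != 0 by [].
have mG : cmeas (fun y : R1 => (I z)%:C * expi (b * e * z) * (H y * expi (- (b * y)))).
  apply: cmeasM; first exact: cmeas_cst.
  by apply: cintg_cmeas; exact: cintg_phase1.
rewrite -(@cint_change R _ _ leb1 (fun x : R1 => (1 * x + e * z : R1)) `|1|
  (normr_ge0 _) (measurable_affine _ _) (fun f mf f0 => ge0_integral_affine (e * z) c1 mf f0) _ mG).
apply: cint_ext => x; rewrite normr1 /F /= mul1r (addrC x).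
rewrite [RHS](_ : _ = H (e * z + x) * (I z)%:C * (expi (b * e * z) * expi (- (b * (e * z + x))))); last by rewrite mul1r; ring.
by rewrite -expiD; congr (_ * expi _); ring.
Qed.

Lemma box_symbol_le1 b : normc (box_symbol b) <= 1.
Proof.
rewrite -lee_fin; apply: le_trans (normc_cint_le (cintg_symbol b)) _.
by under eq_integral do rewrite normcM normc_expi mulr1 normcI; rewrite intI.
Qed.

Lemma cmeas_box_symbol : cmeas box_symbol.
Proof.
apply: (@cmeas_cint _ _ _ R1 R1 leb1 (fun p : R1 * R1 => (I p.2)%:C * expi (p.1 * e * p.2))).
apply: cmeasM; first exact: (cmeas_comp cmI measurable_snd).
apply: cmeas_expi; apply: measurable_funM; last exact: measurable_snd.
by apply: measurable_funM; [exact: measurable_fst|exact: measurable_cst].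
Qed.

(** Jensen's inequality for the uniform law on [0, 1], then translation
    invariance. *)
Lemma N2_box : (N2 leb1 (box e H) <= N2 leb1 H)%E.
Proof.
rewrite /N2 -(tonelli_box (g := fun x => normc (H x) ^+ 2)); last 2 first.
- exact: measurable_normc2.
- by move=> x; exact: sqr_ge0.
apply: ge0_le_integral => //.
- by move=> x _; rewrite lee_fin sqr_ge0.
- by apply: measurable_normc2_EFin; exact: cmeas_box.
- apply: (@measurable_fun_fubini_tonelli_F _ _ R1 R1 R leb1
    (fun p : R1 * R1 => (normc (H (e * p.2 + p.1)%R) ^+ 2 * I p.2)%:E)).
    apply/measurable_EFinP; apply: measurable_funM.
      exact: (measurableT_comp (measurable_normc2 mH) m_shift).
    exact: (measurableT_comp mI measurable_snd).
  by move=> p; rewrite lee_fin mulr_ge0 ?sqr_ge0.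
move=> x _.
pose f (z : R1) := H (e * z + x)%R * (I z)%:C.
have mf : cmeas f by exact: cintg_cmeas (cintg_shift x).
have N2I : N2 leb1 (fun z => (I z)%:C) = 1%E.
  by rewrite -intI; apply: eq_integral => z _; rewrite normcI I_sqr.
have N2f : N2 leb1 f = (\int[leb1]_z (normc (H (e * z + x)%R) ^+ 2 * I z)%:E)%E.
  by apply: eq_integral => z _; rewrite /f normcM exprMn normcI I_sqr.
rewrite -N2f; have [->|/eqP ne] := eqVneq (N2 leb1 f) +oo%E; first by rewrite leey.
have foo : (N2 leb1 f < +oo)%E by rewrite ltey; apply/eqP.
have Ioo : (N2 leb1 (fun z => (I z)%:C) < +oo)%E by rewrite N2I ltry.
have h := normc_cint_mul mf cmI foo Ioo.
rewrite N2I sqrtr1 mulr1 in h.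
rewrite -(fineK (N2_fin foo)) lee_fin.
rewrite -[leRHS](sqr_sqrtr (fine_ge0 (N2_ge0 _ _))).
rewrite ler_pXn2r ?nnegrE ?normc_ge0 ?sqrtr_ge0//.
rewrite (_ : box e H x = cint leb1 (fun z => f z * (I z)%:C))//.
apply: cint_ext => z; rewrite /f -mulrA -realCM; congr (_ * _%:C).
by rewrite -[LHS]I_sqr expr2.
Qed.

End box_average.

Section Plancherel_line.
Context {R : realType}.
Local Notation R1 := (measurableTypeR R).
Local Notation leb1 := (@lebesgue_measure R).
Implicit Types (H : R1 -> R[i]) (b x : R1).

Let eps n : R := n.+1%:R^-1.
Let eps_gt0 n : 0 < eps n. Proof. by rewrite invr_gt0. Qed.
Let eps_cvg : eps n @[n --> \oo] --> (0 : R). Proof. exact: cvg_harmonic. Qed.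

Let window (x : R) n : set R1 := `[x, x + eps n]%classic.

Let window_shrinking x : nicely_shrinking x (window x).
Proof.
split; first by move=> n; exact: measurable_itv.
(* The ball of radius 2 eps contains the window and is 4 times as long. *)
exists (4, fun n => PosNum (mulr_gt0 (ltr0n R 2) (eps_gt0 n))); split => //=.
- rewrite -[X in _ --> X](mulr0 2); apply: cvgMr; exact: eps_cvg.
- move=> n y; rewrite /window /ball /= in_itv/= => /andP[xy yx].
  rewrite distrC ger0_norm ?subr_ge0//.
  have := eps_gt0 n; lra.
- move=> n; rewrite lebesgue_measure_ball; last by rewrite mulr_ge0// ltW.
  rewrite /window lebesgue_measure_itv/= lte_fin ltrDl eps_gt0 -EFinB -EFinM lee_fin.
  have := eps_gt0 n; lra.
Qed.

(** Lebesgue's differentiation theorem along the windows [x, x + eps n]. *)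
Let differentiation (f : R1 -> R) : leb1.-integrable setT (EFin \o f) ->
  {ae leb1, forall x : R1,
    Rintegral leb1 setT (fun y : R1 =>
      f y * ((eps n)^-1 * \1_(`[0, 1]%classic : set R1) ((y - x) / eps n))) @[n --> \oo] --> f x}.
Proof.
move=> fi; have locf : locally_integrable setT f.
  exact: (open_integrable_locally openT fi).
have := lebesgue_differentiation locf.
apply: filterS; first exact: (ae_filter_ringOfSetsType leb1).
move=> x fx.
have h := @nice_lebesgue_differentiation R window window_shrinking f locf x fx.
have -> : (fun n => Rintegral leb1 setT (fun y : R1 =>
      f y * ((eps n)^-1 * \1_(`[0, 1]%classic : set R1) ((y - x) / eps n)))) =
   fine \o (fun n => (leb1 (window x n))^-1 * \int[leb1]_(y in window x n) (f y)%:E)%E.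
  apply/funext => n /=; rewrite /Rintegral; congr fine.
  have mw : measurable (window x n) by exact: measurable_itv.
  have iw : leb1.-integrable (window x n) (EFin \o f).
    exact: (@integrableS _ _ _ leb1 setT).
  rewrite /window lebesgue_measure_itv/= lte_fin ltrDl eps_gt0 -EFinB addrAC subrr add0r.
  rewrite inver gt_eqF ?eps_gt0//.
  rewrite -(integralZl mw iw) integral_mkcond.
  apply: eq_integral => y _; rewrite patchE indicE.
  have -> : (y \in window x n) = ((y - x) / eps n \in (`[0, 1]%classic : set R1)).
    rewrite /window; apply/idP/idP => /set_mem /=; rewrite !in_itv/= => /andP[h1 h2];
      apply/mem_set; rewrite /= in_itv/=; apply/andP; split.
    - by rewrite divr_ge0 ?subr_ge0// ltW.
    - by rewrite ler_pdivrMr// mul1r lerBlDl.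
    - by move: h1; rewrite pmulr_lge0 ?invr_gt0// subr_ge0.
    - by move: h2; rewrite ler_pdivrMr// mul1r lerBlDl.
  by case: ifP => _ /=; rewrite ?mulr1 ?mulr0// -EFinM mulrC.
exact: fine_cvg h.
Qed.

Lemma box_cvg H : cintg leb1 H ->
  {ae leb1, forall x : R1, normc (box (eps n) H x - H x) @[n --> \oo] --> (0 : R)}.
Proof.
move=> Hi; have [ri ji] := Hi.
apply: filterS2 (differentiation ri) (differentiation ji) => x /= rx jx.
pose a n := Re (box (eps n) H x) - Re (H x).
pose c n := Im (box (eps n) H x) - Im (H x).
have ReZ (z : R[i]) (r : R) : Re (z * r%:C) = Re z * r by rewrite ReM /= mulr0 subr0.
have ImZ (z : R[i]) (r : R) : Im (z * r%:C) = Im z * r by rewrite ImM /= mulr0 add0r.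
have a0 : a n @[n --> \oo] --> (0 : R).
  rewrite /a -[X in _ --> X](subrr (Re (H x))); apply: cvgB; last exact: cvg_cst.
  have -> : (fun n => Re (box (eps n) H x)) = (fun n => Rintegral leb1 setT (fun y : R1 =>
      Re (H y) * ((eps n)^-1 * \1_(`[0, 1]%classic : set R1) ((y - x) / eps n)))).
    apply/funext => n; rewrite (boxE (eps_gt0 n) Hi) Re_cint; congr Rintegral.
    by apply/funext => y; rewrite /= ReZ.
  exact: rx.
have c0 : c n @[n --> \oo] --> (0 : R).
  rewrite /c -[X in _ --> X](subrr (Im (H x))); apply: cvgB; last exact: cvg_cst.
  have -> : (fun n => Im (box (eps n) H x)) = (fun n => Rintegral leb1 setT (fun y : R1 =>
      Im (H y) * ((eps n)^-1 * \1_(`[0, 1]%classic : set R1) ((y - x) / eps n)))).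
    apply/funext => n; rewrite (boxE (eps_gt0 n) Hi) Im_cint; congr Rintegral.
    by apply/funext => y; rewrite /= ImZ.
  exact: jx.
apply: (@squeeze_cvgr _ _ _ _ (fun=> 0) (fun n => `|a n| + `|c n|)).
- apply: nearW => n; rewrite normc_ge0 andTb.
  by apply: le_trans (normc_le_ReIm _) _; rewrite ReD ImD ReN ImN.
- exact: cvg_cst.
- rewrite -[X in _ --> X]addr0; apply: cvgD.
  + by rewrite -[X in _ --> X](@normr0 _ R); apply: cvg_norm.
  + by rewrite -[X in _ --> X](@normr0 _ R); apply: cvg_norm.
Qed.

Let symbol_cvg b : normc (box_symbol (eps n) b - 1) @[n --> \oo] --> (0 : R).
Proof.
pose I (z : R1) : R := \1_(`[0, 1]%classic : set R1) z.
have mI : measurable_fun [set: R1] I by apply: measurable_indic; exact: measurable_itv.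
have I0 z : 0 <= I z by rewrite /I indicE.
have intI : (\int[leb1]_z (I z)%:E = 1)%E.
  have h := @lebesgue_measure_itv R `[0%R, 1%R].
  rewrite /= lte_fin ltr01 -EFinB subr0 in h.
  by rewrite integral_indic ?setIT -?h//; exact: measurable_itv.
have -> : 1 = cint leb1 (fun z => (I z)%:C) by rewrite cint_real /Rintegral intI.
apply: (@cint_dominated _ _ _ _ _ _ I) => //.
- move=> n; apply: cmeasM; first exact: cmeas_real.
  by apply: cmeas_expi; exact: (mulrl_measurable (b * eps n)).
- exact: cmeas_real.
- apply: nearW => z.
  have t0 : b * eps n * z @[n --> \oo] --> (0 : R).
    rewrite -[X in _ --> X](mul0r z) -[X in X * z](mulr0 b); apply: cvgMl; apply: cvgMr.
    exact: eps_cvg.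
  have h := cvg_expi t0.
  have -> : (fun n => normc ((\1_(`[0, 1]%classic : set R1) z)%:C * expi (b * eps n * z) - (I z)%:C)) =
            (fun n => I z * normc (expi (b * eps n * z) - 1)).
    apply/funext => n; rewrite -/(I z) -{2}[(I z)%:C]mulr1 -mulrBr normcM normc_real.
    by rewrite ger0_norm.
  by rewrite -[X in _ --> X](mulr0 (I z)); apply: cvgMr.
- by move=> n z; rewrite normcM normc_expi mulr1 normc_real ger0_norm// ?I0.
- by move=> z; rewrite normc_real ger0_norm.
- by rewrite intI ltry.
Qed.

(** Both sides may be infinite. The box averages of H are bounded and continuous,
    converge to H almost everywhere and do not increase N2; their transforms are
    that of H multiplied by symbols of modulus at most 1 that tend to 1. So the
    identity for the averages yields one inequality by Fatou's lemma on the
    transform side and the other by Fatou's lemma for the averages. *)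
Theorem Plancherel_line H : cintg leb1 H ->
  N2 leb1 (FT1 H) = ((2 * pi)%:E * N2 leb1 H)%E.
Proof.
move=> Hi; have mH := cintg_cmeas Hi; have mh := cmeas_FT1 mH.
have pi2 : 0 <= 2 * pi :> R by rewrite mulr_ge0// pi_ge0.
have pigt0 : 0 < 2 * pi :> R by rewrite mulr_gt0// pi_gt0.
have boxP n : N2 leb1 (FT1 (box (eps n) H)) = ((2 * pi)%:E * N2 leb1 (box (eps n) H))%E.
  apply: Plancherel_line_continuous.
  - exact: cintg_box.
  - by move=> y; apply: box_bounded.
  - by move=> x u u0; apply: box_continuous.
have FTbox n : FT1 (box (eps n) H) = fun b => box_symbol (eps n) b * FT1 H b.
  by apply/funext => b; exact: FT1_box.
have msym n : cmeas (fun b => box_symbol (eps n) b * FT1 H b).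
  by apply: cmeasM => //; exact: cmeas_box_symbol.
apply/eqP; rewrite eq_le; apply/andP; split.
- apply: (@N2_fatou _ _ _ leb1 (fun n b => box_symbol (eps n) b * FT1 H b)) => //.
  + apply: nearW => b.
    have -> : (fun n => normc (box_symbol (eps n) b * FT1 H b - FT1 H b)) =
              (fun n => normc (box_symbol (eps n) b - 1) * normc (FT1 H b)).
      by apply/funext => n; rewrite -normcM mulrBl mul1r.
    by rewrite -[X in _ --> X](mul0r (normc (FT1 H b))); apply: cvgMl; exact: symbol_cvg.
  + move=> n; rewrite -FTbox boxP lee_wpmul2l ?lee_fin//.
    exact: N2_box.
- rewrite -lee_pdivlMl//.
  apply: (@N2_fatou _ _ _ leb1 (fun n => box (eps n) H)) => //.
  + by move=> n; exact: cmeas_box.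
  + exact: box_cvg.
  + move=> n; rewrite lee_pdivlMl// -boxP FTbox.
    apply: le_N2 => //; apply: nearW => b; rewrite normcM.
    by rewrite ler_piMl ?normc_ge0//; exact: box_symbol_le1.
Qed.

End Plancherel_line.

(** * Integrals over products and over R^n *)

Section product_integrals.
Context {R : realType} d1 d2 (T1 : measurableType d1) (T2 : measurableType d2).
Variables (m1 : {sigma_finite_measure set T1 -> \bar R})
          (m2 : {sigma_finite_measure set T2 -> \bar R}).
Implicit Types f : T1 * T2 -> R[i].

Lemma cintg_prod_lty f : cintg (m1 \x m2)%E f ->
  (\int[m1]_x \int[m2]_y (normc (f (x, y)))%:E < +oo)%E.
Proof.
move=> /cintgP[mf foo]; rewrite -(@fubini_tonelli1 _ _ _ _ _ m1 m2 (fun p => (normc (f p))%:E))//.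
- exact: measurable_normc_EFin.
- by move=> x; rewrite lee_fin normc_ge0.
Qed.

Lemma ae_cintg2 f : cintg (m1 \x m2)%E f ->
  {ae m2, forall y, cintg m1 (fun x => f (x, y))}.
Proof.
by move=> [rf jf]; apply: filterS2 (ae_integrable2 rf) (ae_integrable2 jf) => y ry jy.
Qed.

Lemma measurable_integral2 (u : T1 * T2 -> \bar R) : measurable_fun setT u ->
  (forall p, 0 <= u p)%E -> measurable_fun [set: T2] (fun y => \int[m1]_x u (x, y))%E.
Proof. by move=> mu u0; exact: (measurable_fun_fubini_tonelli_G u). Qed.

Lemma cmeas_cint2 f : cmeas f -> cmeas (fun y => cint m1 (fun x => f (x, y))).
Proof.
move=> mf; apply: (@cmeas_cint _ _ _ T2 T1 m1 (fun p => f (p.2, p.1))).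
by apply: (cmeas_comp mf); apply: measurable_fun_pair; [exact: measurable_snd|exact: measurable_fst].
Qed.

Lemma cintg_cint2 f : cintg (m1 \x m2)%E f ->
  cintg m2 (fun y => cint m1 (fun x => f (x, y))).
Proof.
move=> fi; have mf := cintg_cmeas fi.
apply/cintgP; split; first exact: cmeas_cint2.
have mn : measurable_fun setT (fun p => (normc (f p))%:E).
  exact: measurable_normc_EFin.
have n0 p : (0 <= (normc (f p))%:E)%E by rewrite lee_fin normc_ge0.
apply: le_lt_trans (cintg_prod_lty fi).
rewrite (fubini_tonelli (fun p => (normc (f p))%:E))//.
apply: ae_ge0_le_integral => //.
- by move=> y _; rewrite lee_fin normc_ge0.
- by apply: measurable_normc_EFin; exact: cmeas_cint2.
- by move=> y _; apply: integral_ge0.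
- exact: (measurable_integral2 mn n0).
- by apply: filterS (ae_cintg2 fi) => y fy _; exact: normc_cint_le.
Qed.

End product_integrals.

Notation coord := Defs.coord.

Section tuples.
Context {R : realType}.
Local Notation R1 := (measurableTypeR R).
Local Notation leb1 := (@lebesgue_measure R).
Local Notation leb := (lebesgue_Rn R).

Lemma tuple_tcons n (P : Rn R n.+1 -> Prop) :
  (forall x t, P (tcons (x, t))) -> forall u, P u.
Proof.
by move=> h u; case/tupleP: u => x t; have := h x t; congr P; exact: val_inj.
Qed.

Lemma coord_tcons0 n x (t : Rn R n) : coord (tcons (x, t)) ord0 = x.
Proof. by rewrite /coord /tcons tnth0. Qed.

Lemma coord_tconsS n x (t : Rn R n) i : coord (tcons (x, t)) (lift ord0 i) = coord t i.
Proof. by rewrite /coord /tcons tnthS. Qed.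

Lemma dotRn_tcons n x y (t u : Rn R n) :
  dotRn (tcons (x, t)) (tcons (y, u)) = x * y + dotRn t u.
Proof.
rewrite /dotRn big_ord_recl !coord_tcons0; congr (_ + _).
by apply: eq_bigr => i _; rewrite !coord_tconsS.
Qed.

Lemma absp_tcons n x (t : Rn R n) : absp (tcons (x, t)) = `|x| * absp t.
Proof.
rewrite /absp big_ord_recl coord_tcons0 normrM; congr (_ * `|_|).
by apply: eq_bigr => i _; rewrite coord_tconsS.
Qed.

Lemma absp0 (t : Rn R 0) : absp t = 1.
Proof. by rewrite /absp big_ord0 normr1. Qed.

Lemma dotRn0 (t u : Rn R 0) : dotRn t u = 0.
Proof. by rewrite /dotRn big_ord0. Qed.

Lemma absp_ge0 n (t : Rn R n) : 0 <= absp t. Proof. exact: normr_ge0. Qed.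

Lemma measurable_coord n (i : 'I_n) : measurable_fun [set: Rn R n] (fun t : Rn R n => coord t i).
Proof. exact: measurable_tnth. Qed.

Lemma measurable_dotRn n :
  measurable_fun [set: Rn R n * Rn R n] (fun p : Rn R n * Rn R n => dotRn p.1 p.2).
Proof.
rewrite /dotRn; apply: measurable_sum => i.
apply: measurable_funM.
- exact: (measurableT_comp (measurable_coord i) measurable_fst).
- exact: (measurableT_comp (measurable_coord i) measurable_snd).
Qed.

Lemma measurable_absp n : measurable_fun [set: Rn R n] (@absp R n).
Proof.
apply: measurableT_comp => //; apply: measurable_prod => i _; exact: measurable_coord.
Qed.

Lemma measurable_to_Rn d (T : measurableType d) n (f : T -> Rn R n) :
  (forall i, measurable_fun [set: T] (fun x => coord (f x) i)) -> measurable_fun [set: T] f.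
Proof. by move=> h; apply/measurable_fun_tnthP => i; exact: h. Qed.

Lemma ge0_integral_tcons n (f : Rn R n.+1 -> \bar R) : measurable_fun setT f ->
  (forall x, 0 <= f x)%E ->
  (\int[leb n.+1]_u f u = \int[leb1]_x \int[leb n]_t f (tcons (x, t)))%E.
Proof.
move=> mf f0.
rewrite -(fubini_tonelli1 (fun p => f (tcons p)))//; last first.
  exact: (measurableT_comp mf (@measurable_tcons R n)).
pose P : {measure set (Rn R n.+1) -> \bar R} :=
  measure_function_pushforward__canonical__measure_function_Measure
    (leb1 \x leb n)%E (@measurable_tcons R n).
transitivity (\int[P]_(u in setT) f u)%E.
  by apply: eq_measure_integral => A mA _.
rewrite -[LHS]/(\int[pushforward (leb1 \x leb n)%E (@tcons R n)]_(u in setT) f u)%E.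
by rewrite (ge0_integral_pushforward (@measurable_tcons R n))// => y _; exact: f0.
Qed.

Lemma cintg_tcons n (f : Rn R n.+1 -> R[i]) : cintg (leb n.+1) f ->
  cintg (leb1 \x leb n)%E (fun p => f (tcons p)).
Proof.
move=> /cintgP[mf foo]; apply: cintg_prod; first exact: (cmeas_comp mf (@measurable_tcons R n)).
rewrite -(ge0_integral_tcons (f := fun u => (normc (f u))%:E))//.
- exact: measurable_normc_EFin.
- by move=> u; rewrite lee_fin normc_ge0.
Qed.

Lemma Rintegral_tcons n (f : Rn R n.+1 -> R) : measurable_fun setT f ->
  Rintegral (leb n.+1) setT f = Rintegral (leb1 \x leb n)%E setT (fun p => f (tcons p)).
Proof.
move=> mf.
have part (g : \bar R -> \bar R) : measurable_fun setT g -> (forall r, 0 <= g r)%E ->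
    (\int[leb n.+1]_u g (f u)%:E = \int[leb1 \x leb n]_p g (f (tcons p))%:E)%E.
  move=> mg g0; have mgf : measurable_fun setT (fun u => g (f u)%:E).
    by apply: (measurableT_comp mg); exact/measurable_EFinP.
  rewrite ge0_integral_tcons// (fubini_tonelli1 (fun p => g (f (tcons p))%:E))//.
  exact: (measurableT_comp mgf (@measurable_tcons R n)).
have mp : measurable_fun [set: \bar R] (fun r => maxe r 0%E) by exact: measurable_maxe.
have mn : measurable_fun [set: \bar R] (fun r => maxe (- r)%E 0%E).
  by apply: measurable_maxe => //; exact: oppe_measurable.
have max0 (r : \bar R) : (0 <= maxe r 0)%E by rewrite le_max lexx orbT.
have ep := part _ mp (fun r => max0 r).
have en := part _ mn (fun r => max0 _).
rewrite /Rintegral [X in fine X = _]integralE [X in _ = fine X]integralE.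
under eq_integral do rewrite funeposE.
under [X in (_ - X)%E]eq_integral do rewrite funenegE.
rewrite ep en; congr (fine (_ - _)%E).
- by apply: eq_integral => p _; rewrite funeposE.
- by apply: eq_integral => p _; rewrite funenegE.
Qed.

Lemma cint_tcons n (f : Rn R n.+1 -> R[i]) : cmeas f ->
  cint (leb n.+1) f = cint (leb1 \x leb n)%E (fun p => f (tcons p)).
Proof.
by move=> [rf jf]; apply: ReIm_inj; rewrite !(Re_cint, Im_cint); exact: Rintegral_tcons.
Qed.

(** Induction on the dimension: over a nonzero first coordinate, the section of
    the exceptional set is the exceptional set one dimension lower. *)
Lemma ae_absp_neq0 n : {ae leb n, forall t : Rn R n, absp t != 0}.
Proof.
have mZ m : measurable [set t : Rn R m | absp t == 0].
  have -> : [set t : Rn R m | absp t == 0] = (@absp R m) @^-1` [set 0].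
    by apply/seteqP; split => t /= /eqP.
  by rewrite -[X in measurable X]setTI; exact: (measurable_absp).
suff Z0 : leb n [set t | absp t == 0] = 0%E.
  exists [set t | absp t == 0]; split; [exact: mZ|exact: Z0|] => t /=.
  by move=> /negP; rewrite negbK.
elim: n => [|n IH].
  rewrite (_ : [set t | _] = set0) ?measure0//.
  by apply/seteqP; split => // t /=; rewrite absp0 oner_eq0.
rewrite -[X in leb n.+1 X]setIT -integral_indic//; last exact: mZ.
rewrite ge0_integral_tcons; last 2 first.
- by apply/measurable_EFinP; exact: (measurable_indic (mZ _)).
- by move=> u; rewrite lee_fin indicE.
rewrite (ae_eq_integral (cst 0%E)) ?integral0//.
- apply: (measurable_fun_fubini_tonelli_F
    (fun p : R1 * Rn R n => (\1_[set t | absp t == 0] (tcons p))%:E)).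
    apply/measurable_EFinP; apply: (measurableT_comp _ (@measurable_tcons R n)).
    exact: (measurable_indic (mZ _)).
  by move=> p; rewrite lee_fin indicE.
- apply: filterS (ae_neq 0) => x x0 _ /=.
  rewrite -[RHS]IH -[X in _ = leb n X]setIT -integral_indic//; last exact: mZ.
  apply: eq_integral => t _; rewrite !indicE; congr ((nat_of_bool _)%:R%:E : \bar R).
  apply/idP/idP => /set_mem/= h; apply/mem_set => /=.
    by move: h; rewrite absp_tcons mulf_eq0 normr_eq0 (negbTE x0).
  by rewrite absp_tcons mulf_eq0 h orbT.
Qed.

Definition affRn n (a b t : Rn R n) : Rn R n :=
  [tuple (coord a i * coord t i + coord b i : R) | i < n].

Lemma coord_affRn n (a b t : Rn R n) i :
  coord (affRn a b t) i = coord a i * coord t i + coord b i.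
Proof. by rewrite /coord /affRn tnth_mktuple. Qed.

Lemma eq_coord n (t u : Rn R n) : (forall i, coord t i = coord u i) -> t = u.
Proof. by move=> h; apply: eq_from_tnth => i; exact: h. Qed.

Lemma affRn_tcons n a0 b0 x (a b t : Rn R n) :
  affRn (tcons (a0, a)) (tcons (b0, b)) (tcons (x, t)) = tcons (a0 * x + b0, affRn a b t).
Proof.
apply: eq_coord => i; rewrite coord_affRn; case: (unliftP ord0 i) => [j|] ->.
  by rewrite !coord_tconsS coord_affRn.
by rewrite !coord_tcons0.
Qed.

Lemma measurable_affRn n (a b : Rn R n) : measurable_fun [set: Rn R n] (affRn a b).
Proof.
apply: measurable_to_Rn => i; under eq_fun do rewrite coord_affRn.
apply: measurable_funD; last exact: measurable_cst.
by apply: measurable_funM; [exact: measurable_cst|exact: measurable_coord].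
Qed.

Lemma ge0_integral_affRn n (a b : Rn R n) (f : Rn R n -> \bar R) : absp a != 0 ->
  measurable_fun setT f -> (forall x, 0 <= f x)%E ->
  ((absp a)%:E * \int[leb n]_t f (affRn a b t) = \int[leb n]_t f t)%E.
Proof.
elim: n a b f => [a b f _ mf f0|n IH a b f].
  rewrite absp0 mul1e; apply: eq_integral => t _; congr f.
  by apply: eq_coord => -[].
elim/tuple_tcons: a => a0 a; elim/tuple_tcons: b => b0 b.
rewrite absp_tcons mulf_eq0 negb_or normr_eq0 => /andP[a00 an0] mf f0.
have mfa : measurable_fun setT (fun u => f (affRn (tcons (a0, a)) (tcons (b0, b)) u)).
  exact: (measurableT_comp mf (measurable_affRn _ _)).
have mft : measurable_fun setT (fun p : R1 * Rn R n => f (tcons p)).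
  exact: (measurableT_comp mf (@measurable_tcons R n)).
rewrite ge0_integral_tcons// [RHS]ge0_integral_tcons//.
pose g (x : R1) : \bar R := (\int[leb n]_t f (tcons (x, t)))%E.
have mg : measurable_fun [set: R1] g.
  exact: (measurable_fun_fubini_tonelli_F (fun p : R1 * Rn R n => f (tcons p))).
have g0 x : (0 <= g x)%E by apply: integral_ge0.
rewrite -[RHS](ge0_integral_affine b0 a00 mg g0) EFinM -muleA; congr (_ * _)%E.
rewrite -ge0_integralZl_EFin ?absp_ge0//; last 2 first.
- by move=> x _; apply: integral_ge0.
- by apply: (measurable_fun_fubini_tonelli_F
    (fun p : R1 * Rn R n => f (affRn (tcons (a0, a)) (tcons (b0, b)) (tcons p)))) => //;
  exact: (measurableT_comp mfa (@measurable_tcons R n)).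
apply: eq_integral => x _; rewrite /g -(IH a b (fun t => f (tcons (a0 * x + b0, t))))//; last first.
  exact: (measurableT_comp mft (pair1_measurable _)).
by congr (_ * _)%E; apply: eq_integral => t _; rewrite affRn_tcons.
Qed.

Lemma cint_affRn n (a b : Rn R n) (f : Rn R n -> R[i]) : absp a != 0 -> cmeas f ->
  cint (leb n) (fun t => (absp a)%:C * f (affRn a b t)) = cint (leb n) f.
Proof.
move=> a0 mf; apply: (@cint_change R _ _ (leb n) (affRn a b) (absp a)) => //.
- exact: absp_ge0.
- exact: measurable_affRn.
- by move=> u mu u0; exact: ge0_integral_affRn.
Qed.

End tuples.

(** * The Fourier transform on R^n *)

Section Fourier_Rn.
Context {R : realType} (s : R).
Local Notation R1 := (measurableTypeR R).
Local Notation leb1 := (@lebesgue_measure R).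
Local Notation leb := (lebesgue_Rn R).

(** The scale s is csc alpha for the fractional transform; the opposite scale
    gives the inverse transform up to a constant. *)
Definition FT n (H : Rn R n -> R[i]) (xi : Rn R n) : R[i] :=
  cint (leb n) (fun t => H t * expi (- (s * dotRn t xi))).

Lemma cmeas_phase n : cmeas (fun p : Rn R n * Rn R n => expi (- (s * dotRn p.1 p.2))).
Proof.
apply: cmeas_expi; apply: measurableT_comp => //.
by apply: measurable_funM; [exact: measurable_cst|exact: measurable_dotRn].
Qed.

Lemma cmeas_phase_l n (xi : Rn R n) : cmeas (fun t : Rn R n => expi (- (s * dotRn t xi))).
Proof. exact: (cmeas_comp (@cmeas_phase n) (pair2_measurable xi)). Qed.

Lemma cintg_phase n (H : Rn R n -> R[i]) xi : cintg (leb n) H ->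
  cintg (leb n) (fun t => H t * expi (- (s * dotRn t xi))).
Proof.
move=> Hi; apply: (@cintgMr_bounded _ _ _ _ _ _ 1) => //; first exact: cmeas_phase_l.
by move=> t; rewrite normc_expi.
Qed.

Lemma cmeas_FT n (H : Rn R n -> R[i]) : cmeas H -> cmeas (FT H).
Proof.
move=> mH; apply: (@cmeas_cint2 _ _ _ (Rn R n) (Rn R n) (leb n)
  (fun p => H p.1 * expi (- (s * dotRn p.1 p.2)))).
by apply: cmeasM; [exact: (cmeas_comp mH measurable_fst)|exact: cmeas_phase].
Qed.

Hypothesis s0 : s != 0.

Let M1 : R := 2 * pi / `|s|.
Let M1_ge0 : 0 <= M1. Proof. by rewrite divr_ge0// mulr_ge0// pi_ge0. Qed.

Let Plancherel_line_scaled (H : R1 -> R[i]) : cintg leb1 H ->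
  (\int[leb1]_y (normc (FT1 H (s * y)%R) ^+ 2)%:E = M1%:E * N2 leb1 H)%E.
Proof.
move=> Hi; have mh := cmeas_FT1 (cintg_cmeas Hi).
have h := ge0_integral_affine 0 s0 (f := fun y : R1 => (normc (FT1 H y) ^+ 2)%:E).
have := h _ _; rewrite -/(N2 leb1 (FT1 H)) Plancherel_line// => {}h.
have sgt0 : 0 < `|s| by rewrite normr_gt0.
rewrite /M1 mulrC EFinM -muleA -h.
- rewrite muleA -EFinM mulVf ?gt_eqF// mul1e.
  by apply: eq_integral => y _; rewrite addr0.
- exact: measurable_normc2_EFin.
- by move=> y; rewrite lee_fin sqr_ge0.
Qed.

(** Induction on the dimension: transform one variable at a time. The sections
    are integrable but need not be square-integrable, so that it matters that
    the identity on the line holds in [0, +oo]. *)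
Theorem Plancherel_Rn n (H : Rn R n -> R[i]) : cintg (leb n) H ->
  N2 (leb n) (FT H) = ((M1 ^+ n)%:E * N2 (leb n) H)%E.
Proof.
elim: n H => [H Hi|n IH H Hi].
  (* In dimension 0 the measure is the Dirac mass at the empty tuple. *)
  rewrite expr0 mul1e; apply: eq_integral => t _; congr ((normc _ ^+ 2)%:E : \bar R).
  have e (f : Rn R 0 -> R) : Rintegral (leb 0) setT f = f t.
    rewrite /Rintegral /= integral_dirac//.
    - by rewrite diracE mem_set// mul1e /=; congr f; apply: eq_coord => -[].
    - apply/measurable_EFinP; rewrite (_ : f = cst (f t)); first exact: measurable_cst.
      by apply/funext => u; congr f; apply: eq_coord => -[].
  rewrite /FT /cint !e /= !dotRn0 mulr0 oppr0 /expi cos0 sin0.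
  by case: (H t) => a b /=; rewrite !mulr1 !mulr0 subr0 add0r.
have mH := cintg_cmeas Hi; have HiP := cintg_tcons Hi.
have mHP : cmeas (fun p : R1 * Rn R n => H (tcons p)) by exact: cintg_cmeas HiP.
pose G (y : R1) (t : Rn R n) : R[i] := FT1 (fun x : R1 => H (tcons (x, t))) (s * y).
have phi (y : R1) : cintg (leb1 \x leb n)%E
    (fun p : R1 * Rn R n => H (tcons p) * expi (- (s * y * p.1))).
  apply: (@cintgMr_bounded _ _ _ _ _ _ 1) => //; last by move=> p; rewrite normc_expi.
  apply: cmeas_expi; apply: measurableT_comp => //.
  by apply: measurable_funM; [exact: measurable_cst|exact: measurable_fst].
have Gi y : cintg (leb n) (G y) by exact: (cintg_cint2 (phi y)).
have FTE (y : R1) (u : Rn R n) : FT H (tcons (y, u)) = FT (G y) u.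
  have i : cintg (leb1 \x leb n)%E
      (fun p : R1 * Rn R n => H (tcons p) * expi (- (s * dotRn (tcons p) (tcons (y, u))))).
    exact: (cintg_tcons (cintg_phase (tcons (y, u)) Hi)).
  rewrite /FT cint_tcons; last exact: cintg_cmeas (cintg_phase _ Hi).
  rewrite cint_prod21//; apply: cint_ae.
  - exact: (cmeas_cint2 leb1 (cintg_cmeas i)).
  - by apply: cmeasM; [exact: cintg_cmeas (Gi y)|exact: cmeas_phase_l].
  - apply: filterS (ae_cintg2 HiP) => t Ht.
    rewrite /G /FT1 mulrC -cintZ; last exact: cintg_phase1.
    apply: cint_ext => x; rewrite mulrCA -expiD dotRn_tcons; congr (_ * expi _); ring.
have mG : cmeas (fun p : R1 * Rn R n => G p.1 p.2).
  apply: (@cmeas_cint _ _ _ (R1 * Rn R n)%type R1 leb1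
    (fun q : (R1 * Rn R n) * R1 => H (tcons (q.2, q.1.2)) * expi (- (s * q.1.1 * q.2)))).
  have m11 : measurable_fun setT (fun q : (R1 * Rn R n) * R1 => q.1.1).
    exact: (measurableT_comp measurable_fst measurable_fst).
  have m12 : measurable_fun setT (fun q : (R1 * Rn R n) * R1 => q.1.2).
    exact: (measurableT_comp measurable_snd measurable_fst).
  apply: cmeasM.
    apply: (cmeas_comp mHP (u := fun q : (R1 * Rn R n) * R1 => (q.2, q.1.2))).
    by apply: measurable_fun_pair => //; exact: measurable_snd.
  apply: cmeas_expi; apply: measurableT_comp => //.
  apply: measurable_funM; last exact: measurable_snd.
  by apply: measurable_funM => //; exact: measurable_cst.
have mG2 : measurable_fun setT (fun p : R1 * Rn R n => (normc (G p.1 p.2) ^+ 2)%:E).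
  by apply/measurable_EFinP; exact: (measurable_normc2 mG).
have mH2 : measurable_fun setT (fun p : R1 * Rn R n => (normc (H (tcons p)) ^+ 2)%:E).
  by apply/measurable_EFinP; exact: (measurable_normc2 mHP).
have sq0 (z : R[i]) : (0 <= (normc z ^+ 2)%:E)%E by rewrite lee_fin sqr_ge0.
have Mn0 : 0 <= M1 ^+ n by rewrite exprn_ge0.
rewrite {1}/N2 ge0_integral_tcons//; last first.
  by apply: measurable_normc2_EFin; exact: cmeas_FT.
transitivity (\int[leb1]_y ((M1 ^+ n)%:E * \int[leb n]_t (normc (G y t) ^+ 2)%:E))%E.
  apply: eq_integral => y _; rewrite -(IH _ (Gi y)).
  by apply: eq_integral => u _; rewrite FTE.
rewrite ge0_integralZl_EFin//; last 2 first.
- by move=> y _; exact: integral_ge0.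
- by apply: (measurable_fun_fubini_tonelli_F (fun p : R1 * Rn R n => (normc (G p.1 p.2) ^+ 2)%:E)).
rewrite (fubini_tonelli (fun p : R1 * Rn R n => (normc (G p.1 p.2) ^+ 2)%:E))//=.
rewrite exprSr EFinM -muleA; congr (_ * _)%E.
transitivity (\int[leb n]_t (M1%:E * \int[leb1]_x (normc (H (tcons (x, t))) ^+ 2)%:E))%E.
  apply: ge0_ae_eq_integral => //.
  - exact: (measurable_integral2 _ mG2).
  - apply: measurable_funeM; exact: (measurable_integral2 _ mH2).
  - by move=> t _; exact: integral_ge0.
  - by move=> t _; rewrite mule_ge0 ?lee_fin//; exact: integral_ge0.
  - by apply: filterS (ae_cintg2 HiP) => t Ht _; exact: Plancherel_line_scaled.
rewrite ge0_integralZl_EFin//; last 2 first.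
- by move=> t _; exact: integral_ge0.
- exact: (measurable_integral2 _ mH2).
rewrite /N2 ge0_integral_tcons//; last first.
  exact: measurable_normc2_EFin.
by rewrite (fubini_tonelli (fun p : R1 * Rn R n => (normc (H (tcons p)) ^+ 2)%:E)).
Qed.

End Fourier_Rn.

(** * The Fourier transform of square-integrable functions *)

Section L2_tools.
Context {R : realType}.

Lemma cvge0_le (a e1 e2 : nat -> \bar R) (c1 c2 : R) :
  (forall k, 0 <= a k)%E -> (forall k, a k <= c1%:E * e1 k + c2%:E * e2 k)%E ->
  e1 k @[k --> \oo] --> 0%E -> e2 k @[k --> \oo] --> 0%E -> a k @[k --> \oo] --> 0%E.
Proof.
move=> a0 ale e10 e20.
apply: (@squeeze_cvge _ _ _ _ (fun=> 0%E) _ (fun k => c1%:E * e1 k + c2%:E * e2 k)%E).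
- by apply: nearW => k; rewrite a0 ale.
- exact: cvg_cst.
- rewrite (_ : 0%E = (c1%:E * 0 + c2%:E * 0)%E); last by rewrite !mule0 adde0.
  by apply: cvgeD; [rewrite !mule0|exact: cvgeZl|exact: cvgeZl].
Qed.

Context d (T : measurableType d) (mu : {measure set T -> \bar R}).
Implicit Types f g : T -> R[i].

Definition L12 f := cintg mu f /\ (N2 mu f < +oo)%E.

(** Cutting off the small values of a square-integrable function makes it
    integrable. *)
Lemma L12_dense f : cmeas f -> (N2 mu f < +oo)%E ->
  exists g : nat -> T -> R[i], (forall k, L12 (g k)) /\
    N2 mu (fun x => g k x - f x) @[k --> \oo] --> 0%E.
Proof.
move=> mf foo.
pose A k := [set x | k.+1%:R^-1 <= normc (f x)].
have mA k : measurable (A k).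
  rewrite (_ : A k = [set: T] `&` (fun x => normc (f x)) @^-1` `[k.+1%:R^-1, +oo[%classic).
    by apply: (measurable_normc mf) => //; exact: measurable_itv.
  by rewrite setTI; apply/seteqP; split => x /=; rewrite /A /= in_itv/= andbT.
pose g k x : R[i] := f x * (\1_(A k) x)%:C.
have mg k : cmeas (g k).
  by apply: cmeasM => //; apply: cmeas_real; exact: (measurable_indic (mA k)).
have gle k x : normc (g k x) <= normc (f x).
  rewrite /g normcM normc_real indicE; case: (_ \in _); rewrite ?normr1 ?mulr1//.
  by rewrite normr0 mulr0 normc_ge0.
exists g; split.
- move=> k; split; last first.
    by apply: le_lt_trans foo; apply: le_N2 => //; exact: nearW.
  apply: (@cintg_le _ _ _ _ _ (fun x => k.+1%:R * normc (f x) ^+ 2)) => //.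
  + by apply: measurable_funM => //; exact: measurable_normc2.
  + move=> x; rewrite /g normcM normc_real indicE.
    have [/set_mem Ax|_] := boolP (x \in A k); last first.
      by rewrite normr0 mulr0 mulr_ge0 ?sqr_ge0.
    rewrite normr1 mulr1 expr2 mulrA ler_peMl ?normc_ge0//.
    by rewrite -(@ler_pM2l _ k.+1%:R^-1) ?invr_gt0// mulr1 mulKf.
  + under eq_integral do rewrite EFinM.
    rewrite ge0_integralZl_EFin//; first exact: lte_mul_pinfty.
    * by move=> x _; rewrite lee_fin sqr_ge0.
    * exact: measurable_normc2_EFin.
- have h := @dominated_convergence _ _ _ mu setT measurableT
    (fun k x => (normc (g k x - f x) ^+ 2)%:E) (cst 0%E) (fun x => (normc (f x) ^+ 2)%:E).
  have gf k x : normc (g k x - f x) <= normc (f x).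
    rewrite /g indicE; case: (_ \in _); rewrite ?mulr1 ?mulr0 ?subrr ?normc0 ?normc_ge0//.
    by rewrite sub0r normcN.
  have h1 k : measurable_fun [set: T] (fun x => (normc (g k x - f x) ^+ 2)%:E).
    by apply: measurable_normc2_EFin; exact: cmeasB.
  have h2 : {ae mu, forall x, [set: T] x ->
      (normc (g k x - f x) ^+ 2)%:E @[k --> \oo] --> (cst 0%E : T -> \bar R) x}.
    apply: nearW => x _; apply: cvg_near_cst.
    have [fx0|fx0] := eqVneq (f x) 0.
      by apply: nearW => k; rewrite /g fx0 mul0r subrr normc0 expr0n.
    have fgt0 : 0 < normc (f x).
      by rewrite lt_def normc_ge0 andbT; apply: contra_neq fx0; exact: normc_eq0.
    have hh : \forall k \near \oo, (k.+1%:R^-1 : R) < normc (f x).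
      by have := cvgr_lt _ (@cvg_harmonic R) _ fgt0; apply.
    apply: filterS hh => k hk; rewrite /g indicE mem_set ?mulr1 ?subrr ?normc0 ?expr0n//.
    exact: ltW.
  have h3 : mu.-integrable setT (fun x => (normc (f x) ^+ 2)%:E).
    apply/integrableP; split; first exact: measurable_normc2_EFin.
    by under eq_integral do rewrite /= ger0_norm ?sqr_ge0//.
  have h4 : {ae mu, forall x k, [set: T] x ->
      (`|(normc (g k x - f x) ^+ 2)%:E| <= (normc (f x) ^+ 2)%:E)%E}.
    apply: nearW => x k _; rewrite /= lee_fin ger0_norm ?sqr_ge0//.
    by rewrite ler_pXn2r ?nnegrE ?normc_ge0.
  by have [_ _] := h h1 (measurable_cst _) h2 h3 h4; rewrite integral0.
Qed.

(** Polarization: inner products are combinations of values of N2, so that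
    Plancherel's identity implies Parseval's. *)
Lemma Re_cint_mul f g : cmeas f -> cmeas g -> (N2 mu f < +oo)%E -> (N2 mu g < +oo)%E ->
  Re (cint mu (fun x => f x * (g x)^*%C)) =
  (fine (N2 mu (fun x => f x + g x)%R) - fine (N2 mu f) - fine (N2 mu g)) / 2.
Proof.
move=> mf mg foo goo.
have moo := N2D_lty mf mg foo goo.
have mc (h : T -> R[i]) : cmeas h -> (N2 mu h < +oo)%E -> (N2 mu (fun x => (h x)^*%C) < +oo)%E.
  by move=> _; rewrite N2_conj.
have i (u v : T -> R[i]) : cmeas u -> cmeas v -> (N2 mu u < +oo)%E -> (N2 mu v < +oo)%E ->
    cintg mu (fun x => u x * (v x)^*%C).
  by move=> mu_ mv uoo voo; apply: cintg_mul => //; [exact: cmeas_conj|rewrite N2_conj].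
have := cint_sqr (cmeasD mf mg) moo.
rewrite (@cint_ext _ _ _ _ _ (fun x => (f x * (f x)^*%C + g x * (g x)^*%C) +
    (f x * (g x)^*%C + (f x * (g x)^*%C)^*%C))); last first.
  by move=> x; rewrite conjcM conjcK rmorphD /=; ring.
rewrite cintD; last 2 first.
  by apply: cintgD; exact: i.
  by apply: cintgD; [exact: i|apply: cintg_conj; exact: i].
rewrite cintD; [|exact: i|exact: i].
rewrite cintD; [|exact: i|by apply: cintg_conj; exact: i].
rewrite cint_conj; last exact: i.
rewrite !cint_sqr// => /(congr1 (@complex.Re R)).
rewrite !ReD Reconj /= => <-; by field.
Qed.

Lemma Im_cint_mul f g : cmeas f -> cmeas g -> (N2 mu f < +oo)%E -> (N2 mu g < +oo)%E ->
  Im (cint mu (fun x => f x * (g x)^*%C)) =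
  Re (cint mu (fun x => f x * ('i%C * g x)^*%C)).
Proof.
move=> mf mg foo goo.
rewrite (@cint_ext _ _ _ _ (fun x => f x * ('i%C * g x)^*%C)
    (fun x => (- 'i%C) * (f x * (g x)^*%C))); last first.
  move=> x; rewrite mulrCA; congr (_ * _); rewrite conjcM; congr (_ * _).
  by apply: ReIm_inj; rewrite /= ?oppr0.
rewrite cintZ; last by apply: cintg_mul => //; [exact: cmeas_conj|rewrite N2_conj].
by rewrite ReM /= oppr0 mul0r sub0r mulN1r opprK.
Qed.

End L2_tools.

#[global] Arguments FT : simpl never.

Section L2_Fourier.
Context {R : realType} (s : R) (s0 : s != 0) (n : nat).
Local Notation V := (Rn R n).
Local Notation mu := (lebesgue_Rn R n).
Implicit Types f g P Q : V -> R[i].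

Definition massRn : R := (2 * pi / `|s|) ^+ n.
Local Notation M := massRn.

Lemma massRn_gt0 : 0 < M.
Proof. by rewrite exprn_gt0// divr_gt0 ?normr_gt0// mulr_gt0// pi_gt0. Qed.

Let Re_realM (x : R) (z : R[i]) : Re (x%:C * z) = x * Re z.
Proof. by rewrite ReM /= mul0r subr0. Qed.

Let Im_realM (x : R) (z : R[i]) : Im (x%:C * z) = x * Im z.
Proof. by rewrite ImM /= mul0r addr0. Qed.

Let M0 : 0 <= M. Proof. exact: ltW massRn_gt0. Qed.

Lemma FTB f g : cintg mu f -> cintg mu g ->
  FT s (fun t => f t - g t) = (fun xi => FT s f xi - FT s g xi).
Proof.
move=> fi gi; apply/funext => xi; rewrite /FT -cintB; [|exact: cintg_phase..].
by apply: cint_ext => t; rewrite mulrBl.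
Qed.

Lemma FTD f g : cintg mu f -> cintg mu g ->
  FT s (fun t => f t + g t) = (fun xi => FT s f xi + FT s g xi).
Proof.
move=> fi gi; apply/funext => xi; rewrite /FT -cintD; [|exact: cintg_phase..].
by apply: cint_ext => t; rewrite mulrDl.
Qed.

Lemma FTZ c f : cintg mu f -> FT s (fun t => c * f t) = (fun xi => c * FT s f xi).
Proof.
move=> fi; apply/funext => xi; rewrite /FT -cintZ; last exact: cintg_phase.
by apply: cint_ext => t; rewrite mulrA.
Qed.

Lemma N2_FT f : cintg mu f -> N2 mu (FT s f) = (M%:E * N2 mu f)%E.
Proof. exact: Plancherel_Rn. Qed.

Lemma N2_FT_lty f : L12 mu f -> (N2 mu (FT s f) < +oo)%E.
Proof. by move=> [fi foo]; rewrite N2_FT//; apply: lte_mul_pinfty. Qed.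

Lemma Parseval_L12 f g : L12 mu f -> L12 mu g ->
  cint mu (fun xi => FT s f xi * (FT s g xi)^*%C) = M%:C * cint mu (fun t => f t * (g t)^*%C).
Proof.
move=> fL gL.
have re h : L12 mu h -> Re (cint mu (fun xi => FT s f xi * (FT s h xi)^*%C)) =
    M * Re (cint mu (fun t => f t * (h t)^*%C)).
  move=> hL; have [[fi foo] [hi hoo]] := (fL, hL).
  have [mf mh] := (cintg_cmeas fi, cintg_cmeas hi).
  rewrite !Re_cint_mul//; try (exact: cmeas_FT) || (exact: N2_FT_lty).
  rewrite -FTD// !N2_FT//; last exact: cintgD.
  have fin u : cmeas u -> (N2 mu u < +oo)%E -> fine (M%:E * N2 mu u)%E = M * fine (N2 mu u).
    by move=> _ uoo; rewrite fineM// N2_fin.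
  rewrite !fin//; [by ring|exact: cmeasD|exact: N2D_lty].
have [[fi foo] [gi goo]] := (fL, gL).
have [mf mg] := (cintg_cmeas fi, cintg_cmeas gi).
apply: ReIm_inj; rewrite ?Re_realM ?Im_realM; first exact: re.
rewrite !Im_cint_mul//; try (exact: cmeas_FT) || (exact: N2_FT_lty).
have igL : L12 mu (fun t => 'i%C * g t) by split; [exact: cintgZ|exact: N2Z_lty].
by rewrite -(re _ igL); congr Re; apply: cint_ext => xi; rewrite FTZ.
Qed.

(** A relation rather than a function, since the transform P of f is determined
    only up to null sets. One approximating sequence is asked for; by L2FT_seq
    every other one behaves in the same way. *)
Record L2FT f P : Prop := MkL2FT {
  L2FT_cmeas : cmeas f;
  L2FT_lty : (N2 mu f < +oo)%E;
  L2FT_cmeas_r : cmeas P;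
  L2FT_lty_r : (N2 mu P < +oo)%E;
  L2FT_approx : exists g : nat -> V -> R[i], [/\ forall k, L12 mu (g k),
    N2 mu (fun t => g k t - f t) @[k --> \oo] --> 0%E &
    N2 mu (fun xi => FT s (g k) xi - P xi) @[k --> \oo] --> 0%E] }.

Lemma L2FT_seq f P (h : nat -> V -> R[i]) : L2FT f P -> (forall k, L12 mu (h k)) ->
  N2 mu (fun t => h k t - f t) @[k --> \oo] --> 0%E ->
  N2 mu (fun xi => FT s (h k) xi - P xi) @[k --> \oo] --> 0%E.
Proof.
move=> [mf foo mP Poo [g [gL gf gP]]] hL hf.
have mg k : cmeas (g k) by exact: cintg_cmeas (gL k).1.
have mh k : cmeas (h k) by exact: cintg_cmeas (hL k).1.
have hg : N2 mu (fun t => h k t - g k t) @[k --> \oo] --> 0%E.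
  apply: (@cvge0_le _ _ _ _ 2 2 _ _ hf gf) => k; first exact: N2_ge0.
  rewrite (@N2_ext _ _ _ _ _ (fun t => (h k t - f t) - (g k t - f t))); last by move=> t; ring.
  by apply: N2B; exact: cmeasB.
apply: (@cvge0_le _ _ _ _ (2 * M) 2 _ _ hg gP) => k; first exact: N2_ge0.
rewrite (@N2_ext _ _ _ _ _ (fun xi => FT s (fun t => h k t - g k t) xi + (FT s (g k) xi - P xi))); last first.
  by move=> xi; rewrite FTB; [ring|exact: (hL k).1|exact: (gL k).1].
have m1 : cmeas (FT s (fun t => h k t - g k t)) by apply: cmeas_FT; exact: cmeasB.
have m2 : cmeas (fun xi => FT s (g k) xi - P xi) by apply: cmeasB => //; exact: cmeas_FT.
apply: le_trans (N2D mu m1 m2) _.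
by rewrite N2_FT ?muleA ?EFinM//; apply: cintgB; [exact: (hL k).1|exact: (gL k).1].
Qed.

(** Approximations of f with a geometric rate have transforms with a geometric
    rate, by Plancherel's identity, and these converge by completeness. *)
Lemma L2FT_exists f : cmeas f -> (N2 mu f < +oo)%E -> exists P, L2FT f P.
Proof.
move=> mf foo; have [g [gL gf]] := L12_dense mf foo.
have gi k : cintg mu (g k) by have [] := gL k.
have mg k : cmeas (g k) by exact: cintg_cmeas.
have goo k : (N2 mu (g k) < +oo)%E by have [] := gL k.
have fast k : {m | (N2 mu (fun t => g m t - f t)%R <= (8^-1 ^+ k)%:E)%E}.
  apply/cid.
  have e0 : 0 < 8^-1 ^+ k :> R by rewrite exprn_gt0// invr_gt0.
  have : \forall m \near \oo, fine (N2 mu (fun t => g m t - f t)%R) < 8^-1 ^+ k.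
    by have := cvgr_lt _ (fine_cvg gf) _ e0; apply.
  move=> [m _ hm]; exists m; rewrite -(@fineK _ (N2 mu (fun t => g m t - f t)%R)).
    by rewrite lee_fin ltW//; exact: hm (leqnn m).
  by apply: N2_fin; exact: N2B_lty.
pose G k := g (sval (fast k)).
have Gf k : (N2 mu (fun t => G k t - f t)%R <= (8^-1 ^+ k)%:E)%E by exact: (svalP (fast k)).
have GL k : L12 mu (G k) by exact: gL.
have mFG k : cmeas (FT s (G k)) by apply: cmeas_FT; exact: mg.
have Gf0 : N2 mu (fun t => G k t - f t) @[k --> \oo] --> 0%E.
  apply: (@squeeze_cvge _ _ _ _ (fun=> 0%E) _ (fun k => (8^-1 ^+ k)%:E)).
  - by apply: nearW => k; rewrite N2_ge0 Gf.
  - exact: cvg_cst.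
  - apply: cvg_EFin; first exact: nearW.
    by apply: cvg_expr; rewrite ger0_norm ?invr_ge0// invf_lt1// ltr1n.
have step k : (N2 mu (fun xi => FT s (G k.+1) xi - FT s (G k) xi)%R <= (4 * M * 8^-1 ^+ k)%:E)%E.
  rewrite -FTB; [|exact: (GL k.+1).1|exact: (GL k).1].
  rewrite N2_FT; last by apply: cintgB; [exact: (GL k.+1).1|exact: (GL k).1].
  rewrite (_ : 4 * M * 8^-1 ^+ k = M * (4 * 8^-1 ^+ k)); last by ring.
  rewrite EFinM lee_wpmul2l ?lee_fin//.
  rewrite (@N2_ext _ _ _ _ _ (fun t => (G k.+1 t - f t) - (G k t - f t))); last by move=> t; ring.
  have m1 j : cmeas (fun t => G j t - f t) by apply: cmeasB => //; exact: mg.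
  apply: le_trans (N2B mu (m1 k.+1) (m1 k)) _.
  apply: (@le_trans _ _ (2%:E * (8^-1 ^+ k)%:E + 2%:E * (8^-1 ^+ k)%:E)%E).
    apply: leeD; apply: lee_wpmul2l; rewrite ?lee_fin//.
    apply: le_trans (Gf _) _; rewrite lee_fin exprS ler_piMl ?exprn_ge0 ?invr_ge0//.
    by rewrite invf_le1// ler1n.
  by rewrite -!EFinM -EFinD lee_fin; lra.
have [P [mP GP]] := L2_complete mFG step.
exists P; split => //; last by exists G.
have : \forall k \near \oo, fine (N2 mu (fun xi => FT s (G k) xi - P xi)%R) < 1 /\
    N2 mu (fun xi => FT s (G k) xi - P xi)%R \is a fin_num.
  have h1 : \forall k \near \oo, fine (N2 mu (fun xi => FT s (G k) xi - P xi)%R) < 1.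
    by have := cvgr_lt _ (fine_cvg GP) _ ltr01; apply.
  have h2 := cvg_is_fine GP.
  by apply: filterS2 h1 h2.
move=> [k _ /(_ k (leqnn k))[_ fin]].
rewrite (@N2_ext _ _ _ _ _ (fun xi => FT s (G k) xi - (FT s (G k) xi - P xi))); last by move=> xi; ring.
apply: N2B_lty.
- exact: mFG.
- by apply: cmeasB => //; exact: mFG.
- exact: N2_FT_lty.
- by rewrite ltey_eq fin.
Qed.

Lemma Parseval f P g Q : L2FT f P -> L2FT g Q ->
  cint mu (fun xi => P xi * (Q xi)^*%C) = M%:C * cint mu (fun t => f t * (g t)^*%C).
Proof.
move=> [mf foo mP Poo [u [uL uf uP]]] [mg goo mQ Qoo [v [vL vg vQ]]].
have mu_ k : cmeas (u k) by exact: cintg_cmeas (uL k).1.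
have mv k : cmeas (v k) by exact: cintg_cmeas (vL k).1.
have mFu k : cmeas (FT s (u k)) by exact: cmeas_FT.
have mFv k : cmeas (FT s (v k)) by exact: cmeas_FT.
have conj_lty h : (N2 mu h < +oo)%E -> (N2 mu (fun x => (h x)^*%C) < +oo)%E by rewrite N2_conj.
have lim1 := cint_mul_cvg mFu (fun k => cmeas_conj (mFv k)) mP (cmeas_conj mQ)
  (fun k => N2_FT_lty (uL k)) (fun k => conj_lty _ (N2_FT_lty (vL k))) Poo (conj_lty _ Qoo)
  uP (N2_conj_cvg vQ).
have lim2 := cint_mul_cvg mu_ (fun k => cmeas_conj (mv k)) mf (cmeas_conj mg)
  (fun k => (uL k).2) (fun k => conj_lty _ (vL k).2) foo (conj_lty _ goo)
  uf (N2_conj_cvg vg).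
apply: (cvg_normc_unique lim1).
have -> : (fun k => normc (cint mu (fun xi => FT s (u k) xi * (FT s (v k) xi)^*%C) -
    M%:C * cint mu (fun t => f t * (g t)^*%C))) =
  (fun k => M * normc (cint mu (fun t => u k t * (v k t)^*%C) - cint mu (fun t => f t * (g t)^*%C))).
  by apply/funext => k; rewrite Parseval_L12// -mulrBr normcM normc_real ger0_norm.
by rewrite -[X in _ --> X](mulr0 M); apply: cvgMr.
Qed.

Lemma N2_L2FT f P : L2FT f P -> N2 mu P = (M%:E * N2 mu f)%E.
Proof.
move=> h; have := Parseval h h; have [mf foo mP Poo _] := h.
rewrite !cint_sqr// -realCM => /(congr1 (@complex.Re R)) /= e.
by rewrite -(fineK (N2_fin Poo)) -(fineK (N2_fin foo)) -EFinM e.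
Qed.

Definition scaleRn (a xi : V) : V := affRn a [tuple 0 | i < n] xi.
Definition atomRn (a b t : V) : V := divRn (subRn t b) a.

Lemma coord_atomRn a b t i : coord (atomRn a b t) i = (coord t i - coord b i) / coord a i.
Proof. by rewrite /atomRn /divRn /subRn /coord !tnth_mktuple. Qed.

Lemma coord_scaleRn a xi i : coord (scaleRn a xi) i = coord a i * coord xi i.
Proof. by rewrite coord_affRn /coord tnth_mktuple addr0. Qed.

Lemma absp_coord (a : V) i : absp a != 0 -> coord a i != 0.
Proof. by rewrite /absp normr_eq0 => /prodf_neq0; apply. Qed.

Lemma atomRnK a b t : absp a != 0 -> atomRn a b (affRn a b t) = t.
Proof.
move=> a0; apply: eq_coord => i; rewrite coord_atomRn coord_affRn addrK.
by rewrite mulrC mulKf// absp_coord.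
Qed.

Lemma dotRn_affRn a b t xi : dotRn (affRn a b t) xi = dotRn t (scaleRn a xi) + dotRn b xi.
Proof.
rewrite /dotRn -big_split /=; apply: eq_bigr => i _.
by rewrite coord_affRn coord_scaleRn; ring.
Qed.

Lemma measurable_atomRn_joint :
  measurable_fun setT (fun p : (V * V) * V => atomRn p.1.1 p.1.2 p.2).
Proof.
apply: measurable_to_Rn => i; under eq_fun do rewrite coord_atomRn.
have m11 : measurable_fun setT (fun q : (V * V) * V => q.1.1).
  exact: (measurableT_comp measurable_fst measurable_fst).
have m12 : measurable_fun setT (fun q : (V * V) * V => q.1.2).
  exact: (measurableT_comp measurable_snd measurable_fst).
apply: measurable_funM.
  apply: measurable_funB; first exact: (measurableT_comp (measurable_coord i) measurable_snd).
  exact: (measurableT_comp (measurable_coord i) m12).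
apply: (measurableT_comp measurable_inv).
exact: (measurableT_comp (measurable_coord i) m11).
Qed.

Lemma measurable_atomRn a b : measurable_fun [set: V] (atomRn a b).
Proof. exact: (measurableT_comp measurable_atomRn_joint (pair1_measurable (a, b))). Qed.

Lemma measurable_scaleRn_joint : measurable_fun setT (fun p : V * V => scaleRn p.1 p.2).
Proof.
apply: measurable_to_Rn => i; under eq_fun do rewrite coord_scaleRn.
apply: measurable_funM.
- exact: (measurableT_comp (measurable_coord i) measurable_fst).
- exact: (measurableT_comp (measurable_coord i) measurable_snd).
Qed.

Lemma measurable_scaleRn a : measurable_fun [set: V] (scaleRn a).
Proof. exact: measurable_affRn. Qed.

Variables (a b : V).
Hypothesis a0 : absp a != 0.

Lemma ge0_integral_atomRn (f : V -> \bar R) : measurable_fun setT f -> (forall t, 0 <= f t)%E ->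
  (\int[mu]_t f (atomRn a b t) = (absp a)%:E * \int[mu]_t f t)%E.
Proof.
move=> mf f0; rewrite -(ge0_integral_affRn b a0 (f := fun t => f (atomRn a b t)))//.
  by congr (_ * _)%E; apply: eq_integral => t _; rewrite atomRnK.
exact: (measurableT_comp mf (measurable_atomRn a b)).
Qed.

Lemma N2_atomRn f : cmeas f ->
  N2 mu (fun t => f (atomRn a b t)) = ((absp a)%:E * N2 mu f)%E.
Proof.
move=> mf; apply: (ge0_integral_atomRn (f := fun t => (normc (f t) ^+ 2)%:E)).
- exact: measurable_normc2_EFin.
- by move=> t; rewrite lee_fin sqr_ge0.
Qed.

Lemma cmeas_atomRn f : cmeas f -> cmeas (fun t => f (atomRn a b t)).
Proof. by move=> mf; exact: (cmeas_comp mf (measurable_atomRn a b)). Qed.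

Lemma L12_atomRn f : L12 mu f -> L12 mu (fun t => f (atomRn a b t)).
Proof.
move=> [fi foo]; have [mf noo] := (cintgP _ _).1 fi; split; last first.
  by rewrite N2_atomRn//; apply: lte_mul_pinfty => //; rewrite lee_fin absp_ge0.
apply/cintgP; split; first exact: cmeas_atomRn.
rewrite (ge0_integral_atomRn (f := fun t => (normc (f t))%:E)).
- by apply: lte_mul_pinfty => //; rewrite lee_fin absp_ge0.
- exact: measurable_normc_EFin.
- by move=> t; rewrite lee_fin normc_ge0.
Qed.

Let symbol xi : R[i] := (absp a)%:C * expi (- (s * dotRn b xi)).

Lemma FT_atomRn f : cintg mu f ->
  FT s (fun t => f (atomRn a b t)) = (fun xi => symbol xi * FT s f (scaleRn a xi)).
Proof.
move=> fi; apply/funext => xi; have mf := cintg_cmeas fi.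
have mF : cmeas (fun t => f (atomRn a b t) * expi (- (s * dotRn t xi))).
  by apply: cmeasM; [exact: cmeas_atomRn|exact: cmeas_phase_l].
rewrite /FT -(cint_affRn b a0 mF) -cintZ; last exact: cintg_phase.
apply: cint_ext => t; rewrite atomRnK// dotRn_affRn /symbol.
rewrite [RHS](_ : _ = (absp a)%:C * (f t * (expi (- (s * dotRn b xi)) *
  expi (- (s * dotRn t (scaleRn a xi)))))); last by ring.
by rewrite -expiD; congr (_ * (_ * expi _)); ring.
Qed.

Let cmeas_symbol : cmeas symbol.
Proof.
apply: cmeasM; first exact: cmeas_cst.
exact: (cmeas_comp (cmeas_phase s n) (pair1_measurable b)).
Qed.

Let N2_symbol P : cmeas P ->
  N2 mu (fun xi => symbol xi * P (scaleRn a xi)) = ((absp a)%:E * N2 mu P)%E.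
Proof.
move=> mP; have := ge0_integral_affRn [tuple 0 | i < n] a0 (f := fun t => (normc (P t) ^+ 2)%:E).
rewrite -/(N2 mu P) => <-; last 2 first.
- exact: measurable_normc2_EFin.
- by move=> t; rewrite lee_fin sqr_ge0.
rewrite muleA -EFinM -expr2 -ge0_integralZl_EFin ?sqr_ge0//; last 2 first.
- by move=> t _; rewrite lee_fin sqr_ge0.
- apply/measurable_EFinP; apply: measurable_normc2.
  exact: (cmeas_comp mP (measurable_scaleRn a)).
apply: eq_integral => xi _; rewrite -EFinM /symbol !normcM normc_expi mulr1 normc_real.
by rewrite ger0_norm ?absp_ge0// exprMn.
Qed.

(** Translations and dilations become modulations and dilations, first for
    integrable functions and then in the limit, both sides being continuous. *)
Lemma L2FT_atomRn f P : L2FT f P ->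
  L2FT (fun t => f (atomRn a b t)) (fun xi => symbol xi * P (scaleRn a xi)).
Proof.
move=> [mf foo mP Poo [g [gL gf gP]]].
have mg k : cmeas (g k) by exact: cintg_cmeas (gL k).1.
have c0 : (0%:E <= (absp a)%:E)%E by rewrite lee_fin absp_ge0.
split.
- exact: cmeas_atomRn.
- by rewrite N2_atomRn//; apply: lte_mul_pinfty.
- by apply: cmeasM => //; exact: (cmeas_comp mP (measurable_scaleRn a)).
- by rewrite N2_symbol//; apply: lte_mul_pinfty.
exists (fun k t => g k (atomRn a b t)); split.
- by move=> k; exact: L12_atomRn.
- have -> : (fun k => N2 mu (fun t => g k (atomRn a b t) - f (atomRn a b t))) =
            (fun k => (absp a)%:E * N2 mu (fun t => (g k t - f t)%R))%E.
    by apply/funext => k; rewrite -N2_atomRn//; exact: cmeasB.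
  by rewrite -[X in _ --> X](mule0 (absp a)%:E); apply: cvgeZl.
- have -> : (fun k => N2 mu (fun xi => FT s (fun t => g k (atomRn a b t)) xi -
                                 symbol xi * P (scaleRn a xi))) =
            (fun k => (absp a)%:E * N2 mu (fun xi => (FT s (g k) xi - P xi)%R))%E.
    apply/funext => k; rewrite -N2_symbol; last by apply: cmeasB => //; exact: cmeas_FT.
    by apply: N2_ext => xi; rewrite FT_atomRn ?mulrBr//; exact: (gL k).1.
  by rewrite -[X in _ --> X](mule0 (absp a)%:E); apply: cvgeZl.
Qed.

End L2_Fourier.

(** * Correlations with translates and dilates *)

Lemma lty_pmull {R : realType} (r : R) (x : \bar R) : 0 < r -> (0 <= x)%E ->
  (r%:E * x < +oo)%E -> (x < +oo)%E.
Proof. by move=> r0; case: x => [x _ _||//]; [exact: ltry|rewrite gt0_muley ?lte_fin]. Qed.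

Lemma cintg_ae {R : realType} d (T : measurableType d) (mu : {measure set T -> \bar R})
    (f g : T -> R[i]) :
  cmeas f -> cintg mu g -> {ae mu, forall x, f x = g x} -> cintg mu f.
Proof.
move=> mf /cintgP[mg goo] fg; apply/cintgP; split => //; move: goo.
rewrite (@ge0_ae_eq_integral _ _ _ mu setT (fun x => (normc (g x))%:E) (fun x => (normc (f x))%:E))//.
- exact: measurable_normc_EFin.
- exact: measurable_normc_EFin.
- by move=> x _; rewrite lee_fin normc_ge0.
- by move=> x _; rewrite lee_fin normc_ge0.
- by apply: filterS fg => x -> _.
Qed.

Lemma ae_N2_section {R : realType} d1 d2 (T1 : measurableType d1) (T2 : measurableType d2)
    (m1 : {sigma_finite_measure set T1 -> \bar R}) (m2 : {sigma_finite_measure set T2 -> \bar R})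
    (f : T1 * T2 -> R[i]) : cmeas f -> (N2 (m1 \x m2)%E f < +oo)%E ->
  {ae m2, forall y, (N2 m1 (fun x => f (x, y)) < +oo)%E}.
Proof.
move=> mf foo.
have /ae_cintg2 : cintg (m1 \x m2)%E (fun p => f p * (f p)^*%C).
  by apply: cintg_mul => //; [exact: cmeas_conj|rewrite N2_conj].
apply: filterS => y /cintgP[_].
by under eq_integral do rewrite normcM normc_conj -expr2.
Qed.

Section correlation.
Context {R : realType} (s : R) (s0 : s != 0) (n : nat).
Local Notation V := (Rn R n).
Local Notation mu := (lebesgue_Rn R n).
Local Notation M := (massRn s n).
Implicit Types (f g phi psi P Q : V -> R[i]) (a b xi : V).

Definition corr f phi a b : R[i] := cint mu (fun t => f t * (phi (atomRn a b t))^*%C).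

(** At a fixed dilation a, the correlation of f and phi as a function of the
    translation is a multiple of the inverse transform of the slice of their
    transforms. *)
Definition slice P Q a xi : R[i] := P xi * (Q (scaleRn a xi))^*%C.

(** The factor 1/|a| of the time-scale measure is split between the two factors
    of a product of slices, each of which becomes square-integrable in
    (xi, a). *)
Definition slice_joint P Q (p : V * V) : R[i] := ((Num.sqrt (absp p.2))^-1)%:C * slice P Q p.2 p.1.

(** The Calderon integral of a function with transform Q, and its polarization. *)
Definition admissibility Q : \bar R := (\int[mu]_u (normc (Q u) ^+ 2 / absp u)%:E)%E.

Definition admissibility2 Q1 Q2 : R[i] := cint mu (fun u => (Q1 u)^*%C * Q2 u * ((absp u)^-1)%:C).

Lemma massRnN : massRn (- s) n = M.
Proof. by rewrite /massRn normrN. Qed.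

Lemma scaleRnC a xi : scaleRn a xi = scaleRn xi a.
Proof. by apply: eq_coord => i; rewrite !coord_scaleRn mulrC. Qed.

Lemma dotRnC (x y : V) : dotRn x y = dotRn y x.
Proof. by apply: eq_bigr => i _; rewrite mulrC. Qed.

Lemma absp_scaleRn a xi : absp (scaleRn a xi) = absp a * absp xi.
Proof.
rewrite /absp -normrM -big_split; congr `|_|; apply: eq_bigr => i _.
by rewrite coord_scaleRn.
Qed.

Lemma cmeas_corr f phi : cmeas f -> cmeas phi -> cmeas (fun p : V * V => corr f phi p.1 p.2).
Proof.
move=> mf mphi.
apply: (cmeas_cint mu (f := fun q : (V * V) * V => f q.2 * (phi (atomRn q.1.1 q.1.2 q.2))^*%C)).
apply: cmeasM; first exact: (cmeas_comp mf measurable_snd).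
apply: cmeas_conj; apply: (cmeas_comp (u := fun q : (V * V) * V => atomRn q.1.1 q.1.2 q.2) mphi).
exact: measurable_atomRn_joint.
Qed.

Lemma measurable_sqrt : measurable_fun [set: R] (@Num.sqrt R).
Proof. by apply: continuous_measurable_fun; exact: sqrt_continuous. Qed.

Lemma measurable_invabsp : measurable_fun [set: V] (fun a : V => (absp a)^-1).
Proof. by apply: (measurableT_comp measurable_inv); exact: measurable_absp. Qed.

Lemma cmeas_slice_joint P Q : cmeas P -> cmeas Q -> cmeas (slice_joint P Q).
Proof.
move=> mP mQ; apply: cmeasM.
  apply: cmeas_real; apply: (measurableT_comp measurable_inv).
  apply: (measurableT_comp measurable_sqrt).
  by apply: (measurableT_comp (f := @absp R n)) => //; exact: measurable_absp.
apply: cmeasM; first exact: (cmeas_comp mP measurable_fst).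
apply: cmeas_conj; apply: (cmeas_comp mQ).
under eq_fun do rewrite scaleRnC.
exact: measurable_scaleRn_joint.
Qed.

Lemma cmeas_slice P Q a : cmeas P -> cmeas Q -> cmeas (slice P Q a).
Proof.
move=> mP mQ; apply: cmeasM => //; apply: cmeas_conj.
exact: (cmeas_comp mQ (measurable_scaleRn a)).
Qed.

Lemma normc2_slice_joint P Q xi a :
  normc (slice_joint P Q (xi, a)) ^+ 2 = (absp a)^-1 * normc (slice P Q a xi) ^+ 2.
Proof.
rewrite normcM exprMn normc_real ger0_norm ?invr_ge0 ?sqrtr_ge0//.
by rewrite exprVn sqr_sqrtr ?absp_ge0.
Qed.

(** Multiplicative Haar measure du / |u| is invariant under coordinatewise
    dilations, which makes the admissibility integral scale-free. *)
Lemma admissibility_scale Q xi : cmeas Q -> absp xi != 0 ->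
  (\int[mu]_a (normc (Q (scaleRn a xi)) ^+ 2 / absp a)%:E)%E = admissibility Q.
Proof.
move=> mQ xi0.
have mf : measurable_fun [set: V] (fun u => normc (Q u) ^+ 2 / absp u).
  apply: measurable_funM; first exact: measurable_normc2.
  exact: measurable_invabsp.
have f0 u : 0 <= normc (Q u) ^+ 2 / absp u by rewrite divr_ge0 ?sqr_ge0 ?absp_ge0.
have := ge0_integral_affRn [tuple 0 | i < n] xi0 (f := fun u => (normc (Q u) ^+ 2 / absp u)%:E).
rewrite -/(admissibility Q) => <-; last 2 first.
- exact/measurable_EFinP.
- by move=> u; rewrite lee_fin.
rewrite -ge0_integralZl_EFin ?absp_ge0//; last 2 first.
- by move=> a _; rewrite lee_fin.
- apply/measurable_EFinP; exact: (measurableT_comp mf (measurable_scaleRn xi)).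
apply: eq_integral => a _; rewrite -EFinM -/(scaleRn xi a) absp_scaleRn scaleRnC invfM.
by congr EFin; rewrite mulrCA mulVKf.
Qed.

Lemma admissibility2_scale Q1 Q2 xi : cmeas Q1 -> cmeas Q2 -> absp xi != 0 ->
  cint mu (fun a => (Q1 (scaleRn a xi))^*%C * Q2 (scaleRn a xi) * ((absp a)^-1)%:C) =
  admissibility2 Q1 Q2.
Proof.
move=> m1 m2 xi0; have := cint_affRn [tuple 0 | i < n] (f := fun u => (Q1 u)^*%C * Q2 u * ((absp u)^-1)%:C) xi0.
rewrite -/(admissibility2 Q1 Q2) => <-; last first.
  apply: cmeasM; first by apply: cmeasM => //; exact: cmeas_conj.
  by apply: cmeas_real; exact: measurable_invabsp.
apply: cint_ext => a; rewrite -/(scaleRn xi a) absp_scaleRn scaleRnC invfM.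
rewrite [RHS]mulrCA -realCM; congr (_ * _%:C).
by rewrite mulVKf.
Qed.

Lemma cintg_admissibility2 Q1 Q2 : cmeas Q1 -> cmeas Q2 ->
  (admissibility Q1 < +oo)%E -> (admissibility Q2 < +oo)%E ->
  cintg mu (fun u => (Q1 u)^*%C * Q2 u * ((absp u)^-1)%:C).
Proof.
move=> m1 m2 Q1oo Q2oo.
have mn Q : cmeas Q -> measurable_fun [set: V] (fun u => normc (Q u) ^+ 2 / absp u).
  by move=> mQ; apply: measurable_funM; [exact: measurable_normc2|exact: measurable_invabsp].
apply: (@cintg_le _ _ _ _ _ (fun u => normc (Q1 u) ^+ 2 / absp u + normc (Q2 u) ^+ 2 / absp u)).
- apply: cmeasM; last by apply: cmeas_real; exact: measurable_invabsp.
  by apply: cmeasM => //; exact: cmeas_conj.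
- by apply: measurable_funD; exact: mn.
- move=> u; rewrite !normcM normc_conj normc_real ger0_norm ?invr_ge0 ?absp_ge0//.
  rewrite -mulrDl ler_wpM2r ?invr_ge0 ?absp_ge0//; nra.
- under eq_integral do rewrite EFinD.
  rewrite ge0_integralD//.
  + exact: lte_add_pinfty.
  + by move=> u _; rewrite lee_fin divr_ge0 ?sqr_ge0 ?absp_ge0.
  + by apply/measurable_EFinP; exact: mn.
  + by move=> u _; rewrite lee_fin divr_ge0 ?sqr_ge0 ?absp_ge0.
  + by apply/measurable_EFinP; exact: mn.
Qed.

Lemma N2_slice_joint P Q : cmeas P -> cmeas Q ->
  N2 (mu \x mu)%E (slice_joint P Q) = (N2 mu P * admissibility Q)%E.
Proof.
move=> mP mQ; have mS := cmeas_slice_joint mP mQ.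
have mS2 : measurable_fun setT (fun p => (normc (slice_joint P Q p) ^+ 2)%:E).
  exact: measurable_normc2_EFin.
have A0 : (0 <= admissibility Q)%E.
  by apply: integral_ge0 => u _; rewrite lee_fin divr_ge0 ?sqr_ge0 ?absp_ge0.
rewrite /N2 fubini_tonelli1//; last by move=> p; rewrite lee_fin sqr_ge0.
rewrite -ge0_integralZr//; last 2 first.
- exact: measurable_normc2_EFin.
- by move=> x _; rewrite lee_fin sqr_ge0.
have mQa xi : measurable_fun [set: V] (fun a => (normc (Q (scaleRn a xi)) ^+ 2 / absp a)%:E).
  apply/measurable_EFinP; apply: measurable_funM.
    under eq_fun do rewrite scaleRnC.
    by apply: measurable_normc2; exact: (cmeas_comp mQ (measurable_scaleRn xi)).
  exact: measurable_invabsp.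
apply: ge0_ae_eq_integral => //.
- by apply: measurable_fun_fubini_tonelli_F => // p; rewrite lee_fin sqr_ge0.
- apply: emeasurable_funM; last exact: measurable_cst.
  exact: measurable_normc2_EFin.
- by move=> x _; apply: integral_ge0 => a _; rewrite lee_fin sqr_ge0.
- by move=> x _; rewrite mule_ge0// lee_fin sqr_ge0.
apply: filterS (ae_absp_neq0 n) => xi xi0 _.
rewrite -(admissibility_scale mQ xi0) -ge0_integralZl_EFin ?sqr_ge0//.
- apply: eq_integral => a _; rewrite normc2_slice_joint normcM normc_conj exprMn -EFinM.
  by congr EFin; ring.
- by move=> a _; rewrite lee_fin divr_ge0 ?sqr_ge0 ?absp_ge0.
Qed.

Section one_correlation.
Variables (f phi P Q : V -> R[i]).
Hypotheses (fP : L2FT s f P) (phiQ : L2FT s phi Q).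

Let mf := L2FT_cmeas fP.
Let mphi := L2FT_cmeas phiQ.
Let mP := L2FT_cmeas_r fP.
Let mQ := L2FT_cmeas_r phiQ.

Lemma cintg_slice a : absp a != 0 -> cintg mu (slice P Q a).
Proof.
move=> a0; have mQa := cmeas_comp mQ (measurable_scaleRn a).
apply: cintg_mul => //; first exact: cmeas_conj.
- exact: L2FT_lty_r fP.
- rewrite N2_conj; have := L2FT_lty_r phiQ.
  have := ge0_integral_affRn [tuple 0 | i < n] a0 (f := fun t => (normc (Q t) ^+ 2)%:E).
  rewrite -/(N2 mu Q) => <-; last 2 first.
  + exact: measurable_normc2_EFin.
  + by move=> t; rewrite lee_fin sqr_ge0.
  rewrite -/(N2 mu (fun t => Q (scaleRn a t))).
  have agt0 : 0 < absp a by rewrite lt_def a0 absp_ge0.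
  by apply: lty_pmull => //; exact: N2_ge0.
Qed.

(** Parseval's identity: the transform of the translate and dilate of phi is a
    phase in b times a dilate of Q. *)
Lemma corr_FT a b : absp a != 0 ->
  corr f phi a b = (absp a / M)%:C * FT (- s) (slice P Q a) b.
Proof.
move=> a0; have M0 := massRn_gt0 s0 n.
have M1 : M%:C != 0 :> R[i] by rewrite eq_complex /= negb_and gt_eqF.
apply: (mulfI M1); rewrite /corr -(Parseval s0 fP (L2FT_atomRn b a0 phiQ)).
rewrite mulrA -realCM mulrCA mulfV ?gt_eqF// mulr1.
rewrite /FT -cintZ; last by apply: cintg_phase; exact: cintg_slice.
apply: cint_ext => xi; rewrite !conjcM conjc_real conj_expi opprK mulNr opprK dotRnC /slice.
by ring.
Qed.

Lemma N2_corr a : absp a != 0 ->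
  N2 mu (corr f phi a) = ((absp a ^+ 2 / M)%:E * N2 mu (slice P Q a))%E.
Proof.
move=> a0; have M0 := massRn_gt0 s0 n; have sN0 : - s != 0 by rewrite oppr_eq0.
have iS := cintg_slice a0.
rewrite (@N2_ext _ _ _ _ _ _ (fun b => corr_FT b a0)) N2Z; last first.
  by apply: cmeas_FT; exact: cintg_cmeas iS.
rewrite N2_FT// massRnN muleA -EFinM; congr (_%:E * _)%E.
rewrite normc_real ger0_norm; last by rewrite divr_ge0 ?absp_ge0 ?ltW.
by field; rewrite gt_eqF.
Qed.

(** Plancherel's identity in the translation b turns the left-hand side into
    the integral of |P xi|^2 |Q(a xi)|^2 / |a|, from which the integral over a
    splits off by admissibility_scale. *)
Lemma energy_corr :
  (\int[mu]_a (((absp a ^+ 3)^-1)%:E * N2 mu (corr f phi a)) = N2 mu f * admissibility Q)%E.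
Proof.
have M0 := massRn_gt0 s0 n.
have A0 : (0 <= admissibility Q)%E.
  by apply: integral_ge0 => u _; rewrite lee_fin divr_ge0 ?sqr_ge0 ?absp_ge0.
have mS := cmeas_slice_joint mP mQ.
have mS2 : measurable_fun setT (fun p => (normc (slice_joint P Q p) ^+ 2)%:E).
  exact: measurable_normc2_EFin.
transitivity ((M^-1)%:E * N2 (mu \x mu)%E (slice_joint P Q))%E; last first.
  rewrite N2_slice_joint// (N2_L2FT s0 fP) !muleA -EFinM mulVf ?mul1e//.
  by rewrite gt_eqF.
rewrite /N2 fubini_tonelli2//; last by move=> p; rewrite lee_fin sqr_ge0.
have Mi0 : 0 <= M^-1 by rewrite invr_ge0 ltW.
rewrite -ge0_integralZl_EFin; last 4 first.
- exact: measurableT.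
- by move=> a _; apply: integral_ge0 => xi _; rewrite lee_fin sqr_ge0.
- by apply: measurable_fun_fubini_tonelli_G => // p; rewrite lee_fin sqr_ge0.
- exact: Mi0.
apply: ge0_ae_eq_integral => //.
- apply: emeasurable_funM.
    apply/measurable_EFinP; apply: (measurableT_comp measurable_inv).
    by apply: measurable_funX; exact: measurable_absp.
  apply: (@measurable_fun_fubini_tonelli_F _ _ _ _ _ mu (fun p => (normc (corr f phi p.1 p.2) ^+ 2)%:E)).
    by apply: measurable_normc2_EFin; exact: cmeas_corr.
  by move=> p; rewrite lee_fin sqr_ge0.
- apply: emeasurable_funM; first exact: measurable_cst.
  by apply: measurable_fun_fubini_tonelli_G => // p; rewrite lee_fin sqr_ge0.
- move=> a _; apply: mule_ge0; first by rewrite lee_fin invr_ge0 exprn_ge0// absp_ge0.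
  exact: N2_ge0.
- move=> a _; apply: mule_ge0; first by rewrite lee_fin invr_ge0 ltW.
  by apply: integral_ge0 => xi _; rewrite lee_fin sqr_ge0.
apply: filterS (ae_absp_neq0 n) => a a0 _.
rewrite -/(N2 mu (corr f phi a)) N2_corr// muleA -EFinM.
rewrite /fubini_G; under [in RHS]eq_integral do rewrite normc2_slice_joint EFinM.
rewrite ge0_integralZl_EFin ?invr_ge0 ?absp_ge0//; last 2 first.
- by move=> xi _; rewrite lee_fin sqr_ge0.
- by apply: measurable_normc2_EFin; exact: cmeas_slice.
rewrite muleA -EFinM; congr (_%:E * _)%E.
by field; rewrite a0 gt_eqF.
Qed.

End one_correlation.

Section two_correlations.
Variables (f phi P Q g psi P' Q' : V -> R[i]).
Hypotheses (fP : L2FT s f P) (phiQ : L2FT s phi Q).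
Hypotheses (gP : L2FT s g P') (psiQ : L2FT s psi Q').
Hypotheses (Qoo : (admissibility Q < +oo)%E) (Q'oo : (admissibility Q' < +oo)%E).

Let mf := L2FT_cmeas fP.
Let mphi := L2FT_cmeas phiQ.
Let mP := L2FT_cmeas_r fP.
Let mQ := L2FT_cmeas_r phiQ.
Let mg := L2FT_cmeas gP.
Let mpsi := L2FT_cmeas psiQ.
Let mP' := L2FT_cmeas_r gP.
Let mQ' := L2FT_cmeas_r psiQ.

Let kernel (p : V * V) : R[i] := slice_joint P Q p * (slice_joint P' Q' p)^*%C.

Let N2_slice_joint_lty (p q : V -> R[i]) : cmeas p -> cmeas q -> (N2 mu p < +oo)%E ->
  (admissibility q < +oo)%E -> (N2 (mu \x mu)%E (slice_joint p q) < +oo)%E.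
Proof.
move=> mp mq poo qoo; rewrite N2_slice_joint// lte_mul_pinfty ?N2_ge0//.
exact: N2_fin.
Qed.

Let Soo : (N2 (mu \x mu)%E (slice_joint P Q) < +oo)%E.
Proof. by apply: N2_slice_joint_lty => //; exact: L2FT_lty_r fP. Qed.

Let S'oo : (N2 (mu \x mu)%E (slice_joint P' Q') < +oo)%E.
Proof. by apply: N2_slice_joint_lty => //; exact: L2FT_lty_r gP. Qed.

Let kernel_cintg : cintg (mu \x mu)%E kernel.
Proof.
apply: cintg_mul; rewrite ?N2_conj//; first exact: cmeas_slice_joint.
by apply: cmeas_conj; exact: cmeas_slice_joint.
Qed.

Let kernelE xi a : kernel (xi, a) = ((absp a)^-1)%:C * (slice P Q a xi * (slice P' Q' a xi)^*%C).
Proof.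
rewrite /kernel /slice_joint /= conjcM conjc_real.
rewrite -{3}(sqr_sqrtr (absp_ge0 a)) expr2 invfM realCM; ring.
Qed.

Let slice_lty (p q : V -> R[i]) : cmeas p -> cmeas q ->
    (N2 (mu \x mu)%E (slice_joint p q) < +oo)%E ->
  {ae mu, forall a, absp a != 0 -> (N2 mu (slice p q a) < +oo)%E}.
Proof.
move=> mp mq /(ae_N2_section (cmeas_slice_joint mp mq)); apply: filterS => a aoo a0.
have agt0 : 0 < absp a by rewrite lt_def a0 absp_ge0.
rewrite (@N2_ext _ _ _ _ _ (fun xi => (Num.sqrt (absp a))%:C * slice_joint p q (xi, a))).
  apply: N2Z_lty => //.
  by apply: (cmeas_comp (cmeas_slice_joint mp mq)); exact: pair2_measurable.
move=> xi; rewrite mulrA -realCM mulfV ?mul1r//.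
by rewrite gt_eqF// sqrtr_gt0.
Qed.

Let ae_good : {ae mu, forall a, [/\ absp a != 0, (N2 mu (slice P Q a) < +oo)%E &
  (N2 mu (slice P' Q' a) < +oo)%E]}.
Proof.
have h1 := slice_lty mP mQ Soo; have h2 := slice_lty mP' mQ' S'oo.
have h3 := ae_absp_neq0 (R := R) n.
by apply: (filterS3 _ _ h1 h2 h3) => a k1 k2 a0; split => //; [exact: k1|exact: k2].
Qed.

Lemma ae_cintg_corr : {ae mu, forall a, absp a != 0 ->
  cintg mu (fun b => corr f phi a b * (corr g psi a b)^*%C)}.
Proof.
apply: filterS ae_good => a [_ h1 h2] a0.
have cm u v : cmeas u -> cmeas v -> cmeas (corr u v a).
  by move=> mu_ mv; exact: (cmeas_comp (cmeas_corr mu_ mv) (pair1_measurable a)).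
apply: cintg_mul; [exact: cm|by apply: cmeas_conj; exact: cm| |rewrite N2_conj].
- rewrite (N2_corr fP phiQ a0); apply: lte_mul_pinfty => //.
  by rewrite lee_fin divr_ge0 ?sqr_ge0 ?ltW ?massRn_gt0.
- rewrite (N2_corr gP psiQ a0); apply: lte_mul_pinfty => //.
  by rewrite lee_fin divr_ge0 ?sqr_ge0 ?ltW ?massRn_gt0.
Qed.

Let outer a : R[i] :=
  cint mu (fun b => ((absp a ^+ 3)^-1)%:C * (corr f phi a b * (corr g psi a b)^*%C)).

Let outer_cmeas : cmeas outer.
Proof.
apply: (cmeas_cint mu (f := fun p => ((absp p.1 ^+ 3)^-1)%:C *
  (corr f phi p.1 p.2 * (corr g psi p.1 p.2)^*%C))).
apply: cmeasM; last by apply: cmeasM; [exact: cmeas_corr|apply: cmeas_conj; exact: cmeas_corr].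
apply: cmeas_real; apply: (measurableT_comp measurable_inv); apply: measurable_funX.
by apply: (measurableT_comp (f := @absp R n)) => //; exact: measurable_absp.
Qed.

Let outer_ae : {ae mu, forall a, outer a = (M^-1)%:C * cint mu (fun xi => kernel (xi, a))}.
Proof.
apply: filterS2 ae_good ae_cintg_corr => a [a0 h1 h2] /(_ a0) iC; have M0 := massRn_gt0 s0 n.
have sN0 : - s != 0 by rewrite oppr_eq0.
have L1 : L12 mu (slice P Q a) by split => //; exact: (cintg_slice fP phiQ a0).
have L2 : L12 mu (slice P' Q' a) by split => //; exact: (cintg_slice gP psiQ a0).
have i12 : cintg mu (fun xi => slice P Q a xi * (slice P' Q' a xi)^*%C).
  apply: cintg_mul; rewrite ?N2_conj//; first exact: cintg_cmeas L1.1.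
  by apply: cmeas_conj; exact: cintg_cmeas L2.1.
rewrite (@cint_ext _ _ _ _ (fun xi => kernel (xi, a)) _ (kernelE^~ a)) cintZ//.
rewrite /outer cintZ// (@cint_ext _ _ _ _ _ (fun b => ((absp a / M) ^+ 2)%:C *
   (FT (- s) (slice P Q a) b * (FT (- s) (slice P' Q' a) b)^*%C))); last first.
  move=> b; rewrite (corr_FT fP phiQ b a0) (corr_FT gP psiQ b a0) conjcM conjc_real.
  by rewrite expr2 realCM; ring.
rewrite cintZ; last first.
  apply: cintg_mul; rewrite ?N2_conj//; last 2 first.
  - exact: N2_FT_lty.
  - exact: N2_FT_lty.
  - by apply: cmeas_FT; exact: cintg_cmeas L1.1.
  - by apply: cmeas_conj; apply: cmeas_FT; exact: cintg_cmeas L2.1.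
rewrite Parseval_L12// massRnN !mulrA -!realCM; congr (_%:C * _).
by field; rewrite a0 gt_eqF.
Qed.

Let kernel_cint_cintg : cintg mu (fun a => (M^-1)%:C * cint mu (fun xi => kernel (xi, a))).
Proof. by apply: cintgZ; exact: cintg_cint2. Qed.

(** The inner integral is, up to a constant, the integral in xi of a kernel that
    is integrable over all (xi, a) as a product of two square-integrable
    functions. *)
Lemma cintg_corr2 : cintg mu outer.
Proof. exact: (cintg_ae outer_cmeas kernel_cint_cintg outer_ae). Qed.

(** The polarized form of energy_corr; Fubini's theorem for the kernel takes the
    place of Tonelli's. *)
Lemma cint_corr2 :
  cint mu outer = admissibility2 Q Q' * cint mu (fun t => f t * (g t)^*%C).
Proof.
have M0 := massRn_gt0 s0 n.
rewrite (cint_ae outer_cmeas (cintg_cmeas kernel_cint_cintg) outer_ae).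
rewrite cintZ; last exact: cintg_cint2.
rewrite -(cint_prod21 kernel_cintg) (cint_prod12 kernel_cintg).
have iPP : cintg mu (fun xi => P xi * (P' xi)^*%C).
  apply: cintg_mul; rewrite ?N2_conj//; first exact: cmeas_conj.
  - exact: L2FT_lty_r fP.
  - exact: L2FT_lty_r gP.
rewrite (@cint_ae _ _ _ _ _ (fun xi => admissibility2 Q Q' * (P xi * (P' xi)^*%C))).
- rewrite cintZ// (Parseval s0 fP gP) mulrCA; congr (_ * _).
  by rewrite mulrA -realCM mulVf ?mul1r// gt_eqF.
- exact: (cmeas_cint mu (cintg_cmeas kernel_cintg)).
- by apply: cmeasM; [exact: cmeas_cst|exact: cintg_cmeas iPP].
apply: filterS (ae_absp_neq0 n) => xi xi0.
rewrite -(admissibility2_scale mQ mQ' xi0) [RHS]mulrC.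
rewrite -cintZ.
  by apply: cint_ext => a; rewrite kernelE /slice !conjcM conjcK; ring.
have ms : measurable_fun [set: V] (fun a => scaleRn a xi).
  by under eq_fun do rewrite scaleRnC; exact: measurable_scaleRn.
apply: cintg_admissibility2; [exact: (cmeas_comp mQ ms)|exact: (cmeas_comp mQ' ms)| |].
- by rewrite /admissibility admissibility_scale.
- by rewrite /admissibility admissibility_scale.
Qed.

End two_correlations.
End correlation.

(** * Integrals over the vectors without zero coordinate *)

Section R0n_integrals.
Context {R : realType} {n : nat}.
Local Notation V := (Rn R n).
Local Notation mu := (lebesgue_Rn R n).

Lemma measurable_R0n : measurable (R0n : set V).
Proof.
have -> : R0n = ~` ((@absp R n) @^-1` [set 0]).
  by apply/seteqP; split => a /= /eqP.
by apply: measurableC; rewrite -[X in measurable X]setTI; exact: measurable_absp.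
Qed.

(** The weights 1/|a| extend by 0 where |a| vanishes, the inverse of 0 being 0,
    so that integrals over R0n are integrals over the whole space. *)
Lemma ge0_integral_R0n (f g : V -> \bar R) : (forall a, R0n a -> f a = g a) ->
  (forall a, absp a = 0 -> g a = 0%E) ->
  (\int[mu]_(a in R0n) f a = \int[mu]_a g a)%E.
Proof.
move=> fg g0; rewrite integral_mkcond; apply: eq_integral => a _; rewrite patchE.
have [/set_mem|/negP aN] := boolP (a \in R0n); first exact: fg.
by rewrite g0//; apply/eqP/negPn/negP => a0; apply: aN; exact: mem_set.
Qed.

Lemma cintegral_R0n (f g : V -> R[i]) : (forall a, R0n a -> f a = g a) ->
  (forall a, absp a = 0 -> g a = 0) -> cintegral R0n f = cint mu g.
Proof.
move=> fg g0.
apply: ReIm_inj; rewrite /= ?Re_cint ?Im_cint Rintegral_mkcond; congr fine;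
  apply: eq_integral => a _; congr EFin; rewrite patchE;
  (have [/set_mem|/negP aN] := boolP (a \in R0n); first by move=> /fg /= ->);
  by rewrite /= g0//; apply/eqP/negPn/negP => a0; apply: aN; exact: mem_set.
Qed.

Lemma cintegrable_R0n (f g : V -> R[i]) : (forall a, R0n a -> f a = g a) ->
  cintg mu g -> cintegrable R0n f.
Proof.
move=> fg [rg ig]; have m0 := measurable_R0n; split.
- apply: (@eq_integrable _ _ _ _ _ m0 (EFin \o (Re \o g))).
    by move=> a /set_mem /fg /= ->.
  exact: (integrableS measurableT).
- apply: (@eq_integrable _ _ _ _ _ m0 (EFin \o (Im \o g))).
    by move=> a /set_mem /fg /= ->.
  exact: (integrableS measurableT).
Qed.

End R0n_integrals.

(** * Lebesgue norms *)

Section Lp_norms.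
Context {R : realType} {n : nat}.
Local Notation V := (Rn R n).
Local Notation mu := (lebesgue_Rn R n).
Implicit Types f : V -> R[i].

Lemma cLnorm_ge0 p f : (0 <= cLnorm p f)%E.
Proof. exact: Lnorm_ge0. Qed.

Lemma N2_cLnorm f : N2 mu f = (cLnorm 2%:E f * cLnorm 2%:E f)%E.
Proof. exact: N2_Lnorm. Qed.

Lemma cLnorm2_lty f : (cLnorm 2%:E f < +oo)%E <-> (N2 mu f < +oo)%E.
Proof.
rewrite N2_cLnorm; have := cLnorm_ge0 2%:E f.
by case: (cLnorm _ _) => [x|_|//] /=; [rewrite !ltry|rewrite mulyy].
Qed.

Lemma inLp2P f : inLp 2%:E f <-> cmeas f /\ (N2 mu f < +oo)%E.
Proof. by split=> -[mf] /cLnorm2_lty foo. Qed.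

Lemma inLp1P f : inLp 1%:E f <-> cintg mu f.
Proof.
have e : cLnorm 1%:E f = (\int[mu]_t (normc (f t))%:E)%E.
  rewrite /cLnorm Lnorm1; apply: eq_integral => t _ /=.
  by rewrite ger0_norm ?normc_ge0.
by split=> [[mf]|/cintgP[mf]]; rewrite ?e => foo; [apply/cintgP|split; rewrite ?e].
Qed.

Lemma cvg_cLnorm2 (u : nat -> V -> R[i]) :
  cLnorm 2%:E (u k) @[k --> \oo] --> 0%E <-> N2 mu (u k) @[k --> \oo] --> 0%E.
Proof.
split=> u0.
  under eq_fun do rewrite N2_cLnorm.
  by rewrite -(mule0 0%E); apply: cvgeM.
have fin : \forall k \near \oo, N2 mu (u k) \is a fin_num by exact: cvg_is_fine u0.
have sqE : (Num.sqrt (fine (N2 mu (u k))))%:E @[k --> \oo] --> 0%E.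
  by apply: cvg_EFin; [exact: nearW|exact: cvg_sqrt_fine u0].
apply: cvg_trans sqE; apply: near_eq_cvg; apply: filterS fin => k.
rewrite /= N2_cLnorm; have := cLnorm_ge0 2%:E (u k).
case: (cLnorm _ _) => [x|_|//] /=; last by rewrite mulyy.
by rewrite lee_fin => x0 _; rewrite -expr2 sqrtr_sqr ger0_norm.
Qed.

End Lp_norms.

(** * The fractional Fourier and wavelet transforms *)

Section fractional.
Context {R : realType} (n : nat) (alpha : R).
Hypothesis alpha_notin : forall k : int, alpha <> k%:~R * pi.
Local Notation V := (Rn R n).
Local Notation mu := (lebesgue_Rn R n).
Local Notation C := (Calpha n alpha).
Implicit Types f g phi psi P Q : V -> R[i].

Lemma sin_intpi (k : int) : sin (k%:~R * pi : R) = 0.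
Proof.
have nat_pi (m : nat) : sin (m%:R * pi : R) = 0.
  elim: m => [|m IH]; first by rewrite mul0r sin0.
  by rewrite -addn1 natrD mulrDl mul1r sinD IH sinpi mul0r mulr0 addr0.
case: (intP k) => [|m|m]; first by rewrite mul0r sin0.
- exact: nat_pi.
- by rewrite mulrNz mulNr sinN nat_pi oppr0.
Qed.

(** The sine is positive on ]0, pi[, and translating by multiples of pi only
    affects its sign. *)
Lemma sin_neq0 : sin alpha != 0.
Proof.
apply/eqP => s0; have pi0 : 0 < pi :> R := pi_gt0 R.
pose k := Num.floor (alpha / pi).
have x0 : sin (alpha - k%:~R * pi) = 0.
  by rewrite sinB s0 sin_intpi mul0r mulr0 subr0.
have [l u] : k%:~R <= alpha / pi /\ alpha / pi < k%:~R + 1.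
  by split; [exact: Num.Theory.floor_le_tmp|rewrite -intrD1; exact: Num.Theory.floorD1_gt].
have : 0 < sin (alpha - k%:~R * pi).
  apply: sin_gt0_pi; apply/andP; split.
    rewrite subr_gt0 lt_def -ler_pdivlMr// l andbT; apply/eqP; exact: alpha_notin.
  by rewrite ltrBlDr (_ : pi + _ = (k%:~R + 1) * pi) -?ltr_pdivrMr//; ring.
by rewrite x0 ltxx.
Qed.

Lemma csc_neq0 : csc alpha != 0.
Proof. by rewrite invr_eq0 sin_neq0. Qed.

Lemma normc_Calpha_gt0 : 0 < normc C.
Proof.
rewrite /Calpha /cpowR normcM normc_expi mulr1 normc_real ger0_norm ?powR_ge0//.
rewrite powR_gt0// lt_def normc_ge0 andbT; apply/eqP => /normc_eq0 /eqP.
rewrite mulf_eq0 invr_eq0 !eq_complex /= oner_eq0 /= eqxx andbT.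
by rewrite mulf_eq0 pnatr_eq0 /= gt_eqF// pi_gt0.
Qed.

Lemma Calpha_neq0 : C != 0.
Proof.
apply/eqP => C0; have := normc_Calpha_gt0; by rewrite C0 normc0 ltxx.
Qed.

Let gauss (t : V) : R := normRn t ^+ 2 * cot alpha / 2.

Definition dechirp f (t : V) : R[i] := expi (normRn t ^+ 2 * cot alpha / 2) * f t.

Lemma normRn_sqr (t : V) : normRn t ^+ 2 = dotRn t t.
Proof. by rewrite sqr_sqrtr//; apply: sumr_ge0 => i _; rewrite -expr2 sqr_ge0. Qed.

Lemma measurable_gauss : measurable_fun [set: V] gauss.
Proof.
rewrite /gauss; under eq_fun do rewrite normRn_sqr -mulrA.
apply: measurable_funM; last exact: measurable_cst.
by apply: measurable_sum => i; apply: measurable_funM; exact: measurable_coord.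
Qed.

Lemma cmeas_gauss : cmeas (fun t : V => expi (normRn t ^+ 2 * cot alpha / 2)).
Proof. exact: (cmeas_expi measurable_gauss). Qed.

Lemma cmeas_gaussN : cmeas (fun t : V => expi (- (normRn t ^+ 2 * cot alpha / 2))).
Proof. by apply: cmeas_expi; apply: measurableT_comp => //; exact: measurable_gauss. Qed.

Lemma chirpK f : dechirp (chirp alpha f) = f.
Proof. by apply/funext => t; rewrite /dechirp /chirp mulrA -expiD subrr expi0 mul1r. Qed.

Lemma N2_chirpM (u : V -> R) f : N2 mu (fun t => expi (u t) * f t) = N2 mu f.
Proof. by apply: eq_integral => t _; rewrite normcM normc_expi mul1r. Qed.

Lemma cmeas_dechirp f : cmeas f -> cmeas (dechirp f).
Proof. by move=> mf; apply: cmeasM => //; exact: cmeas_gauss. Qed.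

Lemma L12_expiM (u : V -> R) f : cmeas (fun t => expi (u t)) -> L12 mu f ->
  L12 mu (fun t => expi (u t) * f t).
Proof.
move=> mu_ [/cintgP[mf fi] foo]; split; last by rewrite N2_chirpM.
apply/cintgP; split; first exact: cmeasM.
by under eq_integral do rewrite normcM normc_expi mul1r.
Qed.

(** The chirp of the kernel in the time variable cancels against the chirp put
    on the signal. *)
Lemma FrFT_L1E f xi : cintg mu (dechirp f) ->
  FrFT_L1 alpha f xi =
  C * (expi (normRn xi ^+ 2 * cot alpha / 2) * FT (csc alpha) (dechirp f) xi).
Proof.
move=> fi; rewrite /FrFT_L1 -[cintegral _ _]/(cint mu _) mulrA /FT -cintZ; last exact: cintg_phase.
apply: cint_ext => t; rewrite /Kalpha /dechirp.
have -> : (normRn t ^+ 2 + normRn xi ^+ 2) * cot alpha / 2 - dotRn t xi * csc alpha =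
  normRn xi ^+ 2 * cot alpha / 2 + (normRn t ^+ 2 * cot alpha / 2 + - (csc alpha * dotRn t xi)).
  by ring.
by rewrite !expiD; ring.
Qed.

Lemma N2_ZexpiM (c : R[i]) (u : V -> R) f : cmeas f ->
  N2 mu (fun t => c * (expi (u t) * f t)) = ((normc c ^+ 2)%:E * N2 mu f)%E.
Proof.
move=> mf; rewrite -(N2Z mu c mf); apply: eq_integral => t _.
by rewrite !normcM normc_expi mul1r.
Qed.

(** Existence of the fractional transform, from that of the L^2 Fourier
    transform; FrFT is then not the default value of the choice. *)
Lemma FrFT_L2_exists phi Q : L2FT (csc alpha) phi Q ->
  is_FrFT_L2 alpha (chirp alpha phi)
    (fun u => C * (expi (normRn u ^+ 2 * cot alpha / 2) * Q u)).
Proof.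
move=> phiQ; have mQ := L2FT_cmeas_r phiQ; split.
  apply/inLp2P; split.
    by apply: cmeasM; [exact: cmeas_cst|apply: cmeasM => //; exact: cmeas_gauss].
  rewrite N2_ZexpiM//; apply: lte_mul_pinfty; rewrite ?lee_fin ?sqr_ge0//.
  exact: L2FT_lty_r phiQ.
move=> h hL /cvg_cLnorm2 h0; apply/cvg_cLnorm2.
have dL k : L12 mu (dechirp (h k)).
  have [/inLp1P h1 /inLp2P[_ h2]] := hL k.
  by apply: L12_expiM => //; exact: cmeas_gauss.
have := L2FT_seq csc_neq0 phiQ dL.
have -> : (fun k => N2 mu (fun t => dechirp (h k) t - phi t)) =
          (fun k => N2 mu (h k \- chirp alpha phi)).
  apply/funext => k; rewrite -[RHS](N2_chirpM gauss); apply: N2_ext => t.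
  by rewrite /= mulrBr -/(dechirp (h k) t) -/(dechirp (chirp alpha phi) t) chirpK.
move=> /(_ h0) /(cvgeZl (erefl : (normc C ^+ 2)%:E \is a fin_num)).
rewrite mule0; apply: cvg_trans; apply: near_eq_cvg; apply: nearW => k.
rewrite -(N2_ZexpiM C (fun u => normRn u ^+ 2 * cot alpha / 2)); last first.
  by apply: cmeasB => //; apply: cmeas_FT; exact: cintg_cmeas (dL k).1.
by apply: N2_ext => u /=; rewrite FrFT_L1E ?mulrBr//; exact: (dL k).1.
Qed.

(** FrFT is an unspecified representative of its class. Removing the factors in
    front of it leaves a Fourier transform of phi in the sense of L2FT, so that
    representatives need not be compared. *)
Lemma FrFT_chirp phi : inLp 2%:E phi -> exists2 Q, L2FT (csc alpha) phi Q &
  forall u, FrFT alpha (chirp alpha phi) u =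
            C * (expi (normRn u ^+ 2 * cot alpha / 2) * Q u).
Proof.
move=> /inLp2P[mphi phioo]; have [P phiP] := L2FT_exists csc_neq0 mphi phioo.
have := xgetPex (fun=> 0) (ex_intro _ _ (FrFT_L2_exists phiP)).
rewrite -/(FrFT alpha (chirp alpha phi)); set F := FrFT _ _ => -[/inLp2P[mF Foo] Flim].
pose Q u := C^-1 * (expi (- (normRn u ^+ 2 * cot alpha / 2)) * F u).
have FE u : F u = C * (expi (normRn u ^+ 2 * cot alpha / 2) * Q u).
  rewrite /Q [expi _ * (C^-1 * _)]mulrCA mulVKf ?Calpha_neq0// mulrA -expiD subrr.
  by rewrite expi0 mul1r.
exists Q => //; have mQ : cmeas Q.
  by apply: cmeasM; [exact: cmeas_cst|apply: cmeasM => //; exact: cmeas_gaussN].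
have [g [gL gphi]] := L12_dense mphi phioo.
have mg k : cmeas (g k) by exact: cintg_cmeas (gL k).1.
split => //.
  by rewrite N2_ZexpiM//; apply: lte_mul_pinfty; rewrite ?lee_fin ?sqr_ge0.
exists g; split => //.
have cL k : inLp 1%:E (chirp alpha (g k)) /\ inLp 2%:E (chirp alpha (g k)).
  have [gi goo] : L12 mu (chirp alpha (g k)) by apply: L12_expiM => //; exact: cmeas_gaussN.
  by split; [exact/inLp1P|apply/inLp2P; split => //; exact: cintg_cmeas gi].
have := Flim _ cL; rewrite !cvg_cLnorm2.
have -> : (fun k => N2 mu (chirp alpha (g k) \- chirp alpha phi)) =
          (fun k => N2 mu (fun t => g k t - phi t)).
  apply/funext => k; rewrite -[RHS](N2_chirpM (fun t => - gauss t)); apply: N2_ext => t.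
  by rewrite /= mulrBr.
move=> /(_ gphi) /(cvgeZl (erefl : ((normc C ^+ 2)^-1)%:E \is a fin_num)).
rewrite mule0; apply: cvg_trans; apply: near_eq_cvg; apply: nearW => k.
have C2 : normc C ^+ 2 != 0 by rewrite gt_eqF// exprn_gt0// normc_Calpha_gt0.
transitivity (((normc C ^+ 2)^-1)%:E * ((normc C ^+ 2)%:E * N2 mu (fun u => FT (csc alpha) (g k) u - Q u)%R))%E.
  rewrite -(N2_ZexpiM C (fun u => normRn u ^+ 2 * cot alpha / 2)); last first.
    by apply: cmeasB => //; exact: cmeas_FT.
  congr (_ * _)%E; apply: N2_ext => u /=.
  by rewrite FrFT_L1E ?chirpK ?FE ?mulrBr//; exact: (gL k).1.
by rewrite muleA -EFinM mulVf// mul1e.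
Qed.

Section transform.
Variables (f phi : V -> R[i]).
Hypotheses (f2 : inLp 2%:E f) (phi2 : inLp 2%:E phi).

Let atom_cintg a b : absp a != 0 ->
  cintg mu (fun t => dechirp f t * (phi (atomRn a b t))^*%C).
Proof.
move=> a0; have [/inLp2P[mf foo] /inLp2P[mphi phioo]] := (f2, phi2).
apply: cintg_mul; first exact: cmeas_dechirp.
- by apply: cmeas_conj; exact: cmeas_atomRn.
- by rewrite N2_chirpM.
- by rewrite N2_conj N2_atomRn//; apply: lte_mul_pinfty; rewrite // lee_fin absp_ge0.
Qed.

Let atom_conj a b t : f t * (wavelet_atom alpha phi a b t)^*%C =
  ((Num.sqrt (absp a))^-1)%:C * expi (- (normRn b ^+ 2 * cot alpha / 2)) *
  (dechirp f t * (phi (atomRn a b t))^*%C).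
Proof.
rewrite /wavelet_atom /dechirp !conjcM conj_expi opprK conjc_real.
have -> : (normRn t ^+ 2 - normRn b ^+ 2) * cot alpha / 2 =
  normRn t ^+ 2 * cot alpha / 2 + - (normRn b ^+ 2 * cot alpha / 2) by ring.
by rewrite expiD /atomRn; ring.
Qed.

(** The chirp of the atom in t moves to f, and the one in b comes out as a phase. *)
Lemma CFrWTE a b : absp a != 0 -> CFrWT alpha phi f b a =
  ((Num.sqrt (absp a))^-1)%:C * expi (- (normRn b ^+ 2 * cot alpha / 2)) *
  corr (dechirp f) phi a b.
Proof.
move=> a0; rewrite /corr -cintZ; last exact: atom_cintg.
exact: (cint_ext mu (atom_conj a b)).
Qed.

Lemma cintg_CFrWT a b : absp a != 0 ->
  cintg mu (fun t => f t * (wavelet_atom alpha phi a b t)^*%C).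
Proof.
by move=> a0; rewrite (funext (atom_conj a b)); apply: cintgZ; exact: atom_cintg.
Qed.

End transform.

(** By energy_corr for psi against itself, the integral in the definition of a
    wavelet is N2 psi times the Calderon integral, and N2 psi is not 0. *)
Lemma wavelet_admissibility psi Q : wavelet alpha psi -> L2FT (csc alpha) psi Q ->
  (admissibility Q < +oo)%E.
Proof.
move=> [psi2 psiN0 fin] psiQ; have [mpsi psioo] := (inLp2P psi).1 psi2.
have dpsioo : (N2 mu (dechirp psi) < +oo)%E by rewrite N2_chirpM.
have [P psiP] := L2FT_exists csc_neq0 (cmeas_dechirp mpsi) dpsioo.
have pos : (0 < N2 mu psi)%E.
  rewrite lt_def N2_ge0 andbT; apply/eqP => psi0; apply: psiN0.
  have : (\int[mu]_t `|(normc (psi t) ^+ 2)%:E| = 0)%E.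
    by rewrite -psi0; apply: eq_integral => t _; rewrite /= ger0_norm ?sqr_ge0.
  move/ae_eq_integral_abs => /(_ measurableT).
  have m2 : measurable_fun [set: V] (fun t => (normc (psi t) ^+ 2)%:E).
    exact: measurable_normc2_EFin.
  move=> /(_ m2); apply: filterS => t /(_ I) [] /eqP; rewrite sqrf_eq0 => /eqP.
  exact: normc_eq0.
have A0 : (0 <= admissibility Q)%E.
  by apply: integral_ge0 => u _; rewrite lee_fin divr_ge0 ?sqr_ge0 ?absp_ge0.
have := energy_corr csc_neq0 psiP psiQ; rewrite N2_chirpM => energy.
have : (N2 mu psi * admissibility Q < +oo)%E.
  rewrite -energy; apply: le_lt_trans fin; rewrite le_eqVlt; apply/orP; left; apply/eqP/esym.
  apply: ge0_integral_R0n => [a a0|a a0]; last by rewrite a0 expr0n invr0 mul0e.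
  rewrite -ge0_integralZl_EFin ?invr_ge0 ?exprn_ge0 ?absp_ge0//; last 2 first.
  - by move=> b _; rewrite lee_fin sqr_ge0.
  - apply/measurable_EFinP; apply: measurable_normc2.
    have := cmeas_corr (cmeas_dechirp mpsi) mpsi.
    by move=> h; exact: (cmeas_comp h (pair1_measurable a)).
  apply: eq_integral => b _; rewrite -EFinM; congr EFin.
  have -> : cdotL2 (wavelet_atom alpha psi a b) psi = (CFrWT alpha psi psi b a)^*%C.
    rewrite /CFrWT /cdotL2 -[cintegral _ _]/(cint mu _) -[cintegral _ _]/(cint mu _).
    rewrite -cint_conj; last exact: cintg_CFrWT.
    by apply: cint_ext => t; rewrite conjcM conjcK mulrC.
  rewrite normc_conj CFrWTE// !normcM normc_expi mulr1 normc_real.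
  rewrite ger0_norm ?invr_ge0 ?sqrtr_ge0// exprMn exprVn sqr_sqrtr ?absp_ge0//.
  by field; exact: a0.
by rewrite -(fineK (N2_fin psioo)); apply: lty_pmull => //; rewrite fine_gt0 ?pos.
Qed.

End fractional.

(** * The orthogonality relation *)

Theorem theorem3p2 (R : realType) (n : nat) (alpha : R)
    (phi psi f g : Rn R n -> R[i]) :
  (0 < n)%N ->
  (forall k : int, alpha <> k%:~R * pi) ->
  wavelet alpha phi ->
  wavelet alpha psi ->
  (\int[lebesgue_Rn R n]_(u in R0n)
     (normc (FrFT alpha (chirp alpha phi) u)
      * normc (FrFT alpha (chirp alpha psi) u) / absp u)%:E < +oo)%E ->
  inLp 2%:E f ->
  inLp 2%:E g ->
  let integrand (a b : Rn R n) : R[i] :=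
    CFrWT alpha phi f b a * (CFrWT alpha psi g b a)^*%C
    * ((absp a ^+ 2)^-1)%:C in
  [/\ {ae lebesgue_Rn R n,
         forall a, R0n a -> cintegrable setT (integrand a)},
      cintegrable R0n (fun a => cintegral setT (integrand a)) &
      cintegral R0n (fun a => cintegral setT (integrand a)) =
      Cphipsi alpha phi psi / (normc (Calpha n alpha) ^+ 2)%:C * cdotL2 f g].
Proof.
move=> _ alpha_notin wphi wpsi _ f2 g2 integrand.
have [[phi2 _ _] [psi2 _ _]] := (wphi, wpsi).
have [[mf foo] [mg goo]] := ((inLp2P f).1 f2, (inLp2P g).1 g2).
have s0 := csc_neq0 alpha_notin.
have [Q phiQ FrFTphi] := FrFT_chirp alpha_notin phi2.
have [Q' psiQ' FrFTpsi] := FrFT_chirp alpha_notin psi2.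
have [dfoo dgoo] : (N2 (lebesgue_Rn R n) (dechirp alpha f) < +oo)%E /\
    (N2 (lebesgue_Rn R n) (dechirp alpha g) < +oo)%E by rewrite !N2_chirpM.
have [P fP] := L2FT_exists s0 (cmeas_dechirp alpha mf) dfoo.
have [P' gP'] := L2FT_exists s0 (cmeas_dechirp alpha mg) dgoo.
have Qoo := wavelet_admissibility alpha_notin wphi phiQ.
have Q'oo := wavelet_admissibility alpha_notin wpsi psiQ'.
(* The phases in b cancel in the product, and the two factors |a|^(-1/2) join
   the weight 1/|a|^2. *)
have integrandE a : R0n a -> integrand a = (fun b => ((absp a ^+ 3)^-1)%:C *
    (corr (dechirp alpha f) phi a b * (corr (dechirp alpha g) psi a b)^*%C)).
  move=> a0; apply/funext => b; rewrite /integrand (CFrWTE alpha f2 phi2 b a0) (CFrWTE alpha g2 psi2 b a0).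
  rewrite !conjcM conj_expi opprK conjc_real.
  set w := normRn b ^+ 2 * cot alpha / 2; set u := corr _ _ _ _; set v := corr _ _ _ _.
  rewrite [LHS](_ : _ = ((Num.sqrt (absp a))^-1)%:C * ((Num.sqrt (absp a))^-1)%:C *
    ((absp a ^+ 2)^-1)%:C * (expi (- w) * expi w) * (u * v^*%C)); last by ring.
  rewrite -expiD addNr expi0 mulr1 -!realCM -invfM -expr2 sqr_sqrtr ?absp_ge0//.
  by rewrite -invfM -exprS.
split.
- apply: filterS (ae_cintg_corr s0 fP phiQ gP' psiQ' Qoo Q'oo) => a ai a0.
  by rewrite integrandE//; apply: cintgZ; exact: ai.
- apply: (cintegrable_R0n _ (cintg_corr2 s0 fP phiQ gP' psiQ' Qoo Q'oo)) => a a0.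
  by rewrite integrandE.
rewrite (cintegral_R0n (g := fun a => cint (lebesgue_Rn R n) (fun b => ((absp a ^+ 3)^-1)%:C *
    (corr (dechirp alpha f) phi a b * (corr (dechirp alpha g) psi a b)^*%C)))); last 2 first.
- by move=> a a0; rewrite integrandE.
- move=> a a0; rewrite -[RHS](cint0 (lebesgue_Rn R n)); apply: cint_ext => b.
  by rewrite a0 expr0n invr0 mul0r.
rewrite (cint_corr2 s0 fP phiQ gP' psiQ' Qoo Q'oo); congr (_ * _); last first.
  apply: cint_ext => t; rewrite /dechirp conjcM conj_expi.
  by rewrite mulrACA -expiD subrr expi0 mul1r.
have C0 : (normc (Calpha n alpha) ^+ 2)%:C != 0 :> R[i].
  by rewrite eq_complex /= negb_and gt_eqF ?(exprn_gt0 2 (normc_Calpha_gt0 n alpha)).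
apply: (canRL (mulfK C0)); rewrite mulrC /admissibility2 -cintZ; last first.
  exact: (cintg_admissibility2 (L2FT_cmeas_r phiQ) (L2FT_cmeas_r psiQ') Qoo Q'oo).
apply/esym/cintegral_R0n => [u _|u u0]; last by rewrite u0 invr0 !mulr0.
rewrite FrFTphi FrFTpsi; move: (Calpha n alpha) => C.
rewrite (conjcM C) (conjcM (expi _)) conj_expi -mulc_conj.
set w := normRn u ^+ 2 * cot alpha / 2.
rewrite [LHS](_ : _ = C * C^*%C * (expi w * expi (- w)) *
  ((Q u)^*%C * Q' u * ((absp u)^-1)%:C)); last by ring.
by rewrite -expiD subrr expi0 mulr1.
Qed.
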